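(* Suppose $\frac{d\nu}{d\nu_\rho}\in L^\infty_{\mathcal H}(X,\nu)$ and $\frac{d\nu}{d\nu_\rho}(x)$ is invertible a.e. If $f\in L^1_{\mathcal H}(X,\nu)$ and $g\in L^\infty_{\mathcal H}(X,\nu)$, then $f\otimes g\in L^1_{\mathcal H\otimes\mathcal H}(X,\nu\otimes_{\nu_\rho}\nu)$, with $$\|f\otimes g\|_1\le 2\Big\|\frac{d\nu}{d\nu_\rho}\Big\|_\infty\|f\|_1\,\|g\|_\infty$$ and $$\|f\otimes g\|_{1,dec}\le\Big\|\frac{d\nu}{d\nu_\rho}\Big\|_\infty\|f\|_{1,dec}\,\|g\|_\infty.$$
   Context: Setting. $\mathcal H$ is a finite-dimensional or separable Hilbert space, $X$ is a locally compact Hausdorff space, and $\mathcal O(X)$ is the Borel $\sigma$-algebra of $X$. $\mathcal S(\mathcal H)$ is the set of positive trace-one operators in $\mathcal B(\mathcal H)$ (states). $\nu:\mathcal O(X)\to\mathcal B(\mathcal H)$ is a positive operator-valued measure (POVM): $\nu(E)\ge 0$ for all $E$, and $\nu$ is countably additive on disjoint Borel sets in the ultraweak topology ($A_n\to A$ ultraweakly iff $\operatorname{Tr}(sA_n)\to\operatorname{Tr}(sA)$ for all $s\in\mathcal S(\mathcal H)$). Fix a full-rank (trivial null space) $\rho\in\mathcal S(\mathcal H)$ and put $\nu_\rho(E)=\operatorname{Tr}(\rho\,\nu(E))$, a finite positive measure mutually absolutely continuous with $\nu$. For an orthonormal basis $\{e_i\}$ put $\nu_{ij}(E)=\langle\nu(E)e_j,e_i\rangle$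 and $\frac{d\nu}{d\nu_\rho}=\big[\frac{d\nu_{ij}}{d\nu_\rho}\big]_{i,j}$, assumed to be a bounded operator a.e.; it is then positive a.e. ''Almost everywhere'' means with respect to $\nu$, equivalently $\nu_\rho$. A quantum random variable is a function $f:X\to\mathcal B(\mathcal H)$ such that $x\mapsto\operatorname{Tr}(sf(x))$ is Borel measurable for every $s\in\mathcal S(\mathcal H)$. $\mathcal L_{\mathcal H}(X,\nu)$ is the linear span of the positive quantum random variables. $L^\infty_{\mathcal H}(X,\nu)$ is the space of (classes of) essentially bounded quantum random variables, with $\|f\|_\infty$ the $\nu$-essential supremum of the operator norms $\|f(x)\|$. For $s\in\mathcal S(\mathcal H)$ set $f_s(x)=\operatorname{Tr}\big(s(\tfrac{d\nu}{d\nu_\rho}(x))^{1/2}f(x)(\tfrac{d\nu}{d\nu_\rho}(x))^{1/2}\big)$. For $f\in\mathcal L_{\mathcal H}(X,\nu)$ let $Pos_f$ be the set of $(f_1,f_2,f_3,f_4)\in\mathcal L_{\mathcal H}(X,\nu)^4$ with all $f_i\ge 0$ and $f=f_1-f_2+if_3-if_4$, and define $$\|f\|_1=\inf_{Pos_f}\ \sup_{s\in\mathcal S(\mathcal H)}\int_X (f_1+f_2+f_3+f_4)_s\,d\nu_\rho\in[0,\infty],$$ $$\|f\|_{1,dec}=\inf\Big\{\max\{\|S_1\|_1,\|S_2\|_1\}: S_1,S_2\in\mathcal L_{\mathcal H}(X,\nu),\ S_1,S_2\ge0,\ \begin{bmatrix}S_1(x)&f(x)\\ f(x)^*&S_2(x)\end{bmatrix}\ge0\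 \text{a.e.}\Big\}.$$ $L^1_{\mathcal H}(X,\nu)$ is $\{f\in\mathcal L_{\mathcal H}(X,\nu):\|f\|_1<\infty\}$ modulo $\{f:\|f\|_1=0\}$. The same definitions apply to any POVM on any such Hilbert space (the norms $\|\cdot\|_1$ and $\|\cdot\|_{1,dec}$ do not depend on the chosen full-rank state). Tensor products. $\nu\otimes_{\nu_\rho}\nu$ is the POVM on $\mathcal H\otimes\mathcal H$ given by $(\nu\otimes_{\nu_\rho}\nu)(E)=\int_E \frac{d\nu}{d\nu_\rho}\otimes\frac{d\nu}{d\nu_\rho}\,d\nu_\rho$ (entrywise/ultraweak integral), and $(f\otimes g)(x)=f(x)\otimes g(x)$. The norms $\|f\otimes g\|_1$ and $\|f\otimes g\|_{1,dec}$ are taken for the Hilbert space $\mathcal K=\mathcal H\otimes\mathcal H$ and the POVM $\omega=\nu\otimes_{\nu_\rho}\nu$. Explicitly, fix a full-rank $\sigma\in\mathcal S(\mathcal K)$, put $\omega_\sigma(E)=\operatorname{Tr}(\sigma\,\omega(E))$, and for a quantum random variable $h:X\to\mathcal B(\mathcal K)$ and $t\in\mathcal S(\mathcal K)$ put $h_t(x)=\operatorname{Tr}\big(t(\tfrac{d\omega}{d\omega_\sigma}(x))^{1/2}h(x)(\tfrac{d\omega}{d\omega_\sigma}(x))^{1/2}\big)$. Then, for $h=f\otimes g$, $$\|h\|_1=\inf\Big\{\sup_{t\in\mathcal S(\mathcal K)}\int_X (h_1+h_2+h_3+h_4)_t\,d\omega_\sigma:\ h_i\in\mathcal L_{\mathcal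 K}(X,\omega),\ h_i\ge0,\ h=h_1-h_2+ih_3-ih_4\Big\},$$ $$\|h\|_{1,dec}=\inf\Big\{\max\{\|S_1\|_1,\|S_2\|_1\}: S_1,S_2\in\mathcal L_{\mathcal K}(X,\omega),\ S_1,S_2\ge0,\ \begin{bmatrix}S_1(x)&h(x)\\ h(x)^*&S_2(x)\end{bmatrix}\ge0\ \text{a.e.}\Big\}.$$ *)

(* Defs.v *)
From HB Require Import structures.
From mathcomp Require Import all_boot all_order all_algebra.
From mathcomp Require Import all_classical all_reals all_analysis.
From mathcomp Require Import complex.
From mathcomp.analysis.showcase Require summability.

Set Implicit Arguments.
Unset Strict Implicit.
Unset Printing Implicit Defensive.

Import Order.TTheory GRing.Theory Num.Theory.
Import numFieldNormedType.Exports.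

Local Open Scope classical_set_scope.
Local Open Scope ring_scope.
Local Open Scope complex_scope.
Local Open Scope charge_scope.

HB.mixin Record CompleteNormedModule_isHilbert (R : realType) H
    of CompleteNormedModule R[i] H := {
  inner : H -> H -> R[i];
  inner_linearl : forall (a : R[i]) (u v w : H),
    inner (a *: u + v) w = a * inner u w + inner v w;
  innerC : forall u v : H, inner u v = (inner v u)^*;
  inner_norm : forall u : H, inner u u = `|u| ^+ 2 }.

#[short(type=hilbertType)]
HB.structure Definition Hilbert (R : realType) :=
  { H of CompleteNormedModule_isHilbert R H & CompleteNormedModule R[i] H }.

Definition lin_span (K : numDomainType) (V : lmodType K) (S : set V) : set V :=
  [set v | exists n (c : 'I_n -> K) (w : 'I_n -> V),
     (forall k, S (w k)) /\ v = \sum_(k < n) c k *: w k].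

Definition separable (T : topologicalType) : Prop :=
  exists A : set T, countable A /\ dense A.

Definition onb (R : realType) (H : hilbertType R) (I : countType) (e : I -> H) :
    Prop :=
  (forall i j, inner (e i) (e j) = (i == j)%:R) /\
  dense (lin_span (range e)).

Section BoundedOperators.
Variables (R : realType) (H : hilbertType R).

Definition is_bop : {pred H -> H} := fun A => `[< linear A /\ continuous A >].

Record bop := Bop { bop_fun :> H -> H; _ : bop_fun \in is_bop }.

HB.instance Definition _ := [isSub of bop for bop_fun].
HB.instance Definition _ := [Choice of bop by <:].

Lemma is_bop_submod : GRing.submod_closed is_bop.
Proof.
split=> [|a A B].
  apply/asboolP; split=> [b u v|]; last exact: cst_continuous.
  by change (0 = b *: 0 + 0 :> H); rewrite scaler0 addr0.
move=> /asboolP[lA cA] /asboolP[lB cB]; apply/asboolP; split=> [b u v|u].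
  change (a *: A (b *: u + v) + B (b *: u + v) =
          b *: (a *: A u + B u) + (a *: A v + B v)).
  by rewrite lA lB !scalerDr !scalerA (mulrC a b) addrACA.
by apply: cvgD; [exact: cvgZl_tmp (cA u) | exact: cB].
Qed.

HB.instance Definition _ := GRing.isSubmodClosed.Build _ _ is_bop is_bop_submod.
HB.instance Definition _ := [SubChoice_isSubLmodule of bop by <:].

Lemma bop_comp_subproof (A B : bop) : (A : H -> H) \o B \in is_bop.
Proof.
have /asboolP[lA cA] := valP A; have /asboolP[lB cB] := valP B.
apply/asboolP; split=> [b u v|u] /=; first by rewrite lB lA.
by apply: continuous_comp; [exact: cB | exact: cA].
Qed.

Definition bop_comp (A B : bop) : bop := Bop (bop_comp_subproof A B).

Definition opnorm (A : bop) : \bar R :=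
  ereal_sup [set (complex.Re `|A u|)%:E | u in [set u : H | `|u| <= 1]].

Definition positive (A : bop) : Prop := forall u, 0 <= inner (A u) u.

Definition full_rank (A : bop) : Prop := forall u, A u = 0 -> u = 0.

Definition invertible (A : bop) : Prop :=
  exists B : bop, cancel A B /\ cancel B A.

(* [xget 0 S] is a chosen element of S, and 0 if S is empty; the adjoint, and
   the square root of a positive operator, exist and are unique. *)
Definition adjoint (A : bop) : bop :=
  xget 0 [set B : bop | forall u v, inner (A u) v = inner u (B v)].

Definition opsqrt (A : bop) : bop :=
  xget 0 [set B : bop | positive B /\ bop_comp B B = A].

(* The quadratic form of the operator matrix [[S1, A], [A^*, S2]] on H (+) H. *)
Definition block_positive (S1 A S2 : bop) : Prop :=
  forall u v : H,
    0 <= inner (S1 u + A v) u + inner (adjoint A u + S2 v) v.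

Variables (I : countType) (e : I -> H).

Definition has_matrix (M : I -> I -> R[i]) (A : bop) : Prop :=
  forall i j, inner (A (e j)) (e i) = M i j.

(* The bounded operator with matrix M in the basis e, and 0 if M is not the
   matrix of a bounded operator. *)
Definition op_of_matrix (M : I -> I -> R[i]) : bop := xget 0 (has_matrix M).

(* [R[i]^o] is [R[i]] as a normed space over itself. The sum over I is
   unordered; on trace-class operators it does not depend on the basis e. *)
Definition diag_terms (A : bop) : I -> R[i]^o := fun i => inner (A (e i)) (e i).

Definition optrace (A : bop) : R[i] := summability.sum (diag_terms A).

(* Convergence of the trace is required explicitly, [optrace] being a junk value
   when the sum diverges. *)
Definition state : set bop :=
  [set s | positive s /\
     summability.partial_sum (diag_terms s) @ summability.totally
       --> (1 : R[i]^o)].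

End BoundedOperators.

Arguments state {R H I} e.

Notation "A \oc B" := (bop_comp A B) (at level 40, left associativity).

Section Tensor.
Variables (R : realType) (H K : hilbertType R).

(* K, with the map u, v |-> u (x) v, is the Hilbert tensor product of H with
   itself; this determines K up to unitary equivalence. *)
Definition is_tensor (t : H -> H -> K) : Prop :=
  [/\ forall v, linear (t^~ v), forall u, linear (t u),
      forall u v u' v', inner (t u v) (t u' v') = inner u u' * inner v v' &
      dense (lin_span [set z | exists u v, z = t u v])].

(* The unique bounded operator with u (x) v |-> A u (x) B v. *)
Definition op_tensor (t : H -> H -> K) (A B : bop H) : bop K :=
  xget 0 [set C : bop K | forall u v, C (t u v) = t (A u) (B v)].

End Tensor.

Definition borel (X : ptopologicalType) := g_sigma_algebraType (@open X).

Section Measures.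
Variables (d : measure_display) (T : measurableType d) (R : realType).

(* The measure, resp. charge, with values m on the measurable sets (the zero
   measure, resp. charge, if there is none). *)
Definition measure_of (m : set T -> \bar R) : {finite_measure set T -> \bar R} :=
  match pselect (exists mu : {finite_measure set T -> \bar R},
                   forall E, measurable E -> mu E = m E) with
  | left h => sval (cid h)
  | right _ => mzero
  end.

Definition charge_of (m : set T -> \bar R) : {charge set T -> \bar R} :=
  match pselect (exists mu : {charge set T -> \bar R},
                   forall E, measurable E -> mu E = m E) with
  | left h => sval (cid h)
  | right _ => czero
  end.

Definition cintegral (mu : {measure set T -> \bar R}) (E : set T)
    (h : T -> R[i]) : R[i] :=
  Rintegral mu E (fun x => complex.Re (h x)) +i*
  Rintegral mu E (fun x => complex.Im (h x)).

(* For a complex measure m, componentwise; ['d nu '/d mu] is a version of the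
   Radon-Nikodym derivative, hence determined almost everywhere only. *)
Definition cderivative (m : set T -> R[i])
    (mu : {sigma_finite_measure set T -> \bar R}) (x : T) : R[i] :=
  fine ('d (charge_of (fun E => (complex.Re (m E))%:E)) '/d mu x) +i*
  fine ('d (charge_of (fun E => (complex.Im (m E))%:E)) '/d mu x).

End Measures.

Section QuantumRandomVariables.
Variables (R : realType) (H : hilbertType R) (I : countType) (e : I -> H).
Variable X : ptopologicalType.

Definition povm (nu : set (borel X) -> bop H) : Prop :=
  (forall E, measurable E -> positive (nu E)) /\
  forall F : nat -> set (borel X), (forall n, measurable (F n)) ->
    trivIset setT F ->
    forall s, state e s ->
      (fun n => optrace e (s \oc \sum_(k < n) nu (F k)) : R[i]^o) @ \oo -->
      (optrace e (s \oc nu (\bigcup_n F n)) : R[i]^o).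

Definition qrv (f : borel X -> bop H) : Prop :=
  forall s, state e s ->
    measurable_fun setT (fun x => complex.Re (optrace e (s \oc f x))) /\
    measurable_fun setT (fun x => complex.Im (optrace e (s \oc f x))).

Definition pos_fun (f : borel X -> bop H) : Prop := forall x, positive (f x).

Definition LH : set (borel X -> bop H) :=
  lin_span [set f : borel X -> bop H | qrv f /\ pos_fun f].

Variables (nu : set (borel X) -> bop H) (rho : bop H).

Definition nu_rho : {finite_measure set (borel X) -> \bar R} :=
  measure_of (fun E => (complex.Re (optrace e (rho \oc nu E)))%:E).

Definition rn_matrix (x : borel X) (i j : I) : R[i] :=
  cderivative (fun E => inner (nu E (e j)) (e i)) nu_rho x.

Definition rn (x : borel X) : bop H := op_of_matrix e (rn_matrix x).

(* ['N[mu]_+oo] is the essential supremum, set to 0 when mu is the zero measure. *)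
Definition essnorm (f : borel X -> bop H) : \bar R :=
  ('N[nu_rho]_+oo[(fun x => opnorm (f x))])%E.

Definition Linfty : set (borel X -> bop H) :=
  [set f | qrv f /\ (essnorm f < +oo)%E].

(* The function written f_s, for s a state. *)
Definition twist (f : borel X -> bop H) (s : bop H) (x : borel X) : R[i] :=
  optrace e (s \oc opsqrt (rn x) \oc f x \oc opsqrt (rn x)).

(* Applied to positive f only, for which f_s takes nonnegative real values a.e. *)
Definition sup_integral (f : borel X -> bop H) : \bar R :=
  ereal_sup [set (\int[nu_rho]_x (complex.Re (twist f s x))%:E)%E
            | s in state e].

Definition norm1 (f : borel X -> bop H) : \bar R :=
  ereal_inf [set z | exists f1 f2 f3 f4 : borel X -> bop H,
    [/\ LH f1 /\ pos_fun f1, LH f2 /\ pos_fun f2,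
        LH f3 /\ pos_fun f3, LH f4 /\ pos_fun f4 &
        f = f1 - f2 + 'i *: f3 - 'i *: f4 /\
        z = sup_integral (f1 + f2 + f3 + f4)]].

Definition norm1dec (f : borel X -> bop H) : \bar R :=
  ereal_inf [set z | exists S1 S2 : borel X -> bop H,
    [/\ LH S1 /\ pos_fun S1, LH S2 /\ pos_fun S2,
        {ae nu_rho, forall x, block_positive (S1 x) (f x) (S2 x)} &
        z = maxe (norm1 S1) (norm1 S2)]].

(* Functions, not classes modulo [norm1 f = 0]; likewise for [Linfty]. *)
Definition L1 : set (borel X -> bop H) :=
  [set f | LH f /\ (norm1 f < +oo)%E].

End QuantumRandomVariables.

Section TensorPovm.
Variables (R : realType) (H K : hilbertType R) (I J : countType).
Variables (e : I -> H) (b : J -> K) (t : H -> H -> K) (X : ptopologicalType).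

(* The integral of rn (x) rn with respect to nu_rho, entrywise in the basis b. *)
Definition povm_tensor (nu : set (borel X) -> bop H) (rho : bop H)
    (E : set (borel X)) : bop K :=
  op_of_matrix b (fun i j =>
    cintegral (nu_rho e nu rho) E (fun x =>
      inner (op_tensor t (rn e nu rho x) (rn e nu rho x) (b j)) (b i))).

Definition fun_tensor (f g : borel X -> bop H) : borel X -> bop K :=
  fun x => op_tensor t (f x) (g x).

End TensorPovm.

(* Main.v *)
Require Import Defs.
From HB Require Import structures.
From mathcomp Require Import all_boot all_order all_algebra.
From mathcomp Require Import all_classical all_reals all_analysis.
From mathcomp Require Import complex.
From mathcomp.analysis.showcase Require summability.
From mathcomp Require Import measurable_realfun ess_sup_inf.
From mathcomp Require Import ring lra.

(* Write D for the density of nu with respect to nu_rho. The POVM omega has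
   density D (x) D with respect to nu_rho, and omega_sigma has density
   phi = Tr (sigma (D (x) D)); hence the density of omega with respect to
   omega_sigma is (D (x) D) / phi, and the scalar phi cancels:
     h_s d(omega_sigma) = Tr (s (D (x) D)^(1/2) h (D (x) D)^(1/2)) d(nu_rho).
   For F >= 0 and a scalar function 0 <= c <= G,
     (D (x) D)^(1/2) (F (x) c 1) (D (x) D)^(1/2) = D^(1/2) F D^(1/2) (x) c D
       <= |D| G (D^(1/2) F D^(1/2) (x) 1),
   and tensoring with 1 gives a direct sum of copies, so the supremum of the
   integrals of F (x) c 1 is at most |D| G times that of F.
   For the norm [norm1], write g = g1 - g2 + i g3 - i g4 with g_i >= 0 and
   g1 + g2 + g3 + g4 = 2 |g(x)| 1; the products f_i (x) g_j regroup into a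
   decomposition of f (x) g whose sum is (f1 + f2 + f3 + f4) (x) 2 |g(x)| 1.
   For [norm1dec], if [S1, f; f^*, S2] >= 0 then the block matrix with diagonal
   S_i (x) |g(x)| 1 and off-diagonal entry f (x) g is positive as well, and the
   factor 2 disappears because |g(x)| 1 is already positive. *)

Set Implicit Arguments.
Unset Strict Implicit.
Unset Printing Implicit Defensive.

Import Order.TTheory GRing.Theory Num.Theory.
Import numFieldNormedType.Exports.
Import Normc.

Local Open Scope classical_set_scope.
Local Open Scope ring_scope.
Local Open Scope complex_scope.

(** * Hilbert spaces *)

Section Complex.
Variable R : realType.
Implicit Types z w : R[i].

Lemma normcE_R z : `|z| = (normc z)%:C. Proof. by []. Qed.

Lemma normc_ge0 z : 0 <= normc z.
Proof. by have := normr_ge0 z; rewrite normcE_R ler0c. Qed.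

Lemma normc_conj z : normc (conjc z) = normc z.
Proof. by apply: complexI; rewrite -!normcE_R normcJ. Qed.

Lemma normc_real (x : R) : normc x%:C = `|x|.
Proof. by rewrite /normc /= expr0n addr0 sqrtr_sqr. Qed.

Lemma normc_sqr z : normc z ^+ 2 = complex.Re z ^+ 2 + complex.Im z ^+ 2.
Proof. by case: z => a b /=; rewrite sqr_sqrtr // addr_ge0 // sqr_ge0. Qed.

Lemma mul_conj z : z * (conjc z) = (normc z ^+ 2)%:C.
Proof. by rewrite -sqr_normc normcE_R rmorphXn. Qed.

Lemma ler_Re_normc z : `|complex.Re z| <= normc z.
Proof. by have := normc_ge_Re z; rewrite normcE_R lecR. Qed.

Lemma ler_Im_normc z : `|complex.Im z| <= normc z.
Proof.
case: z => a b /=; rewrite -(sqrtr_sqr b) ler_wsqrtr // lerDr; exact: sqr_ge0.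
Qed.

Lemma normc_le_ReIm z : normc z <= `|complex.Re z| + `|complex.Im z|.
Proof.
rewrite -(ler_pXn2r (n := 2)) ?nnegrE ?normc_ge0 ?addr_ge0 //.
rewrite normc_sqr sqrrD !real_normK ?num_real //.
by rewrite -addrA lerD2l lerDr mulrn_wge0 // mulr_ge0.
Qed.

Lemma le0cE z : (0 <= z) = (complex.Im z == 0) && (0 <= complex.Re z).
Proof. by rewrite lecE. Qed.

Lemma cReD z w : complex.Re (z + w) = complex.Re z + complex.Re w.
Proof. by case: z; case: w. Qed.
Lemma cImD z w : complex.Im (z + w) = complex.Im z + complex.Im w.
Proof. by case: z; case: w. Qed.
Lemma cReN z : complex.Re (- z) = - complex.Re z.
Proof. by case: z. Qed.
Lemma cImN z : complex.Im (- z) = - complex.Im z.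
Proof. by case: z. Qed.
Lemma cReM z w : complex.Re (z * w) =
  complex.Re z * complex.Re w - complex.Im z * complex.Im w.
Proof. by case: z; case: w. Qed.
Lemma cImM z w : complex.Im (z * w) =
  complex.Re z * complex.Im w + complex.Im z * complex.Re w.
Proof. by case: z; case: w. Qed.
Lemma cReZ (a : R) z : complex.Re (a%:C * z) = a * complex.Re z.
Proof. by case: z => ? ? /=; rewrite mul0r subr0. Qed.
Lemma cImZ (a : R) z : complex.Im (a%:C * z) = a * complex.Im z.
Proof. by case: z => ? ? /=; rewrite mul0r addr0. Qed.
Lemma cReJ z : complex.Re (conjc z) = complex.Re z. Proof. by case: z. Qed.
Lemma cImJ z : complex.Im (conjc z) = - complex.Im z. Proof. by case: z. Qed.

Lemma complex_ext z w : complex.Re z = complex.Re w ->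
  complex.Im z = complex.Im w -> z = w.
Proof. by move=> h1 h2; apply/eqP; rewrite eq_complex h1 h2 !eqxx. Qed.

Lemma cRe_sum (J : Type) (r : seq J) (P : pred J) (F : J -> R[i]) :
  complex.Re (\sum_(i <- r | P i) F i) = \sum_(i <- r | P i) complex.Re (F i).
Proof. exact: (big_morph _ cReD erefl). Qed.
Lemma cIm_sum (J : Type) (r : seq J) (P : pred J) (F : J -> R[i]) :
  complex.Im (\sum_(i <- r | P i) F i) = \sum_(i <- r | P i) complex.Im (F i).
Proof. exact: (big_morph _ cImD erefl). Qed.

Section Filter.
Context {T : Type} {F : set_system T} {FF : Filter F}.

Lemma cvg_normc (f : T -> R[i]^o) (l : R[i]^o) :
  f @ F --> l <-> (fun x => normc (f x - l)) @ F --> (0 : R).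
Proof.
split=> [/cvgrPdist_lt cf|/cvgrPdist_lt cf]; apply/cvgrPdist_lt => e e0.
  have := cf e%:C; rewrite ltcR => /(_ e0); apply: filterS => x.
  by rewrite normcE_R ltcR sub0r normrN ger0_norm ?normc_ge0 // -normcN opprB.
have eE : e = (complex.Re e)%:C by rewrite RRe_real // realE ltW.
rewrite eE ltcR in e0; have := cf _ e0; apply: filterS => x.
by rewrite sub0r normrN ger0_norm ?normc_ge0 // -normcN opprB eE normcE_R ltcR.
Qed.

Lemma cvg_complex (f : T -> R[i]^o) (l : R[i]^o) :
  f @ F --> l <-> (fun x => complex.Re (f x)) @ F --> complex.Re l /\
                  (fun x => complex.Im (f x)) @ F --> complex.Im l.
Proof.
split=> [/cvg_normc /cvgr0Pnorm_lt h|[hr hi]].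
  split; apply/cvgrPdist_lt => e /h; apply: filterS => x;
    rewrite ger0_norm ?normc_ge0 //; apply: le_lt_trans;
    rewrite distrC -?cReN -?cImN -?cReD -?cImD.
    exact: ler_Re_normc.
  exact: ler_Im_normc.
apply/cvg_normc.
have h0 : (fun x => `|complex.Re l - complex.Re (f x)| +
                    `|complex.Im l - complex.Im (f x)|) @ F --> (0 : R).
  rewrite -(addr0 (0 : R)); apply: cvgD.
    rewrite -(normr0 R); apply: cvg_norm; rewrite -(subrr (complex.Re l)).
    by apply: cvgB => //; exact: cvg_cst.
  rewrite -(normr0 R); apply: cvg_norm; rewrite -(subrr (complex.Im l)).
  by apply: cvgB => //; exact: cvg_cst.
apply: (squeeze_cvgr _ (cvg_cst (0:R)) h0); apply: nearW => x.
rewrite normc_ge0 /= -normcN opprB; apply: (le_trans (normc_le_ReIm _)).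
by rewrite !cReD !cImD !cReN !cImN.
Qed.

End Filter.

Lemma ccvg_unique {T : Type} {F : set_system T} {FF : ProperFilter F}
    (f g : T -> R[i]^o) (a b : R[i]) : f @ F --> (a : R[i]^o) ->
  g @ F --> (b : R[i]^o) -> f =1 g -> a = b.
Proof.
move=> fa gb /funext fg; rewrite -fg in gb.
exact: (cvg_unique (@norm_hausdorff _ R[i]^o) fa gb).
Qed.

Section Algebra.
Context {T : Type} {F : set_system T} {FF : Filter F}.
Implicit Types f g : T -> R[i].

Lemma ccvgD f g (a b : R[i]) : (f x : R[i]^o) @[x --> F] --> (a : R[i]^o) ->
  (g x : R[i]^o) @[x --> F] --> (b : R[i]^o) ->
  (f x + g x : R[i]^o) @[x --> F] --> (a + b : R[i]^o).
Proof. exact: cvgD. Qed.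
Lemma ccvgB f g (a b : R[i]) : (f x : R[i]^o) @[x --> F] --> (a : R[i]^o) ->
  (g x : R[i]^o) @[x --> F] --> (b : R[i]^o) ->
  (f x - g x : R[i]^o) @[x --> F] --> (a - b : R[i]^o).
Proof. exact: cvgB. Qed.
Lemma ccvgM f (c a : R[i]) : (f x : R[i]^o) @[x --> F] --> (a : R[i]^o) ->
  (c * f x : R[i]^o) @[x --> F] --> (c * a : R[i]^o).
Proof. exact: cvgZl_tmp. Qed.
End Algebra.
End Complex.

Section Inner.
Variables (R : realType) (H : hilbertType R).
Implicit Types u v w : H.

Definition nrm u : R := complex.Re `|u|.

Lemma nrmE u : `|u| = (nrm u)%:C.
Proof. by rewrite RRe_real // normr_real. Qed.

Lemma nrm_ge0 u : 0 <= nrm u.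
Proof. by have := normr_ge0 u; rewrite nrmE ler0c. Qed.
Hint Resolve nrm_ge0 : core.

Lemma nrm0 : nrm 0 = 0. Proof. by rewrite /nrm normr0. Qed.

Lemma nrm_eq0 u : nrm u = 0 -> u = 0.
Proof. by move=> h; apply/eqP; rewrite -normr_eq0 nrmE h. Qed.

Lemma nrmD u v : nrm (u + v) <= nrm u + nrm v.
Proof. by have := ler_normD u v; rewrite !nrmE -rmorphD lecR. Qed.

Lemma nrmN u : nrm (- u) = nrm u. Proof. by rewrite /nrm normrN. Qed.

Lemma nrmZ (a : R[i]) u : nrm (a *: u) = normc a * nrm u.
Proof. by apply: complexI; rewrite -nrmE normrZ nrmE normcE_R rmorphM. Qed.

Lemma cvg_nrm {T : Type} {F : set_system T} {FF : Filter F} (f : T -> H) (l : H) :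
  f @ F --> l <-> (fun x => nrm (f x - l)) @ F --> (0 : R).
Proof.
split=> [/cvgrPdist_lt cf|/cvgrPdist_lt cf]; apply/cvgrPdist_lt => e e0.
  have := cf e%:C; rewrite ltcR => /(_ e0); apply: filterS => x.
  by rewrite nrmE ltcR sub0r normrN ger0_norm // -nrmN opprB.
have eE : e = (complex.Re e)%:C by rewrite RRe_real // realE ltW.
rewrite eE ltcR in e0; have := cf _ e0; apply: filterS => x.
by rewrite sub0r normrN ger0_norm // -nrmN opprB eE nrmE ltcR.
Qed.

Lemma innerDl u v w : inner (u + v) w = inner u w + inner v w.
Proof. by have := inner_linearl 1 u v w; rewrite scale1r mul1r. Qed.
Lemma inner0l w : inner 0 w = 0.
Proof.
by have /esym/eqP := innerDl 0 0 w; rewrite addr0 -subr_eq0 addrK => /eqP.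
Qed.
Lemma innerZl (a : R[i]) u w : inner (a *: u) w = a * inner u w.
Proof. by have := inner_linearl a u 0 w; rewrite inner0l !addr0. Qed.
Lemma innerNl u w : inner (- u) w = - inner u w.
Proof. by rewrite -scaleN1r innerZl mulN1r. Qed.
Lemma innerBl u v w : inner (u - v) w = inner u w - inner v w.
Proof. by rewrite innerDl innerNl. Qed.
Lemma innerDr u v w : inner w (u + v) = inner w u + inner w v.
Proof. by rewrite innerC innerDl rmorphD /= -!innerC. Qed.
Lemma inner0r w : inner w 0 = 0.
Proof. by rewrite innerC inner0l conjc0. Qed.
Lemma innerZr (a : R[i]) u w : inner w (a *: u) = (conjc a) * inner w u.
Proof. by rewrite innerC innerZl rmorphM /= -innerC. Qed.
Lemma innerNr u w : inner w (- u) = - inner w u.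
Proof. by rewrite innerC innerNl rmorphN /= -innerC. Qed.
Lemma innerBr u v w : inner w (u - v) = inner w u - inner w v.
Proof. by rewrite innerDr innerNr. Qed.
Lemma inner_suml (J : Type) (r : seq J) (P : pred J) (F : J -> H) w :
  inner (\sum_(i <- r | P i) F i) w = \sum_(i <- r | P i) inner (F i) w.
Proof. exact: (big_morph (inner^~ w) (fun u v => innerDl u v w) (inner0l w)). Qed.
Lemma inner_sumr (J : Type) (r : seq J) (P : pred J) (F : J -> H) w :
  inner w (\sum_(i <- r | P i) F i) = \sum_(i <- r | P i) inner w (F i).
Proof. exact: (big_morph (inner w) (fun u v => innerDr u v w) (inner0r w)). Qed.

Lemma inner_nrm2 u : inner u u = (nrm u ^+ 2)%:C.
Proof. by rewrite inner_norm nrmE rmorphXn. Qed.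

Lemma nrm2E u : nrm u ^+ 2 = complex.Re (inner u u).
Proof. by rewrite inner_nrm2. Qed.

Lemma nrm2D u v :
  nrm (u + v) ^+ 2 = nrm u ^+ 2 + 2 * complex.Re (inner u v) + nrm v ^+ 2.
Proof.
rewrite !nrm2E innerDl !innerDr !cReD (innerC v u) cReJ; ring.
Qed.

(* Discriminant argument for a nonnegative Hermitian form [q]. *)
Lemma cauchy_schwarz_form (q : H -> H -> R[i]) :
  (forall a u v w, q (a *: u + v) w = a * q u w + q v w) ->
  (forall u v, q u v = conjc (q v u)) -> (forall u, 0 <= q u u) ->
  forall u v, normc (q u v) ^+ 2 <= complex.Re (q u u) * complex.Re (q v v).
Proof.
move=> ql qC q0 u v.
have qr a x y w : q w (a *: x + y) = (conjc a) * q w x + q w y.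
  by rewrite qC ql rmorphD rmorphM /= -!qC.
set z := q u v; set a := complex.Re (q u u); set b := complex.Re (q v v).
have reE x : q x x = (complex.Re (q x x))%:C.
  by rewrite RRe_real // realE q0.
have key (t : R) : 0 <= t ^+ 2 * normc z ^+ 2 * a + 2 * t * normc z ^+ 2 + b.
  have := q0 ((t%:C * (conjc z)) *: u + v).
  rewrite ql !qr (reE u) (reE v) -/a -/b (qC v u) -/z.
  have -> : conjc (t%:C * (conjc z)) = t%:C * z by rewrite rmorphM /= conjcK oppr0.
  rewrite (_ : _ + _ = (t ^+ 2 * normc z ^+ 2 * a + 2 * t * normc z ^+ 2 + b)%:C).
    by rewrite ler0c.
  have := mul_conj z; set N := normc z ^+ 2 => h.
  transitivity (t%:C ^+ 2 * N%:C * a%:C + 2 * t%:C * N%:C + b%:C).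
    by rewrite -h; ring.
  by apply: complex_ext; rewrite /= ?expr2 /=; ring.
have a0 : 0 <= a by rewrite -ler0c -reE.
have b0 : 0 <= b by rewrite -ler0c -reE.
have n0 := sqr_ge0 (normc z).
have [aE|aN0] := eqVneq a 0.
  rewrite aE mul0r.
  case: (lerP (normc z ^+ 2) 0) => // zp; have := key (- (b + 1) / (2 * normc z ^+ 2)).
  rewrite aE mulr0 add0r.
  have -> : 2 * (- (b + 1) / (2 * normc z ^+ 2)) * normc z ^+ 2 = - (b + 1).
    by field; apply: contraTneq zp => ->; rewrite expr0n ltxx.
  lra.
have ap : 0 < a by rewrite lt_neqAle eq_sym aN0.
have := key (- a^-1).
have -> : (- a^-1) ^+ 2 * normc z ^+ 2 * a + 2 * (- a^-1) * normc z ^+ 2 + b =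
   b - normc z ^+ 2 / a by field.
by rewrite subr_ge0 ler_pdivrMr // mulrC.
Qed.

Lemma cauchy_schwarz u v : normc (inner u v) <= nrm u * nrm v.
Proof.
rewrite -(ler_pXn2r (n := 2)) ?nnegrE ?normc_ge0 ?mulr_ge0 //.
rewrite exprMn !nrm2E; apply: cauchy_schwarz_form.
- exact: inner_linearl.
- exact: innerC.
- by move=> x; rewrite inner_nrm2 ler0c sqr_ge0.
Qed.

Lemma inner_eq0r u : (forall v, inner u v = 0) -> u = 0.
Proof.
move=> h; apply: nrm_eq0; have := h u; rewrite inner_nrm2 => /complexI /eqP.
by rewrite expf_eq0 => /eqP.
Qed.

Lemma inner_inj u w : (forall v, inner u v = inner w v) -> u = w.
Proof.
move=> h; apply/eqP; rewrite -subr_eq0; apply/eqP/inner_eq0r => v.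
by rewrite innerBl h subrr.
Qed.

Lemma cvg_inner {T : Type} {F : set_system T} {FF : Filter F}
    (f : T -> H) (l w : H) :
  f @ F --> l -> (fun x => inner (f x) w : R[i]^o) @ F --> (inner l w : R[i]^o).
Proof.
move=> /cvg_nrm h; apply/cvg_normc.
have h0 : (fun x => nrm (f x - l) * nrm w) @ F --> (0 : R).
  by rewrite -(mul0r (nrm w)); apply: cvgMl.
apply: (squeeze_cvgr _ (cvg_cst (0:R)) h0); apply: nearW => x.
by rewrite normc_ge0 -innerBl cauchy_schwarz.
Qed.

Lemma cvg_conjc {T : Type} {F : set_system T} {FF : Filter F}
    (f : T -> R[i]^o) (l : R[i]^o) :
  f @ F --> l -> (fun x => conjc (f x) : R[i]^o) @ F --> ((conjc l) : R[i]^o).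
Proof.
move=> /cvg_complex[h1 h2]; apply/cvg_complex; rewrite cReJ cImJ; split.
  by apply: cvg_trans h1; apply: near_eq_cvg; apply: nearW => x; rewrite cReJ.
apply: cvg_trans (cvgN h2); apply: near_eq_cvg; apply: nearW => x /=.
by rewrite cImJ.
Qed.

Lemma cvg_innerr {T : Type} {F : set_system T} {FF : Filter F}
    (f : T -> H) (l w : H) :
  f @ F --> l -> (fun x => inner w (f x) : R[i]^o) @ F --> (inner w l : R[i]^o).
Proof.
move=> /(@cvg_inner _ _ _ _ _ w)/cvg_conjc; rewrite -innerC.
by apply: cvg_trans; apply: near_eq_cvg; apply: nearW => x; rewrite -innerC.
Qed.

Lemma polarization u v :
  4 * inner u v = (nrm (u + v) ^+ 2)%:C - (nrm (u - v) ^+ 2)%:C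
    + 'i%C * (nrm (u + 'i%C *: v) ^+ 2)%:C - 'i%C * (nrm (u - 'i%C *: v) ^+ 2)%:C.
Proof.
rewrite -!inner_nrm2 !(innerDl, innerDr, innerNl, innerNr, innerZl, innerZr).
have iJ : conjc 'i%C = - 'i%C :> R[i] by apply: complex_ext => /=; rewrite ?oppr0.
have := sqr_i R; rewrite expr2 iJ => i2.
set x := inner u u; set y := inner u v; set z := inner v u; set w := inner v v.
rewrite (_ : _ + _ = 2 * (y + z) + 2 * (-('i%C * 'i%C)) * y + 2 * ('i%C * 'i%C) * z); last by ring.
by rewrite i2; ring.
Qed.

End Inner.
#[global] Hint Extern 0 (is_true (0 <= nrm _)) => exact: nrm_ge0 : core.
#[global] Hint Extern 0 (is_true (0 <= normc _)) => exact: normc_ge0 : core.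

Lemma cvg_sumr (K : numFieldType) (V : normedModType K) (T J : Type)
    (F : set_system T) (FF : Filter F) (r : seq J) (f : J -> T -> V) (l : J -> V) :
  (forall j, f j x @[x --> F] --> l j) ->
  (\sum_(j <- r) f j x) @[x --> F] --> \sum_(j <- r) l j.
Proof.
move=> h; elim: r => [|j r IH].
  by rewrite big_nil; under eq_fun do rewrite big_nil; exact: cvg_cst.
rewrite big_cons; under eq_fun do rewrite big_cons.
by apply: cvgD.
Qed.

Section BoundedMaps.
Variable R : realType.

Definition blin (H K : hilbertType R) (f : H -> K) (M : R) : Prop :=
  [/\ linear f, 0 <= M & forall u, nrm (f u) <= M * nrm u].

Section Blin.
Variables (H K : hilbertType R) (f : H -> K).
Hypothesis lf : linear f.

Lemma lin0 : f 0 = 0.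
Proof.
have h := lf 1 0 0; rewrite scale1r addr0 scale1r in h.
by apply/eqP; rewrite -(addrK (f 0) (f 0)) -{1}h subrr.
Qed.
Lemma linD u v : f (u + v) = f u + f v.
Proof. by have := lf 1 u v; rewrite !scale1r. Qed.
Lemma linZ a u : f (a *: u) = a *: f u.
Proof. by have := lf a u 0; rewrite lin0 !addr0. Qed.
Lemma linN u : f (- u) = - f u.
Proof. by rewrite -scaleN1r linZ scaleN1r. Qed.
Lemma linB u v : f (u - v) = f u - f v.
Proof. by rewrite linD linN. Qed.
Lemma lin_sum (J : Type) (r : seq J) (P : pred J) (F : J -> H) :
  f (\sum_(i <- r | P i) F i) = \sum_(i <- r | P i) f (F i).
Proof. exact: (big_morph f linD lin0). Qed.
End Blin.

Lemma cvg_blin (H K : hilbertType R) (f : H -> K) M {T : Type}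
    {F : set_system T} {FF : Filter F} (g : T -> H) (l : H) :
  blin f M -> g @ F --> l -> (fun x => f (g x)) @ F --> f l.
Proof.
move=> [lf M0 bf] /cvg_nrm h; apply/cvg_nrm.
have h0 : (fun x => M * nrm (g x - l)) @ F --> (0 : R).
  by rewrite -(mulr0 M); apply: cvgMr.
apply: (squeeze_cvgr _ (cvg_cst (0:R)) h0); apply: nearW => x.
by rewrite nrm_ge0 -(linB lf) bf.
Qed.

Lemma dense_nrm (H : hilbertType R) (S : set H) : dense S ->
  forall z (d : R), 0 < d -> exists2 y, S y & nrm (z - y) < d.
Proof.
move=> dS z d d0.
have [] := dS (ball z d%:C).
- by exists z; apply: ballxx; rewrite ltcR.
- by apply: ball_open; rewrite ltcR.
move=> y [zy Sy]; exists y => //.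
by move: zy; rewrite -ball_normE /ball_ /= nrmE ltcR.
Qed.

(* Uniformly bounded linear maps that converge on a set with dense span. *)
Lemma dense_cvg (H K : hilbertType R) (S : set H) (P : nat -> H -> K)
    (L : H -> K) (M : R) :
  dense (lin_span S) -> (forall n, blin (P n) M) -> blin L M ->
  (forall s, S s -> P n s @[n --> \oo] --> L s) ->
  forall z, P n z @[n --> \oo] --> L z.
Proof.
move=> dS bP bL PL z; apply/cvg_nrm/cvgr0Pnorm_lt => d d0.
have [lL M0 bL'] := bL.
have M1 : 0 < 4 * (M + 1) by lra.
have [y [m [c [w [Sw ->]]]]] := dense_nrm dS z (divr_gt0 d0 M1).
set y' := \sum_(k < m) _ => zy.
have : P n y' @[n --> \oo] --> L y'.
  rewrite (lin_sum lL).
  rewrite (_ : (fun n => _) = fun n => \sum_(k < m) P n (c k *: w k)); last first.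
    by apply/funext => n; have [lP _ _] := bP n; rewrite (lin_sum lP).
  apply: cvg_sumr => k.
  rewrite (linZ lL); under eq_fun => n do have [lP _ _] := bP n.
  rewrite (_ : (fun n => _) = fun n => c k *: P n (w k)); last first.
    by apply/funext => n; have [lP _ _] := bP n; rewrite (linZ lP).
  by apply: cvgZr; apply: PL.
move=> /cvg_nrm/cvgr0Pnorm_lt/(_ (d / 2)); rewrite divr_gt0 // => /(_ isT).
apply: filterS => n; rewrite !(ger0_norm (nrm_ge0 _)) => h.
have [lP _ bP'] := bP n.
have -> : P n z - L z = P n (z - y') - L (z - y') + (P n y' - L y').
  by rewrite (linB lP) (linB lL) addrAC addrA subrK opprB addrA subrK.
apply: (le_lt_trans (nrmD _ _)).
have h1 : nrm (P n (z - y') - L (z - y')) <= 2 * M * nrm (z - y').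
  apply: (le_trans (nrmD _ _)); rewrite nrmN.
  by have := bP' (z - y'); have := bL' (z - y'); lra.
have h2 : 4 * (M + 1) * nrm (z - y') < d by rewrite mulrC -ltr_pdivlMr.
have := nrm_ge0 (z - y').
lra.
Qed.

Lemma dense_eq (H K : hilbertType R) (S : set H) (f g : H -> K) M M' :
  dense (lin_span S) -> blin f M -> blin g M' ->
  (forall s, S s -> f s = g s) -> forall z, f z = g z.
Proof.
move=> dS [lf M0 bf] [lg M0' bg] fg z.
have bf' : blin f (M + M').
  by split => // [|u]; [lra|have := bf u; have := nrm_ge0 u; nra].
have bg' : blin g (M + M').
  by split => // [|u]; [lra|have := bg u; have := nrm_ge0 u; nra].
have h s : S s -> (fun n : nat => f s) @ \oo --> g s.
  by move=> /fg ->; exact: cvg_cst.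
by have /cvg_lim <- := dense_cvg dS (fun _ : nat => bf') bg' h (z := z);
  rewrite ?lim_cst.
Qed.

Lemma cvg_increments (H : hilbertType R) (w : nat -> H) (S : nat -> R) (p : nat) :
  cvg (S @ \oo) ->
  (forall n m, (n <= m)%N -> nrm (w m - w n) ^+ p.+1 <= S m - S n) ->
  cvg (w @ \oo).
Proof.
move=> /cvg_ex[s /cvgrPdist_lt Ss] h.
apply/cauchy_cvgP/cauchy_exP => d d0.
have dE : d = (complex.Re d)%:C by rewrite RRe_real // realE ltW.
rewrite dE ltcR in d0; set r := complex.Re d in dE d0.
have [|N _ hN] := Ss (r ^+ p.+1 / 2); first by rewrite divr_gt0 ?exprn_gt0.
exists (w N); exists N => //= n /= Nn.
rewrite -ball_normE /ball_ /= -normrN opprB dE nrmE ltcR.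
rewrite -(ltr_pXn2r (n := p.+1)) ?nnegrE ?nrm_ge0 ?(ltW d0) //.
apply: (le_lt_trans (h _ _ Nn)).
have := hN N (leqnn N); have := hN n Nn; rewrite /=.
move=> /ltr_normlP[h1 h2] /ltr_normlP[h3 h4]; lra.
Qed.
End BoundedMaps.

Section OrthonormalSequences.
Variables (R : realType) (H : hilbertType R).

(* Zero terms are allowed, so that a countable orthonormal family can be
   enumerated along [nat] whatever its cardinality. *)
Definition onseq (e : nat -> H) : Prop :=
  [/\ forall m n, m != n -> inner (e m) (e n) = 0,
      forall n, nrm (e n) = 1 \/ e n = 0 &
      dense (lin_span (range e))].

Definition onproj (e : nat -> H) (N : nat) (v : H) : H :=
  \sum_(0 <= n < N) inner v (e n) *: e n.

Variable e : nat -> H.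
Hypothesis one : onseq e.

Lemma onseq_nrm2 (a : nat -> R[i]) m k :
  nrm (\sum_(m <= i < m + k) a i *: e i) ^+ 2 =
  \sum_(m <= i < m + k) normc (a i) ^+ 2 * nrm (e i) ^+ 2.
Proof.
have [eo _ _] := one.
elim: k => [|k IH]; first by rewrite addn0 !big_geq // nrm0 expr0n.
rewrite addnS !big_nat_recr ?leq_addr //= nrm2D IH nrmZ exprMn.
rewrite [X in complex.Re X](_ : _ = 0) ?mulr0 ?addr0 //.
rewrite inner_suml big_nat big1 // => i /andP[_ ik].
by rewrite innerZl innerZr eo ?mulr0 // ltn_eqF.
Qed.

Lemma onseq_nrm_mul (u : H) n :
  normc (inner u (e n)) ^+ 2 * nrm (e n) ^+ 2 = normc (inner u (e n)) ^+ 2.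
Proof.
have [_ en _] := one.
by case: (en n) => [->|->]; rewrite ?expr1n ?mulr1 // inner0r Normc.normc0 expr0n mul0r.
Qed.

Lemma nrm2_onproj N v :
  nrm (onproj e N v) ^+ 2 = \sum_(0 <= n < N) normc (inner v (e n)) ^+ 2.
Proof.
have := onseq_nrm2 (fun n => inner v (e n)) 0 N; rewrite add0n => ->.
by apply: eq_bigr => n _; rewrite onseq_nrm_mul.
Qed.

Lemma inner_onproj N u v :
  inner (onproj e N u) v = \sum_(0 <= n < N) inner u (e n) * inner (e n) v.
Proof. by rewrite inner_suml; apply: eq_bigr => n _; rewrite innerZl. Qed.

Lemma inner_onproj_self N v : inner v (onproj e N v) = (nrm (onproj e N v) ^+ 2)%:C.
Proof.
rewrite innerC inner_onproj nrm2_onproj rmorph_sum rmorph_sum; apply: eq_bigr => n _.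
by rewrite (innerC (e n)) /= mul_conj /= oppr0.
Qed.

Lemma nrm_onproj N v : nrm (onproj e N v) <= nrm v.
Proof.
rewrite -(ler_pXn2r (n := 2)) ?nnegrE ?nrm_ge0 //.
have := sqr_ge0 (nrm (v - onproj e N v)).
rewrite nrm2D innerNr inner_onproj_self nrmN cReN /=; lra.
Qed.

Lemma blin_onproj N : blin (onproj e N) 1.
Proof.
split => // [a u v|u]; last by rewrite mul1r nrm_onproj.
rewrite /onproj scaler_sumr -big_split; apply: eq_bigr => n _ /=.
by rewrite inner_linearl scalerDl scalerA.
Qed.

Lemma blin_id : blin (idfun : H -> H) 1.
Proof. by split => // u; rewrite mul1r. Qed.

Lemma cvg_onproj v : onproj e N v @[N --> \oo] --> v.
Proof.
have [eo en eD] := one.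
apply: (dense_cvg eD blin_onproj blin_id) => _ [m _ <-].
apply: cvg_near_cst; exists m.+1 => // N /= mN.
rewrite /onproj (bigD1_seq m) ?mem_index_iota ?iota_uniq //=.
rewrite big1_seq ?addr0 => [|n /andP[nm _]].
  by case: (en m) => h; rewrite ?h ?scaler0 // inner_nrm2 h expr1n scale1r.
by rewrite eo ?scale0r // eq_sym.
Qed.

Lemma parseval u v :
  (\sum_(0 <= n < N) inner u (e n) * inner (e n) v : R[i]^o) @[N --> \oo]
    --> (inner u v : R[i]^o).
Proof.
by under eq_fun do rewrite -inner_onproj; apply: cvg_inner; exact: cvg_onproj.
Qed.

Lemma parseval_nrm u :
  \sum_(0 <= n < N) normc (inner u (e n)) ^+ 2 @[N --> \oo] --> nrm u ^+ 2.
Proof.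
have /cvg_complex[+ _] := @parseval u u.
rewrite nrm2E; apply: cvg_trans; apply: near_eq_cvg; apply: nearW => N.
rewrite cRe_sum; apply: eq_bigr => n _.
by rewrite (innerC (e n)) mul_conj.
Qed.

Lemma riesz (phi : H -> R[i]) (M : R) :
  (forall a u v, phi (a *: u + v) = a * phi u + phi v) ->
  0 <= M -> (forall u, normc (phi u) <= M * nrm u) ->
  exists w, forall u, phi u = inner u w.
Proof.
move=> lphi M0 bphi; have [eo en eD] := one.
have phi0 : phi 0 = 0.
  by have := lphi (-1) 0 0; rewrite scaler0 addr0 mulN1r addNr.
have phiD u v : phi (u + v) = phi u + phi v.
  by have := lphi 1 u v; rewrite scale1r mul1r.
have phiZ a u : phi (a *: u) = a * phi u by have := lphi a u 0; rewrite phi0 !addr0.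
pose a n := conjc (phi (e n)).
pose z N := \sum_(0 <= n < N) a n *: e n.
pose S N : R := \sum_(0 <= n < N) normc (phi (e n)) ^+ 2.
have aE n : normc (a n) ^+ 2 * nrm (e n) ^+ 2 = normc (phi (e n)) ^+ 2.
  rewrite normc_conj; case: (en n) => [->|->]; first by rewrite expr1n mulr1.
  by rewrite phi0 Normc.normc0 expr0n mul0r.
have zS N : nrm (z N) ^+ 2 = S N.
  have := onseq_nrm2 a 0 N; rewrite add0n -/(z N) => ->.
  by apply: eq_bigr => n _; rewrite aE.
have phiz N : phi (z N) = (S N)%:C.
  rewrite /z (big_morph _ phiD phi0) rmorph_sum; apply: eq_bigr => n _.
  by rewrite phiZ mulrC mul_conj.
have S0 N : 0 <= S N by rewrite -zS sqr_ge0.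
have SM N : S N <= M ^+ 2.
  have := bphi (z N); rewrite phiz normc_real ger0_norm // => h.
  have h2 : S N ^+ 2 <= M ^+ 2 * S N.
    by rewrite -[in leRHS]zS -exprMn ler_pXn2r ?nnegrE ?mulr_ge0 ?nrm_ge0.
  have [->|Sn0] := eqVneq (S N) 0; first exact: sqr_ge0.
  rewrite -(ler_pM2r (x := S N)) ?lt_neqAle 1?eq_sym ?Sn0 ?S0 //.
have cS : cvg (S @ \oo).
  apply: nondecreasing_is_cvgn.
    apply/nondecreasing_seqP => n; rewrite /S big_nat_recr //= lerDl; exact: sqr_ge0.
  by exists (M ^+ 2) => _ [n _ <-].
have cz : cvg (z @ \oo).
  apply: (cvg_increments (p := 1) cS) => n m nm.
  have -> : z m - z n = \sum_(n <= k < m) a k *: e k.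
    by rewrite /z (@big_cat_nat _ _ _ n 0 m) //= addrAC subrr add0r.
  have -> : S m - S n = \sum_(n <= k < m) normc (phi (e k)) ^+ 2.
    by rewrite /S (@big_cat_nat _ _ _ n 0 m) //= addrAC subrr add0r.
  by rewrite -{1 2}(subnKC nm) onseq_nrm2; apply: ler_sum => k _; rewrite aE.
exists (lim (z @ \oo)) => u.
have h1 : (inner u (z N) : R[i]^o) @[N --> \oo] --> (inner u (lim (z @ \oo)) : R[i]^o).
  exact: cvg_innerr.
have h2 : (phi (onproj e N u) : R[i]^o) @[N --> \oo] --> (phi u : R[i]^o).
  apply/cvg_normc.
  have /cvg_nrm h0 := @cvg_onproj u.
  have h0' : M * nrm (onproj e N u - u) @[N --> \oo] --> (0 : R).
    by rewrite -(mulr0 M); apply: cvgMr.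
  apply: (squeeze_cvgr _ (cvg_cst (0:R)) h0'); apply: nearW => N.
  by rewrite normc_ge0 /= -mulN1r -phiZ -phiD scaleN1r.
apply: (cvg_unique (@norm_hausdorff _ R[i]^o) h2).
move: h1; apply: cvg_trans; apply: near_eq_cvg; apply: nearW => N.
rewrite /onproj (big_morph _ phiD phi0) inner_sumr; apply: eq_bigr => n _.
by rewrite phiZ innerZr conjcK mulrC.
Qed.

End OrthonormalSequences.

Section Enumeration.
Variables (R : realType) (H : hilbertType R) (I : countType).

Definition onenum (e : I -> H) (n : nat) : H :=
  if pickle_inv n is Some i then e i else 0.

Lemma onenum_pickle (e : I -> H) i : onenum e (pickle i) = e i.
Proof. by rewrite /onenum pickleK_inv. Qed.

Lemma lin_span_sub (K : numDomainType) (V : lmodType K) (A B : set V) :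
  A `<=` B -> lin_span A `<=` lin_span B.
Proof.
move=> AB v [n [c [w [Aw ->]]]]; exists n, c, w; split => // k.
exact: AB.
Qed.

Lemma onseq_onenum (e : I -> H) : onb e -> onseq (onenum e).
Proof.
move=> [eo eD]; split.
- move=> m n mn; rewrite /onenum.
  have := pickle_invK (T := I) m; have := pickle_invK (T := I) n.
  case: pickle_inv => [i|]; case: pickle_inv => [j|] /=;
    rewrite ?inner0l ?inner0r // => im jn.
  by rewrite eo; case: eqVneq => // ij; move: mn; rewrite -im -jn ij eqxx.
- move=> n; rewrite /onenum; case: pickle_inv => [i|]; last by right.
  left; have := eo i i; rewrite eqxx inner_nrm2 => /complexI/eqP.
  by rewrite -[X in _ == X](expr1n _ 2) eqrXn2 ?nrm_ge0 // => /eqP.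
- move=> O O0 oO; have [z [Oz zE]] := eD O O0 oO.
  exists z; split => //; apply: lin_span_sub zE => _ [i _ <-].
  by exists (pickle i) => //; rewrite onenum_pickle.
Qed.
End Enumeration.

(** * Bounded operators and square roots *)

Section BoundedOperatorTheory.
Variables (R : realType) (H : hilbertType R).
Implicit Types A B : bop H.

Lemma bop_ext A B : (forall u, A u = B u) -> A = B.
Proof. by move=> h; apply: val_inj; apply/funext. Qed.

Lemma bop_lin A : linear A.
Proof. by have /asboolP[] := valP A. Qed.

Lemma bop_blin A : exists M, blin A M.
Proof.
have /asboolP[lA cA] := valP A.
have : A t @[t --> (0 : H)] --> (0 : H).
  by rewrite -[X in _ --> X](lin0 lA); exact: cA.
move=> /cvgr0Pnorm_lt/(_ 1 ltr01)/nbhs_ballP[d /= d0 hd].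
have dE : d = (complex.Re d)%:C by rewrite RRe_real // realE ltW.
rewrite dE ltcR in d0; set r := complex.Re d in dE d0.
exists (2 / r); split => // [|u]; first by rewrite divr_ge0 // ltW.
have [->|u0] := eqVneq u 0; first by rewrite (lin0 lA) !nrm0 mulr0.
have up : 0 < nrm u.
  rewrite lt_neqAle nrm_ge0 andbT eq_sym; apply: contraNneq u0 => h.
  by apply/eqP/nrm_eq0.
have cp : 0 < r / (2 * nrm u) by rewrite divr_gt0 // mulr_gt0.
have := hd ((r / (2 * nrm u))%:C *: u).
rewrite -ball_normE /ball_ /= sub0r normrN nrmE nrmZ normc_real (ger0_norm (ltW cp)) dE ltcR.
have -> : r / (2 * nrm u) * nrm u = r / 2 by field; rewrite gt_eqF.
rewrite ltr_pdivrMr // mulr_natr mulr2n ltrDl d0 => /(_ isT).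
rewrite (linZ lA) nrmE nrmZ normc_real (ger0_norm (ltW cp)) ltcR => h.
have -> : nrm (A u) = r / (2 * nrm u) * nrm (A u) * (2 / r * nrm u).
  by field; rewrite !gt_eqF.
rewrite -[leRHS]mul1r ler_pM2r ?ltW //.
by rewrite mulr_gt0 // divr_gt0.
Qed.

Lemma bop_exists (f : H -> H) M : blin f M -> exists A : bop H, forall u, A u = f u.
Proof.
move=> bf; have [lf M0 _] := bf.
have fb : f \in @is_bop R H.
  apply/asboolP; split => // u; apply: (cvg_blin bf); exact: cvg_id.
by exists (Bop fb).
Qed.

Lemma bop_compE A B u : (A \oc B) u = A (B u). Proof. by []. Qed.
Lemma bop_compA A B C : A \oc (B \oc C) = A \oc B \oc C.
Proof. exact: bop_ext. Qed.
Lemma bopDE A B u : (A + B) u = A u + B u. Proof. by []. Qed.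
Lemma bopNE A u : (- A) u = - A u. Proof. by []. Qed.
Lemma bopBE A B u : (A - B) u = A u - B u. Proof. by []. Qed.
Lemma bop0E u : (0 : bop H) u = 0. Proof. by []. Qed.
Lemma bopZE a A u : (a *: A) u = a *: A u. Proof. by []. Qed.

Lemma bop_id_subproof : idfun \in @is_bop R H.
Proof. by apply/asboolP; split => // u; exact: cvg_id. Qed.
Definition bop1 : bop H := Bop bop_id_subproof.
Lemma bop1E u : bop1 u = u. Proof. by []. Qed.
Lemma bop_comp1 A : A \oc bop1 = A. Proof. exact: bop_ext. Qed.
Lemma bop_1comp A : bop1 \oc A = A. Proof. exact: bop_ext. Qed.

Lemma bop_compDl A B C : (A + B) \oc C = A \oc C + B \oc C.
Proof. exact: bop_ext. Qed.
Lemma bop_compDr A B C : C \oc (A + B) = C \oc A + C \oc B.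
Proof. by apply: bop_ext => u; rewrite bop_compE bopDE (linD (bop_lin C)). Qed.
Lemma bop_compZl a A C : (a *: A) \oc C = a *: (A \oc C).
Proof. exact: bop_ext. Qed.
Lemma bop_compZr a A C : C \oc (a *: A) = a *: (C \oc A).
Proof. by apply: bop_ext => u; rewrite bop_compE bopZE (linZ (bop_lin C)). Qed.
Lemma bop_compNl A C : (- A) \oc C = - (A \oc C).
Proof. exact: bop_ext. Qed.
Lemma bop_compNr A C : C \oc (- A) = - (C \oc A).
Proof. by apply: bop_ext => u; rewrite bop_compE bopNE (linN (bop_lin C)). Qed.

Lemma opnorm_le A M : 0 <= M -> (forall u, nrm (A u) <= M * nrm u) ->
  (opnorm A <= M%:E)%E.
Proof.
move=> M0 h; apply: ge_ereal_sup => _ [u /= u1 <-]; rewrite lee_fin.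
apply: (le_trans (h u)); rewrite -[leRHS]mulr1 ler_wpM2l //.
by move: u1; rewrite nrmE lecR.
Qed.

Lemma opnorm_ge0 A : (0 <= opnorm A)%E.
Proof.
apply: ereal_sup_ubound; exists 0 => /=; first by rewrite normr0.
by rewrite (lin0 (bop_lin A)) normr0.
Qed.

Lemma opnorm_fin A : (opnorm A) \is a fin_num.
Proof.
have [M [lA M0 bA]] := bop_blin A; rewrite ge0_fin_numE ?opnorm_ge0 //.
by apply: le_lt_trans (opnorm_le M0 bA) _; exact: ltry.
Qed.

Lemma le_opnorm A M u : (opnorm A <= M%:E)%E -> nrm (A u) <= M * nrm u.
Proof.
move=> h; have [->|u0] := eqVneq u 0; first by rewrite (lin0 (bop_lin A)) !nrm0 mulr0.
have up : 0 < nrm u.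
  rewrite lt_neqAle nrm_ge0 andbT eq_sym; apply: contraNneq u0 => h'.
  by apply/eqP/nrm_eq0.
have vp : 0 <= (nrm u)^-1 by rewrite invr_ge0 nrm_ge0.
rewrite -ler_pdivrMr // -lee_fin; apply: le_trans h.
apply: ereal_sup_ubound; exists ((nrm u)^-1%:C *: u).
  by rewrite /= nrmE nrmZ normc_real ger0_norm // mulVf ?gt_eqF // lexx.
by rewrite -/(nrm _) (linZ (bop_lin A)) nrmZ normc_real ger0_norm // mulrC.
Qed.

Definition opn A : R := fine (opnorm A).
Lemma opn_ge0 A : 0 <= opn A. Proof. exact/fine_ge0/opnorm_ge0. Qed.
Lemma opnE A : opnorm A = (opn A)%:E.
Proof. by rewrite fineK ?opnorm_fin. Qed.
Lemma nrm_bop A u : nrm (A u) <= opn A * nrm u.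
Proof. by apply: le_opnorm; rewrite opnE. Qed.
Lemma bop_blin_opn A : blin A (opn A).
Proof. by split; [exact: bop_lin|exact: opn_ge0|exact: nrm_bop]. Qed.

Lemma cvg_bop A {T : Type} {F : set_system T} {FF : Filter F} (g : T -> H) (l : H) :
  g @ F --> l -> (fun x => A (g x)) @ F --> A l.
Proof. exact: (cvg_blin (bop_blin_opn A)). Qed.

Definition sa A := forall u v, inner (A u) v = inner u (A v).

Lemma positive_real A u : positive A -> inner (A u) u = (complex.Re (inner (A u) u))%:C.
Proof. by move=> pA; rewrite RRe_real // realE pA. Qed.

Lemma positive_sa A : positive A -> sa A.
Proof.
move=> pA u v.
have im0 x : complex.Im (inner (A x) x) = 0 by exact/ger0_Im/pA.
have h1 := im0 (u + v); have h2 := im0 (u + 'i%C *: v).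
rewrite (linD (bop_lin A)) ?(linZ (bop_lin A)) innerDl !innerDr !cImD !im0 in h1.
rewrite (linD (bop_lin A)) ?(linZ (bop_lin A)) innerDl !innerDr !innerZl !innerZr
  !cImD !cImM !cReM !im0 /= in h2.
rewrite (innerC u); apply: complex_ext; rewrite ?cReJ ?cImJ; lra.
Qed.

Lemma bop_polarization A u v : 4 * inner (A u) v =
  inner (A (u + v)) (u + v) - inner (A (u - v)) (u - v)
  + 'i%C * inner (A (u + 'i%C *: v)) (u + 'i%C *: v)
  - 'i%C * inner (A (u - 'i%C *: v)) (u - 'i%C *: v).
Proof.
rewrite !(linD (bop_lin _)) !(linN (bop_lin _)) !(linZ (bop_lin _)).
rewrite !(innerDl, innerDr, innerNl, innerNr, innerZl, innerZr).
have iJ : conjc 'i%C = - 'i%C :> R[i] by apply: complex_ext => /=; rewrite ?oppr0.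
have := sqr_i R; rewrite expr2 iJ => i2.
set p := inner (A u) u; set q := inner (A u) v; set r := inner (A v) u; set s := inner (A v) v.
transitivity (2 * (q + r) + 2 * (-('i%C * 'i%C)) * q + 2 * ('i%C * 'i%C) * r).
  by rewrite i2; ring.
ring.
Qed.

End BoundedOperatorTheory.

Section Forms.
Variable R : realType.

Lemma form_op (H K : hilbertType R) (e : nat -> K) (B : H -> K -> R[i]) M :
  onseq e -> 0 <= M ->
  (forall a u v w, B (a *: u + v) w = a * B u w + B v w) ->
  (forall a u v w, B w (a *: u + v) = conjc a * B w u + B w v) ->
  (forall u v, normc (B u v) <= M * nrm u * nrm v) ->
  exists2 A : H -> K, blin A M & forall u v, inner (A u) v = B u v.
Proof.
move=> one M0 Bl Br bB.
have /choice[A hA] u : exists w, forall v, B u v = inner w v.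
  have [||w hw] := riesz one (phi := fun v => conjc (B u v)) _ (mulr_ge0 M0 (nrm_ge0 u)).
  - by move=> a v w; rewrite Br rmorphD rmorphM /= conjcK.
  - by move=> v; rewrite normc_conj.
  by exists w => v; rewrite innerC -hw conjcK.
exists A => //; split => // [a u v|u].
  by apply: inner_inj => w; rewrite inner_linearl -!hA Bl.
have := bB u (A u); rewrite hA inner_nrm2 normc_real ger0_norm ?sqr_ge0 // expr2.
have [->|n0] := eqVneq (nrm (A u)) 0; first by rewrite mulr_ge0.
by rewrite ler_pM2r // lt_neqAle eq_sym n0 nrm_ge0.
Qed.

Variables (H : hilbertType R) (e : nat -> H).
Hypothesis one : onseq e.
Implicit Types A B : bop H.

Lemma form_bop (B : H -> H -> R[i]) M :
  0 <= M ->
  (forall a u v w, B (a *: u + v) w = a * B u w + B v w) ->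
  (forall a u v w, B w (a *: u + v) = conjc a * B w u + B w v) ->
  (forall u v, normc (B u v) <= M * nrm u * nrm v) ->
  exists A : bop H, forall u v, inner (A u) v = B u v.
Proof.
move=> M0 Bl Br bB; have [A bA hA] := form_op one M0 Bl Br bB.
by have [A' hA'] := bop_exists bA; exists A' => u v; rewrite hA'.
Qed.

Lemma adjointP A u v : inner (A u) v = inner u (adjoint A v).
Proof.
have : exists B : bop H, forall u v, inner (A u) v = inner u (B v).
  have [|a x y w|a x y w|x y|B hB] := @form_bop (fun v u => inner v (A u)) (opn A).
  - exact: opn_ge0.
  - by rewrite inner_linearl.
  - by rewrite bop_lin innerDr innerZr.
  - apply: (le_trans (cauchy_schwarz _ _)).
    by rewrite (mulrC (opn A)) -mulrA ler_wpM2l ?nrm_ge0 // nrm_bop.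
  by exists B => x y; rewrite innerC -hB -innerC.
by move=> /(xgetPex 0) /(_ u v).
Qed.

Lemma adjointPr A u v : inner u (A v) = inner (adjoint A u) v.
Proof. by rewrite innerC adjointP -innerC. Qed.

Lemma bop_inner_ext A B : (forall m n, inner (A (e n)) (e m) = inner (B (e n)) (e m)) ->
  A = B.
Proof.
move=> h; apply: bop_ext.
have [_ _ eD] := one.
apply: (dense_eq eD (bop_blin_opn A) (bop_blin_opn B)) => _ [n _ <-].
apply: inner_inj => v.
have h1 := @cvg_onproj _ _ _ one v.
have h2 := cvg_innerr (FF := eventually_filter) (w := A (e n)) h1; have h3 := cvg_innerr (FF := eventually_filter) (w := B (e n)) h1.
apply: (ccvg_unique h2 h3) => N.
rewrite !inner_sumr; apply: eq_bigr => k _; by rewrite !innerZr h.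
Qed.

End Forms.

Section PositiveOperators.
Variables (R : realType) (H : hilbertType R).
Implicit Types A B : bop H.

Lemma positive_ge0 A u : positive A -> 0 <= complex.Re (inner (A u) u).
Proof. by move=> pA; rewrite -ler0c -positive_real. Qed.

Lemma positiveP A : sa A -> (forall u, 0 <= complex.Re (inner (A u) u)) -> positive A.
Proof.
move=> sA pA u; rewrite le0cE pA andbT; apply/eqP.
have := sA u u; rewrite (innerC u) => /(congr1 (@complex.Im _)); rewrite cImJ; lra.
Qed.

Lemma positive_cs A u v : positive A ->
  normc (inner (A u) v) ^+ 2 <= complex.Re (inner (A u) u) * complex.Re (inner (A v) v).
Proof.
move=> pA; apply: (@cauchy_schwarz_form _ _ (fun u v => inner (A u) v)).
- by move=> a x y z; rewrite bop_lin inner_linearl.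
- by move=> x y; rewrite (positive_sa pA) innerC.
- exact: pA.
Qed.

Lemma positive_eq0 A u : positive A -> inner (A u) u = 0 -> A u = 0.
Proof.
move=> pA h; apply: nrm_eq0; have := positive_cs u (A u) pA.
rewrite h mul0r inner_nrm2 normc_real ger0_norm ?sqr_ge0 // -exprM => h'.
have : nrm (A u) ^+ 4 == 0 by rewrite eq_le h' exprn_ge0.
by rewrite expf_eq0 => /eqP.
Qed.

Lemma positive0 : positive (0 : bop H).
Proof. by move=> u; rewrite bop0E inner0l. Qed.
Lemma positive1 : positive (@bop1 R H).
Proof. by move=> u; rewrite bop1E inner_nrm2 ler0c sqr_ge0. Qed.
Lemma positiveD A B : positive A -> positive B -> positive (A + B).
Proof. by move=> pA pB u; rewrite bopDE innerDl addr_ge0. Qed.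
Lemma positiveZ (c : R) A : 0 <= c -> positive A -> positive (c%:C *: A).
Proof. by move=> c0 pA u; rewrite bopZE innerZl mulr_ge0 // ler0c. Qed.
Lemma positive_conj A (T T' : bop H) : (forall u v, inner (T u) v = inner u (T' v)) ->
  positive A -> positive (T' \oc A \oc T).
Proof. by move=> hT pA u; rewrite !bop_compE innerC -hT -innerC. Qed.
Lemma positive_sqr (T : bop H) : sa T -> positive (T \oc T).
Proof. by move=> sT u; rewrite bop_compE sT inner_nrm2 ler0c sqr_ge0. Qed.

Lemma sa1 : sa (@bop1 R H). Proof. by []. Qed.
Lemma saD A B : sa A -> sa B -> sa (A + B).
Proof. by move=> h1 h2 u v; rewrite !bopDE innerDl innerDr h1 h2. Qed.
Lemma saN A : sa A -> sa (- A).
Proof. by move=> h1 u v; rewrite !bopNE innerNl innerNr h1. Qed.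
Lemma saZ (c : R) A : sa A -> sa (c%:C *: A).
Proof. by move=> h1 u v; rewrite !bopZE innerZl innerZr conjc_real h1. Qed.

Lemma positive_contraction A : positive A -> positive (bop1 H - A) ->
  forall u, nrm (A u) <= nrm u.
Proof.
move=> pA pB u.
have le v : complex.Re (inner (A v) v) <= nrm v ^+ 2.
  by have := positive_ge0 v pB; rewrite bopBE innerBl bop1E cReD cReN -nrm2E subr_ge0.
have := positive_cs u (A u) pA.
rewrite inner_nrm2 normc_real ger0_norm ?sqr_ge0 // => h.
have := le u; have := le (A u); have := positive_ge0 u pA => h1 h2 h3.
have {h1 h2 h3}h4 : nrm (A u) ^+ 2 ^+ 2 <= nrm u ^+ 2 * nrm (A u) ^+ 2.
  by apply: (le_trans h); rewrite ler_pM // (positive_ge0 _ pA).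
have [->|n0] := eqVneq (nrm (A u)) 0; first exact: nrm_ge0.
rewrite -(ler_pXn2r (n := 2)) ?nnegrE ?nrm_ge0 //.
by move: h4; rewrite [X in X <= _ -> _]expr2 ler_pM2r // exprn_gt0 // lt_neqAle eq_sym n0 nrm_ge0.
Qed.

End PositiveOperators.

Lemma cvg_nrm_le (R : realType) (H : hilbertType R) {T : Type} {F : set_system T}
    {FF : ProperFilter F} (f : T -> H) (l : H) (M : R) :
  f @ F --> l -> (forall x, nrm (f x) <= M) -> nrm l <= M.
Proof.
move=> /cvg_nrm h fM; rewrite -subr_le0; apply: (cvgr_to_ge h).
apply: nearW => x; have := nrmD (f x) (- (f x - l)).
rewrite opprB addrC subrK -(nrmN (l - _)) opprB; have := fM x; lra.
Qed.

Section SquareRoot.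
Variables (R : realType) (H : hilbertType R).
Implicit Types A B X Z : bop H.

(* Fixed-point iteration for [Y = (X + Y^2)/2], that is [(1 - Y)^2 = 1 - X];
   the scalar iteration [sqrt_iterR], at [X = 1], dominates its increments. *)
Fixpoint sqrt_iter X (n : nat) : bop H :=
  if n is n'.+1 then (2^-1)%:C *: (X + sqrt_iter X n' \oc sqrt_iter X n') else 0.

Fixpoint sqrt_iterR (n : nat) : R :=
  if n is n'.+1 then 2^-1 * (1 + sqrt_iterR n' ^+ 2) else 0.

Local Notation y := sqrt_iterR.

Lemma sqrt_iter0 X : sqrt_iter X 0 = 0. Proof. by []. Qed.
Lemma sqrt_iterS X n : sqrt_iter X n.+1 =
  (2^-1)%:C *: (X + sqrt_iter X n \oc sqrt_iter X n).
Proof. by []. Qed.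

Lemma sqrt_iterR_bnd n : 0 <= y n <= 1.
Proof.
elim: n => [|n /= /andP[y0 y1]]; first by rewrite /= lexx ler01.
by apply/andP; split; nra.
Qed.

Lemma sqrt_iterR_nd : {homo y : n m / (n <= m)%N >-> n <= m}.
Proof.
apply/nondecreasing_seqP; elim => [|n IH] /=; first by rewrite expr0n addr0 mulr1 invr_ge0.
rewrite ler_pM2l ?invr_gt0 // lerD2l ler_pXn2r ?nnegrE //.
  by case/andP: (sqrt_iterR_bnd n).
by case/andP: (sqrt_iterR_bnd n.+1).
Qed.

Lemma sqrt_iterR_cvg : cvg (y @ \oo).
Proof.
apply: nondecreasing_is_cvgn; first exact: sqrt_iterR_nd.
by exists 1 => _ [n _ <-]; case/andP: (sqrt_iterR_bnd n).
Qed.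

Lemma sqrt_iter_comm X Z n : Z \oc X = X \oc Z ->
  Z \oc sqrt_iter X n = sqrt_iter X n \oc Z.
Proof.
move=> ZX; elim: n => [|n IH] /=.
  by apply: bop_ext => u; rewrite !bop_compE !bop0E (lin0 (bop_lin Z)).
rewrite bop_compZr bop_compZl bop_compDr bop_compDl ZX; congr (_ *: (_ + _)).
by rewrite bop_compA IH -bop_compA IH bop_compA.
Qed.

Lemma sqrt_iter_sa X n : sa X -> sa (sqrt_iter X n).
Proof.
move=> sX; elim: n => [|n IH] /=; first by move=> u v; rewrite !bop0E inner0l inner0r.
by apply: saZ; apply: saD => // u v; rewrite !bop_compE !IH.
Qed.

Section Contraction.
Variable X : bop H.
Hypothesis cX : forall u, nrm (X u) <= nrm u.
Local Notation Y := (sqrt_iter X).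

Lemma nrm_half (v : H) : nrm ((2^-1)%:C *: v) = 2^-1 * nrm v.
Proof. by rewrite nrmZ normc_real ger0_norm // invr_ge0. Qed.

Lemma sqrt_iter_nrm n u : nrm (Y n u) <= y n * nrm u.
Proof.
elim: n u => [|n IH] u; first by rewrite sqrt_iter0 bop0E nrm0 mul0r.
rewrite sqrt_iterS [y _]/= bopZE nrm_half -mulrA ler_pM2l ?invr_gt0 // mulrDl mul1r bopDE.
apply: (le_trans (nrmD _ _)); apply: lerD => //.
apply: (le_trans (IH _)); rewrite expr2 -mulrA ler_wpM2l //.
by case/andP: (sqrt_iterR_bnd n).
Qed.

Lemma sqrt_iter_incr n u : nrm ((Y n.+1 - Y n) u) <= (y n.+1 - y n) * nrm u.
Proof.
elim: n u => [|n IH] u.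
  by rewrite sqrt_iter0 [y 0]/= !subr0; exact: (sqrt_iter_nrm 1).
have YY : Y n.+1 \oc Y n = Y n \oc Y n.+1.
  by apply: sqrt_iter_comm; rewrite (sqrt_iter_comm (X := X) (Z := X)).
have -> : Y n.+2 - Y n.+1 = (2^-1)%:C *: ((Y n.+1 - Y n) \oc (Y n.+1 + Y n)).
  rewrite [Y n.+2]sqrt_iterS {2}[Y n.+1]sqrt_iterS -scalerBr opprD addrACA subrr add0r.
  congr (_ *: _); rewrite bop_compDl !bop_compDr !bop_compNl YY.
  by rewrite addrA addrK.
have -> : y n.+2 - y n.+1 = 2^-1 * ((y n.+1 - y n) * (y n.+1 + y n)).
  have yS k : y k.+1 = 2^-1 * (1 + y k ^+ 2) by [].
  rewrite [y n.+2]yS {2}[y n.+1]yS; ring.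
rewrite bopZE nrm_half -mulrA ler_pM2l ?invr_gt0 // bop_compE.
apply: (le_trans (IH _)); rewrite -mulrA ler_wpM2l //.
  by rewrite subr_ge0 sqrt_iterR_nd.
rewrite bopDE mulrDl; apply: (le_trans (nrmD _ _)).
by apply: lerD; exact: sqrt_iter_nrm.
Qed.

Lemma sqrt_iter_dist n m u : (n <= m)%N ->
  nrm (Y m u - Y n u) <= (y m - y n) * nrm u.
Proof.
move=> /subnKC <-; elim: (m - n)%N => [|k IH]; first by rewrite addn0 !subrr nrm0 mul0r.
rewrite addnS -(subrKA (Y (n + k) u)) -(subrKA (y (n + k))) mulrDl.
apply: (le_trans (nrmD _ _)); apply: lerD => //.
by rewrite -bopBE sqrt_iter_incr.
Qed.

Lemma sqrt_iter_cvg : exists2 Z : bop H, (forall u, Y n u @[n --> \oo] --> Z u) &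
  (forall u, nrm (Z u) <= nrm u).
Proof.
have cY u : cvg (Y n u @[n --> \oo]).
  apply: (cvg_increments (S := fun n => y n * nrm u) (p := 0)).
    by apply: is_cvgMl; exact: sqrt_iterR_cvg.
  by move=> n m nm; rewrite expr1 -mulrBl sqrt_iter_dist.
pose Z u := lim (Y n u @[n --> \oo]).
have nZ u : nrm (Z u) <= nrm u.
  apply: (cvg_nrm_le (cY u)) => n; apply: (le_trans (sqrt_iter_nrm _ _)).
  by rewrite ler_piMl //; case/andP: (sqrt_iterR_bnd n).
have lZ : linear Z.
  move=> a u v; apply/cvg_lim => //.
  have h : a *: Y n u + Y n v @[n --> \oo] --> a *: Z u + Z v.
    by apply: cvgD; [apply: cvgZl_tmp|]; exact: cY.
  apply: cvg_trans h; apply: near_eq_cvg; apply: nearW => n /=.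
  by rewrite bop_lin.
have [|A hA] := @bop_exists _ _ Z 1; first by split => // u; rewrite mul1r.
by exists A => u; rewrite hA //; exact: cY.
Qed.

Lemma sqrt_contraction : sa X -> exists S : bop H,
  [/\ positive S, S \oc S = bop1 H - X,
      forall Z, Z \oc X = X \oc Z -> Z \oc S = S \oc Z &
      forall u, u - Y n u @[n --> \oo] --> S u].
Proof.
move=> sX; have [Z hZ bZ] := sqrt_iter_cvg.
have cS u : u - Y n u @[n --> \oo] --> (bop1 H - Z) u.
  by rewrite bopBE bop1E; apply: cvgB => //; exact: cvg_cst.
have sZ : sa Z.
  move=> u v; have h1 := cvg_inner (FF := eventually_filter) (w := v) (hZ u).
  have h2 := cvg_innerr (FF := eventually_filter) (w := u) (hZ v).
  by apply: (ccvg_unique h1 h2) => n; rewrite sqrt_iter_sa.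
have ZE : Z = (2^-1)%:C *: (X + Z \oc Z).
  apply: bop_ext => u.
  have hZZ : Y n (Y n u) @[n --> \oo] --> Z (Z u).
    have h1 : Y n (Y n u - Z u) @[n --> \oo] --> (0 : H).
      apply/cvg_nrm; have /cvg_nrm h := hZ u.
      apply: (squeeze_cvgr _ (cvg_cst (0:R)) h); apply: nearW => n.
      rewrite subr0 nrm_ge0 /=; apply: (le_trans (sqrt_iter_nrm _ _)).
      by rewrite ler_piMl //; case/andP: (sqrt_iterR_bnd n).
    have h2 : Y n (Y n u - Z u) + Y n (Z u) @[n --> \oo] --> Z (Z u).
      by rewrite -[X in _ --> X]add0r; apply: cvgD.
    apply: cvg_trans h2; apply: near_eq_cvg; apply: nearW => n /=.
    by rewrite (linB (bop_lin _)) subrK.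
  have h1 : Y n.+1 u @[n --> \oo] --> Z u.
    by have := hZ u; rewrite -(cvg_shiftS (fun n => Y n u)).
  have h2 : Y n.+1 u @[n --> \oo] --> ((2^-1)%:C *: (X + Z \oc Z)) u.
    rewrite bopZE bopDE bop_compE.
    have : (2^-1)%:C *: (X u + Y n (Y n u)) @[n --> \oo] --> (2^-1)%:C *: (X u + Z (Z u)).
      by apply: cvgZl_tmp; apply: cvgD => //; exact: cvg_cst.
    exact.
  exact: (cvg_unique (@norm_hausdorff _ H) h1 h2).
exists (bop1 H - Z); split => //.
- apply: positiveP => [|u]; first by apply: saD; [exact: sa1|exact: saN].
  rewrite bopBE innerBl bop1E cReD cReN -nrm2E subr_ge0.
  apply: (le_trans (ler_norm _)); apply: (le_trans (ler_Re_normc _)).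
  apply: (le_trans (cauchy_schwarz _ _)); rewrite expr2 ler_wpM2r //.
- have -> : X = (2 : R)%:C *: Z - Z \oc Z.
    by rewrite {1}ZE scalerA -rmorphM /= divff ?pnatr_eq0 // scale1r addrK.
  rewrite bop_compDl bop_1comp bop_compNl bop_compDr bop_comp1 bop_compNr.
  by rewrite rmorph_nat scaler_nat mulr2n !opprD !opprK !addrA.
- move=> W WX.
  have WZ : W \oc Z = Z \oc W.
    apply: bop_ext => u; rewrite !bop_compE.
    have h1 : W (Y n u) @[n --> \oo] --> W (Z u) by exact: cvg_bop.
    apply: (cvg_unique (@norm_hausdorff _ H) h1).
    have := hZ (W u); apply: cvg_trans; apply: near_eq_cvg; apply: nearW => n.
    by have /(congr1 (fun A : bop H => A u)) := sqrt_iter_comm n WX.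
  by rewrite bop_compDr bop_compDl bop_compNr bop_compNl bop_comp1 bop_1comp WZ.
Qed.

End Contraction.
End SquareRoot.

Section OperatorSquareRoot.
Variables (R : realType) (H : hilbertType R).
Implicit Types A B S : bop H.

Definition sqrt_scale (M : R) A : bop H := bop1 H - (M^-1)%:C *: A.

Lemma sqrt_bounded A (M : R) : positive A -> 0 < M ->
  (forall u, nrm (A u) <= M * nrm u) ->
  exists S : bop H,
  [/\ positive S, S \oc S = A,
      forall Z, Z \oc A = A \oc Z -> Z \oc S = S \oc Z &
      forall u, (Num.sqrt M)%:C *: (u - sqrt_iter (sqrt_scale M A) n u) @[n --> \oo] --> S u].
Proof.
move=> pA M0 bA; set X := sqrt_scale M A.
have Mi0 : 0 <= M^-1 by rewrite invr_ge0 ltW.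
have X1 : bop1 H - X = (M^-1)%:C *: A by rewrite opprB addrC subrK.
have pX1 : positive (bop1 H - X) by rewrite X1; exact: positiveZ.
have sX : sa X by apply: saD; [exact: sa1|apply: saN; apply: saZ; exact: positive_sa].
have pX : positive X.
  apply: positiveP => // u; rewrite bopBE innerBl bop1E bopZE innerZl cReD cReN cReZ -nrm2E.
  rewrite subr_ge0 mulrC ler_pdivrMr //.
  apply: (le_trans (ler_norm _)); apply: (le_trans (ler_Re_normc _)).
  apply: (le_trans (cauchy_schwarz _ _)); rewrite expr2 mulrC -mulrA ler_wpM2l //.
  by rewrite mulrC bA.
have [S [pS SS cS hS]] := sqrt_contraction (positive_contraction pX pX1) sX.
have sM := sqr_sqrtr (ltW M0).
exists ((Num.sqrt M)%:C *: S); split.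
- by apply: positiveZ.
- rewrite bop_compZl bop_compZr scalerA SS X1 scalerA -!rmorphM -expr2 sM.
  by rewrite divff ?gt_eqF // scale1r.
- move=> Z ZA; rewrite bop_compZl bop_compZr cS //.
  by rewrite bop_compDr bop_compDl bop_compNr bop_compNl bop_comp1 bop_1comp
    bop_compZr bop_compZl ZA.
- by move=> u; apply: cvgZl_tmp; exact: hS.
Qed.

Lemma positive_sqrt_uniq A S B : positive S -> S \oc S = A ->
  (forall Z, Z \oc A = A \oc Z -> Z \oc S = S \oc Z) ->
  positive B -> B \oc B = A -> B = S.
Proof.
move=> pS SS cS pB BB.
have BS : B \oc S = S \oc B by apply: cS; rewrite -BB bop_compA.
apply: bop_ext => u; apply/eqP; rewrite -subr_eq0; apply/eqP/nrm_eq0.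
set w := (B - S) u.
have Dw : (B + S) w = 0.
  rewrite -bop_compE bop_compDr bop_compNr !bop_compDl BB SS BS.
  by rewrite [A + _]addrC subrr.
have sD : sa (B - S).
  by apply: saD; [exact: positive_sa|apply: saN; exact: positive_sa].
have Bw0 : inner (B w) w + inner (S w) w = 0 by rewrite -innerDl -bopDE Dw inner0l.
have [Bw Sw] : inner (B w) w = 0 /\ inner (S w) w = 0.
  move/eqP: Bw0; rewrite paddr_eq0 ?pB ?pS // => /andP[/eqP-> /eqP->].
  by [].
have Bw' := positive_eq0 pB Bw; have Sw' := positive_eq0 pS Sw.
have /eqP : nrm w ^+ 2 = 0.
  by rewrite nrm2E {1}/w sD bopBE Bw' Sw' subrr inner0r.
by rewrite expf_eq0 => /andP[_ /eqP].
Qed.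

Lemma bop_bound A : exists2 M : R, 0 < M & forall u, nrm (A u) <= M * nrm u.
Proof.
exists (opn A + 1); first by have := opn_ge0 A; lra.
by move=> u; have := nrm_bop A u; have := nrm_ge0 u; nra.
Qed.

Lemma opsqrtP A : positive A -> positive (opsqrt A) /\ opsqrt A \oc opsqrt A = A.
Proof.
move=> pA; have [M M0 bA] := bop_bound A.
have [S [pS SS _ _]] := sqrt_bounded pA M0 bA.
have : exists S : bop H, positive S /\ S \oc S = A by exists S.
by move=> /(xgetPex 0).
Qed.

Lemma opsqrt_eq A B : positive B -> B \oc B = A -> opsqrt A = B.
Proof.
move=> pB BB; have pA : positive A by rewrite -BB; apply: positive_sqr; exact: positive_sa.
have [M M0 bA] := bop_bound A; have [S [pS SS cS _]] := sqrt_bounded pA M0 bA.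
have [pT TT] := opsqrtP pA.
by rewrite (positive_sqrt_uniq pS SS cS pT TT) (positive_sqrt_uniq pS SS cS pB BB).
Qed.

Lemma opsqrt_positive A : positive (opsqrt A).
Proof.
rewrite /opsqrt; case: xgetP => [S _ []//|_]; exact: positive0.
Qed.

Lemma opsqrt_cvg A (M : R) u : positive A -> 0 < M ->
  (forall u, nrm (A u) <= M * nrm u) ->
  (Num.sqrt M)%:C *: (u - sqrt_iter (sqrt_scale M A) n u) @[n --> \oo] --> opsqrt A u.
Proof.
move=> pA M0 bA; have [S [pS SS cS h]] := sqrt_bounded pA M0 bA.
by rewrite (opsqrt_eq pS SS).
Qed.

End OperatorSquareRoot.

#[global] Existing Instance summability.totally_filter.

(** * Trace and states *)

Section UnorderedSums.
Import finmap.
Variables (I : countType).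

Definition zeropad (V : zmodType) (a : I -> V) (n : nat) : V :=
  if pickle_inv n is Some i then a i else 0.

Definition has_sum (R : realType) (a : I -> R[i]^o) (l : R[i]) : Prop :=
  summability.partial_sum a @ summability.totally --> (l : R[i]^o).

Definition initial (N : nat) : seq I := pmap pickle_inv (iota 0 N).

Lemma initial_uniq N : uniq (initial N).
Proof.
by apply: (pmap_uniq (@pickle_invK I)); exact: iota_uniq.
Qed.

Lemma mem_initial N i : (i \in initial N) = (choice.pickle i < N)%N.
Proof.
rewrite /initial mem_pmap; apply/mapP/idP.
  move=> [n + h]; rewrite mem_iota /= => nN.
  by have := pickle_invK (T := I) n; rewrite -h /= => ->.
by move=> iN; exists (choice.pickle i); rewrite ?mem_iota // pickleK_inv.
Qed.

Lemma sum_zeropad (V : zmodType) (a : I -> V) N :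
  \sum_(0 <= n < N) zeropad a n = \sum_(i <- initial N) a i.
Proof.
rewrite /initial /index_iota subn0 /zeropad.
elim: (iota 0 N) => [|n s IH]; first by rewrite !big_nil.
by rewrite big_cons IH /=; case: pickle_inv => [i|] /=; rewrite ?big_cons ?add0r.
Qed.

Definition initial_fset N : {fset I} := seq_fset tt (initial N).

Lemma partial_sum_initial (V : zmodType) (a : I -> V) N :
  summability.partial_sum a (initial_fset N) = \sum_(0 <= n < N) zeropad a n.
Proof.
rewrite sum_zeropad /summability.partial_sum -(big_seq_fsetE _ _ predT a) /=.
apply: perm_big; apply: uniq_perm; rewrite ?sort_keys_uniq ?initial_uniq // => i.
by rewrite sort_keysE.
Qed.

Lemma initial_totally : initial_fset @ \oo --> (@summability.totally I).
Proof.
move=> P [A _ AP].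
have [N hN] : exists N, forall i, i \in A -> (choice.pickle i < N)%N.
  exists (\max_(i <- A) choice.pickle i).+1 => i iA.
  by rewrite ltnS (leq_bigmax_seq (F := choice.pickle)).
exists N => // n /= Nn; apply: AP; apply/fsubsetP => i iA.
by rewrite seq_fsetE mem_initial (leq_trans (hN i iA)).
Qed.

Lemma has_sum_series (R : realType) (a : I -> R[i]^o) (l : R[i]) : has_sum a l ->
  (\sum_(0 <= n < N) zeropad a n : R[i]^o) @[N --> \oo] --> (l : R[i]^o).
Proof.
move=> h; under eq_fun do rewrite -partial_sum_initial.
apply: (cvg_comp _ _ initial_totally); exact: h.
Qed.

Lemma ler_sum_sub (R : realType) (a : I -> R) (s1 s2 : seq I) :
  (forall i, 0 <= a i) -> uniq s1 -> uniq s2 -> {subset s1 <= s2} ->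
  \sum_(i <- s1) a i <= \sum_(i <- s2) a i.
Proof.
move=> a0 u1 u2 s12.
have p12 : perm_eq s1 [seq i <- s2 | i \in s1].
  apply: uniq_perm; rewrite ?filter_uniq // => i; rewrite mem_filter.
  by case: (boolP (i \in s1)) => // /s12 ->.
rewrite (perm_big _ p12) /=.
rewrite big_filter big_mkcond; apply: ler_sum => i _.
by case: ifP.
Qed.

Lemma series_has_sum (R : realType) (a : I -> R) (l : R) : (forall i, 0 <= a i) ->
  \sum_(0 <= n < N) zeropad a n @[N --> \oo] --> l ->
  has_sum (fun i => (a i)%:C) l%:C.
Proof.
move=> a0 h.
have z0 n : 0 <= zeropad a n by rewrite /zeropad; case: pickle_inv.
have nd : nondecreasing_seq (fun N => \sum_(0 <= n < N) zeropad a n).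
  by apply/nondecreasing_seqP => n; rewrite big_nat_recr //= lerDl.
have le_l N : \sum_(0 <= n < N) zeropad a n <= l.
  rewrite -(cvg_lim _ h) //; apply: nondecreasing_cvgn_le => //.
  by apply: cvgP h.
have psE A : summability.partial_sum (fun i => (a i)%:C) A =
    (\sum_(i <- enum_fset A) a i)%:C :> R[i].
  by rewrite rmorph_sum /summability.partial_sum -(big_seq_fsetE _ _ predT (fun i => (a i)%:C)).
apply/cvg_normc/cvgr0Pnorm_lt => d d0.
have /cvgrPdist_lt/(_ d d0)[N _ /(_ N (leqnn N)) /= hN] := h.
exists (initial_fset N) => // A /= /fsubsetP NA.
rewrite psE -rmorphB normc_real normr_id distrC.
have [N' hN'] : exists N', {subset enum_fset A <= initial N'}.
  exists (\max_(i <- A) choice.pickle i).+1 => i iA.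
  by rewrite mem_initial ltnS (leq_bigmax_seq (F := choice.pickle)).
have h1 : \sum_(i <- enum_fset A) a i <= l.
  apply: le_trans (le_l N'); rewrite sum_zeropad.
  by apply: ler_sum_sub; rewrite ?fset_uniq ?initial_uniq.
have h2 : \sum_(0 <= n < N) zeropad a n <= \sum_(i <- enum_fset A) a i.
  rewrite sum_zeropad; apply: ler_sum_sub; rewrite ?fset_uniq ?initial_uniq //.
  by move=> i iN; apply: NA; rewrite seq_fsetE.
by rewrite ger0_norm ?subr_ge0 // (le_lt_trans _ hN) // ger0_norm ?subr_ge0 // lerB.
Qed.
End UnorderedSums.

Section SeriesConversion.
Variable R : realType.

Lemma cvg_nneseries (a : nat -> R) (l : R) : (forall n, 0 <= a n) ->
  (\sum_(0 <= n < N) a n @[N --> \oo] --> l) <->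
  (\sum_(0 <= n <oo) (a n)%:E = l%:E)%E.
Proof.
move=> a0.
have aE : (fun N => \sum_(0 <= n < N) a n) =
    fine \o (fun N => \sum_(0 <= n < N) (a n)%:E)%E.
  by apply/funext => N /=; rewrite sumEFin.
split=> [h|h].
  apply/cvg_lim => //; apply: cvg_EFin; last by rewrite -aE.
  by apply: nearW => N; rewrite sumEFin.
rewrite aE; apply: fine_cvg; rewrite -h.
by apply: is_cvg_nneseries => n _ _; rewrite lee_fin.
Qed.

Lemma cvg_series_le (a b : nat -> R) (l : R) : (forall n, 0 <= a n <= b n) ->
  \sum_(0 <= n < N) b n @[N --> \oo] --> l ->
  exists l' : R, \sum_(0 <= n < N) a n @[N --> \oo] --> l'.
Proof.
move=> ab h; suff : cvgn (fun N => \sum_(0 <= n < N) a n) by move=> /cvg_ex.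
have b0 n : 0 <= b n by have /andP[h1 h2] := ab n; exact: le_trans h1 h2.
apply: nondecreasing_is_cvgn.
  by apply/nondecreasing_seqP => n; rewrite big_nat_recr //= lerDl; case/andP: (ab n).
exists l => _ [N _ <-]; apply: (@le_trans _ _ (\sum_(0 <= n < N) b n)).
  by apply: ler_sum => n _; case/andP: (ab n).
rewrite -(cvg_lim _ h) //; apply: nondecreasing_cvgn_le; last exact: cvgP h.
by apply/nondecreasing_seqP => n; rewrite big_nat_recr //= lerDl.
Qed.

End SeriesConversion.

Section Trace.
Variables (R : realType) (H : hilbertType R).

Lemma hilbert_schmidt_adjoint (e : nat -> H) (Z Z' : bop H) (l : R) :
  onseq e -> (forall u v, inner (Z u) v = inner u (Z' v)) ->
  \sum_(0 <= n < N) nrm (Z' (e n)) ^+ 2 @[N --> \oo] --> l ->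
  \sum_(0 <= n < N) nrm (Z (e n)) ^+ 2 @[N --> \oo] --> l.
Proof.
move=> one ZZ'.
have s0 (u : nat -> H) n : 0 <= nrm (u n) ^+ 2 by exact: sqr_ge0.
rewrite !cvg_nneseries; try by move=> n; exact: sqr_ge0.
move=> <-.
transitivity (\sum_(0 <= n <oo) \sum_(0 <= m <oo) (normc (inner (Z (e n)) (e m)) ^+ 2)%:E)%E.
  apply: eq_eseriesr => n _; apply/esym/cvg_nneseries; first by move=> m; exact: sqr_ge0.
  exact: parseval_nrm.
rewrite nneseries_interchange; last by move=> i j; rewrite lee_fin sqr_ge0.
apply: eq_eseriesr => n _.
transitivity (\sum_(0 <= m <oo) (normc (inner (Z' (e n)) (e m)) ^+ 2)%:E)%E.
  by apply: eq_eseriesr => m _; rewrite ZZ' innerC normc_conj.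
apply/cvg_nneseries; first by move=> m; exact: sqr_ge0.
exact: parseval_nrm.
Qed.

Variables (I : countType) (e : I -> H).
Hypothesis onbe : onb e.
Local Notation E := (onenum e).
Let oneE : onseq E := onseq_onenum onbe.

Lemma zeropad_inner (V : zmodType) (f : H -> V) : f 0 = 0 ->
  zeropad (fun i => f (e i)) = (fun n => f (E n)).
Proof.
by move=> f0; apply/funext => n; rewrite /zeropad /onenum; case: pickle_inv.
Qed.

Lemma has_sumD (a b : I -> R[i]^o) (k l : R[i]) : has_sum a k -> has_sum b l ->
  has_sum (fun i => a i + b i : R[i]^o) (k + l).
Proof.
move=> ha hb.
have h : summability.partial_sum a A + summability.partial_sum b A
    @[A --> summability.totally] --> (k + l : R[i]^o) by exact: cvgD ha hb.
apply: cvg_trans h; apply: near_eq_cvg; apply: nearW => A.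
by rewrite /summability.partial_sum big_split.
Qed.

Lemma has_sumZ (c : R[i]) (a : I -> R[i]^o) (k : R[i]) : has_sum a k ->
  has_sum (fun i => c * a i : R[i]^o) (c * k).
Proof.
move=> ha.
have h : c *: summability.partial_sum a A
    @[A --> summability.totally] --> (c *: k : R[i]^o) by exact: cvgZl_tmp ha.
apply: cvg_trans h; apply: near_eq_cvg; apply: nearW => A.
by rewrite /summability.partial_sum /= scaler_sumr.
Qed.

Lemma has_sum_uniq (a : I -> R[i]^o) (k : R[i]) : has_sum a k -> summability.sum a = k.
Proof. by move=> h; apply/cvg_lim. Qed.

(* The trace of [T T A] for a self-adjoint Hilbert-Schmidt operator [T]. *)
Lemma trace_has_sum (T A : bop H) (l : R) : sa T ->
  \sum_(0 <= n < N) nrm (T (E n)) ^+ 2 @[N --> \oo] --> l ->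
  exists2 L : R[i], has_sum (diag_terms e (T \oc T \oc A)) L &
  (\sum_(0 <= n < N) inner (A (T (E n))) (T (E n)) : R[i]^o) @[N --> \oo] --> (L : R[i]^o).
Proof.
move=> sT hT.
pose Z (c : R[i]) := T \oc A + c *: T.
pose Z' (c : R[i]) := adjoint A \oc T + conjc c *: T.
have ZZ' c u v : inner (Z c u) v = inner u (Z' c v).
  rewrite !bopDE !bopZE !bop_compE innerDl innerDr innerZl innerZr conjcK.
  by rewrite !sT (adjointP oneE).
have /choice[s hs] c : exists s : R,
    \sum_(0 <= n < N) nrm (Z' c (E n)) ^+ 2 @[N --> \oo] --> s.
  pose k := opn (adjoint A) + normc c.
  have k0 : 0 <= k by rewrite addr_ge0 ?opn_ge0.
  apply: (@cvg_series_le _ _ (fun n => k ^+ 2 * nrm (T (E n)) ^+ 2) (k ^+ 2 * l)).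
    move=> n; apply/andP; split; first exact: sqr_ge0.
    rewrite -exprMn ler_pXn2r ?nnegrE ?mulr_ge0 //.
    rewrite /Z' bopDE bopZE bop_compE mulrDl; apply: (le_trans (nrmD _ _)).
    by rewrite nrmZ normc_conj lerD2r nrm_bop.
  by under eq_fun do rewrite -mulr_sumr; exact: cvgMr.
have hsum c : has_sum (fun i => (nrm (Z c (e i)) ^+ 2)%:C) (s c)%:C.
  apply: series_has_sum => [i|]; first exact: sqr_ge0.
  rewrite (zeropad_inner (f := fun x => nrm (Z c x) ^+ 2)).
    exact: (hilbert_schmidt_adjoint oneE (ZZ' c) (hs c)).
  by rewrite (lin0 (bop_lin _)) nrm0 expr0n.
pose L := 4^-1 * ((s 1)%:C - (s (-1))%:C + 'i%C * (s 'i%C)%:C - 'i%C * (s (- 'i%C))%:C).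
have n4 : (4 : R[i]) != 0 by rewrite pnatr_eq0.
exists L.
  have h := @has_sumZ 4^-1 _ _ (has_sumD (has_sumD (has_sumD (hsum 1) (@has_sumZ (-1) _ _ (hsum (-1))))
     (@has_sumZ 'i%C _ _ (hsum 'i%C))) (@has_sumZ (- 'i%C) _ _ (hsum (- 'i%C)))).
  have -> : L = 4^-1 * ((s 1)%:C + -1 * (s (-1))%:C + 'i%C * (s 'i%C)%:C +
      - 'i%C * (s (- 'i%C))%:C) by rewrite /L mulN1r mulNr.
  apply: (eq_ind _ (fun a => has_sum a _) h); apply/funext => i.
  rewrite /diag_terms !bop_compE sT; apply/esym.
  apply: (mulfI n4); rewrite polarization mulrA divff // mul1r.
  by rewrite !bopDE !bopZE !bop_compE !scale1r !scaleN1r !scaleNr mulN1r mulNr.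
have hsC c : ((\sum_(0 <= n < N) nrm (Z' c (E n)) ^+ 2)%:C : R[i]^o) @[N --> \oo] --> ((s c)%:C : R[i]^o).
  by apply/cvg_complex; split; [exact: hs|exact: cvg_cst].
have h : (4^-1 * ((\sum_(0 <= n < N) nrm (Z' 1 (E n)) ^+ 2)%:C
     - (\sum_(0 <= n < N) nrm (Z' (-1) (E n)) ^+ 2)%:C
     + 'i%C * (\sum_(0 <= n < N) nrm (Z' 'i%C (E n)) ^+ 2)%:C
     - 'i%C * (\sum_(0 <= n < N) nrm (Z' (- 'i%C) (E n)) ^+ 2)%:C) : R[i]^o) @[N --> \oo]
     --> (L : R[i]^o).
  by apply: ccvgM; apply: ccvgB; [apply: ccvgD; [apply: ccvgB|apply: ccvgM]|apply: ccvgM];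
    exact: hsC.
apply: cvg_trans h; apply: near_eq_cvg; apply: nearW => N.
rewrite !rmorph_sum !mulr_sumr -!sumrB -big_split -sumrB mulr_sumr; apply: eq_bigr => n _.
rewrite (adjointP oneE); apply: (mulfI n4); rewrite polarization mulrA divff // mul1r.
have iJ : conjc 'i%C = - 'i%C :> R[i] by apply: complex_ext => /=; rewrite ?oppr0.
have J1 : conjc (-1) = -1 :> R[i] by apply: complex_ext => /=; rewrite ?oppr0.
have J2 : conjc (- 'i%C) = 'i%C :> R[i] by apply: complex_ext => /=; rewrite ?oppr0 ?opprK.
rewrite !bopDE !bopZE !bop_compE iJ J1 J2 conjc1 !scaleN1r !scale1r.
set x := T (E n); set y := adjoint A x.
have ii : 'i%C * 'i%C = -1 :> R[i] by rewrite -expr2 sqr_i.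
have ni (z : H) : nrm ('i%C *: z) = nrm z.
  by rewrite nrmZ /= expr0n expr1n add0r sqrtr1 mul1r.
congr (_ - _ + _ * _ - _ * _); congr (_ (_ ^+ 2)).
- by rewrite addrC.
- by rewrite -[RHS]nrmN opprB.
- by rewrite -[RHS]ni scalerDr scalerA ii scaleN1r -[RHS]nrmN opprB scaleNr.
- by rewrite -[RHS]ni scalerBr scalerA ii scaleN1r opprK addrC.
Qed.
End Trace.

Section States.
Variables (R : realType) (H : hilbertType R) (I : countType) (e : I -> H).
Hypothesis onbe : onb e.
Local Notation E := (onenum e).
Let oneE : onseq E := onseq_onenum onbe.

Lemma state_vectors (s : bop H) : state e s -> exists w : nat -> H,
  [/\ (\sum_(0 <= n <oo) (nrm (w n) ^+ 2)%:E = 1)%E,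
      forall A : bop H, (\sum_(0 <= n < N) inner (A (w n)) (w n) : R[i]^o) @[N --> \oo]
        --> (optrace e (s \oc A) : R[i]^o) &
      full_rank s -> forall A : bop H, positive A ->
        (forall n, inner (A (w n)) (w n) = 0) -> A = 0].
Proof.
move=> [ps hs]; have [pT TT] := opsqrtP ps; set T := opsqrt s in pT TT.
have sT := positive_sa pT.
have hT : \sum_(0 <= n < N) nrm (T (E n)) ^+ 2 @[N --> \oo] --> (1 : R).
  have /cvg_complex[/= h _] := has_sum_series hs.
  apply: cvg_trans h; apply: near_eq_cvg; apply: nearW => N.
  rewrite cRe_sum; apply: eq_bigr => n _.
  rewrite (_ : zeropad _ = fun n => inner (s (E n)) (E n)).
    by rewrite -TT bop_compE sT nrm2E.
  exact: (zeropad_inner e (f := fun x => inner (s x) x) (inner0r _)).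
exists (fun n => T (E n)); split.
- by apply/cvg_nneseries => // n; exact: sqr_ge0.
- move=> A; have [L hL hL'] := trace_has_sum onbe A sT hT.
  have -> : optrace e (s \oc A) = L by apply: has_sum_uniq; rewrite -TT; exact: hL.
  exact: hL'.
- move=> fs A pA hA.
  have AT : A \oc T = 0.
    apply: (bop_inner_ext oneE) => m n.
    by rewrite bop_compE (positive_eq0 pA (hA n)) bop0E.
  have As u : A (s u) = 0.
    rewrite -TT bop_compE -[A _]/((A \oc T) (T u)) AT; exact: bop0E.
  apply: bop_ext => u; rewrite bop0E; apply: fs; apply: inner_eq0r => v.
  by rewrite (positive_sa ps) (positive_sa pA) As inner0r.
Qed.

Definition rank1_fun (v : H) (u : H) : H := inner u v *: v.

Lemma blin_rank1 v : blin (rank1_fun v) (nrm v ^+ 2).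
Proof.
split => [a x y||u]; last 2 first.
- exact: sqr_ge0.
- rewrite nrmZ (le_trans (ler_wpM2r _ (cauchy_schwarz _ _))) //.
  by rewrite expr2 mulrC mulrA mulrAC.
by rewrite /rank1_fun inner_linearl scalerDl scalerA.
Qed.

Lemma rank1_state (v : H) : nrm v = 1 ->
  exists2 s : bop H, state e s & forall A : bop H, optrace e (s \oc A) = inner (A v) v.
Proof.
move=> v1; have [s sE] := bop_exists (blin_rank1 v).
have ss : sa s by move=> x y; rewrite !sE innerZl innerZr -innerC mulrC.
have s2 : s \oc s = s.
  apply: bop_ext => u; rewrite bop_compE !sE /rank1_fun innerZl inner_nrm2 v1.
  by rewrite expr1n mulr1.
have nE n : nrm (s (E n)) ^+ 2 = normc (inner v (E n)) ^+ 2.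
  by rewrite sE nrmZ v1 mulr1 innerC normc_conj.
have hT : \sum_(0 <= n < N) nrm (s (E n)) ^+ 2 @[N --> \oo] --> (1 : R).
  under eq_fun do under eq_bigr do rewrite nE.
  by have := @parseval_nrm _ _ _ oneE v; rewrite v1 expr1n.
have tr A : has_sum (diag_terms e (s \oc A)) (inner (A v) v).
  have [L hL hL'] := trace_has_sum onbe A ss hT; rewrite s2 in hL.
  suff -> : inner (A v) v = L by [].
  have h : (inner (A v) v * (\sum_(0 <= n < N) normc (inner v (E n)) ^+ 2)%:C : R[i]^o)
      @[N --> \oo] --> (inner (A v) v * 1 : R[i]^o).
    apply: ccvgM; apply/cvg_complex; split; last exact: cvg_cst.
    by have := @parseval_nrm _ _ _ oneE v; rewrite v1 expr1n.
  rewrite mulr1 in h.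
  apply: (ccvg_unique h hL') => N; rewrite rmorph_sum mulr_sumr; apply: eq_bigr => n _.
  rewrite !sE /rank1_fun (linZ (bop_lin A)) innerZl innerZr mulrA mulrC; congr (_ * _).
  by rewrite mul_conj innerC normc_conj.
exists s; last by move=> A; exact: has_sum_uniq.
split; first by rewrite -s2; exact: positive_sqr.
by have := tr (bop1 H); rewrite bop_comp1 bop1E inner_nrm2 v1 expr1n.
Qed.

End States.

(** * Tensor products *)

Section TensorProduct.
Variables (R : realType) (H K : hilbertType R) (t : H -> H -> K).
Hypothesis tt : is_tensor t.

Lemma is_tensor_flip : is_tensor (fun u v => t v u).
Proof.
have [tl tr ti td] := tt; split => //.
  by move=> u v u' v'; rewrite ti mulrC.
move=> O O0 oO; have [z [Oz zE]] := td O O0 oO.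
exists z; split => //; apply: lin_span_sub zE => _ [u [v ->]].
by exists v, u.
Qed.

Lemma nrm_tensor u v : nrm (t u v) = nrm u * nrm v.
Proof.
have [_ _ ti _] := tt.
apply/eqP; rewrite -(eqrXn2 (n := 2)) ?mulr_ge0 // exprMn !nrm2E ti !inner_nrm2.
by rewrite -rmorphM.
Qed.

Lemma blin_tensorr u : blin (t u) (nrm u).
Proof. by have [_ tr _ _] := tt; split => // v; rewrite nrm_tensor. Qed.

Definition elementary : set K := [set z | exists u v, z = t u v].

Lemma elementary_dense : dense (lin_span elementary).
Proof. by have [_ _ _ td] := tt. Qed.

Lemma elementary_inner_inj x y :
  (forall u v, inner x (t u v) = inner y (t u v)) -> x = y.
Proof.
move=> h; apply/eqP; rewrite -subr_eq0; apply/eqP/nrm_eq0.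
set d := x - y; apply/eqP; rewrite eq_le nrm_ge0 andbT leNgt; apply/negP => d0.
have [_ [n [c [w [Sw ->]]]]] := dense_nrm elementary_dense d d0.
set z := \sum_(k < n) _ => dz.
have dz0 : inner d z = 0.
  rewrite inner_sumr big1 // => k _; rewrite innerZr.
  by have [u [v ->]] := Sw k; rewrite innerBl h subrr mulr0.
have : nrm d ^+ 2 <= nrm (d - z) ^+ 2.
  by rewrite nrm2D innerNr dz0 oppr0 mulr0 addr0 lerDl sqr_ge0.
by rewrite ler_pXn2r ?nnegrE // leNgt dz.
Qed.

Variable e : nat -> H.
Hypothesis one : onseq e.

Lemma nrm2_tensor_sum (x : nat -> H) m k :
  nrm (\sum_(m <= j < m + k) t (x j) (e j)) ^+ 2 =
  \sum_(m <= j < m + k) nrm (x j) ^+ 2 * nrm (e j) ^+ 2.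
Proof.
have [eo _ _] := one; have [_ _ ti _] := tt.
elim: k => [|k IH]; first by rewrite addn0 !big_geq // nrm0 expr0n.
rewrite addnS !big_nat_recr ?leq_addr //= nrm2D IH nrm_tensor exprMn.
rewrite [X in complex.Re X](_ : _ = 0) ?mulr0 ?addr0 //.
rewrite inner_suml big_nat big1 // => i /andP[_ ik].
by rewrite ti eo ?mulr0 // ltn_eqF.
Qed.

Lemma onseq_nrm_le1 n : nrm (e n) <= 1.
Proof. by have [_ en _] := one; case: (en n) => ->; rewrite ?nrm0. Qed.

(* [V j] is the adjoint of the isometry [u |-> u (x) e j]. *)
Definition slices (V : nat -> K -> H) : Prop :=
  forall j, blin (V j) 1 /\ forall z u, inner (V j z) u = inner z (t u (e j)).

Lemma slices_exist : exists V, slices V.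
Proof.
have [tl tr ti td] := tt.
suff /choice[V hV] : forall j, exists V : K -> H,
    blin V 1 /\ forall z u, inner (V z) u = inner z (t u (e j)) by exists V.
move=> j.
have [||a u v w|u v|V bV hV] := form_op (B := fun z u => inner z (t u (e j))) (M := 1) one.
- by [].
- by move=> a u v w; exact: inner_linearl.
- by rewrite tl innerDr innerZr.
- apply: (le_trans (cauchy_schwarz _ _)); rewrite mul1r ler_wpM2l // nrm_tensor.
  by rewrite ler_piMr // onseq_nrm_le1.
by exists V.
Qed.

Variable V : nat -> K -> H.
Hypothesis hV : slices V.

Lemma slice_inner j z u : inner (V j z) u = inner z (t u (e j)).
Proof. by have [_ ->] := hV j. Qed.

Lemma slice_innerr j z u : inner (t u (e j)) z = inner u (V j z).
Proof. by rewrite innerC -slice_inner -innerC. Qed.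

Lemma slice_tensor j u v : V j (t u v) = inner v (e j) *: u.
Proof.
have [_ _ ti _] := tt.
by apply: inner_inj => x; rewrite slice_inner ti innerZl mulrC.
Qed.

Lemma slice_e0 j z : e j = 0 -> V j z = 0.
Proof.
move=> ej; apply: inner_eq0r => u; rewrite slice_inner ej.
by have [lt _ _] := blin_tensorr u; rewrite (lin0 lt) inner0r.
Qed.

Lemma slice_nrm_mul (A : bop H) j z : nrm (A (V j z)) ^+ 2 * nrm (e j) ^+ 2 = nrm (A (V j z)) ^+ 2.
Proof.
have [_ en _] := one; case: (en j) => [->|h]; first by rewrite expr1n mulr1.
by rewrite slice_e0 // (lin0 (bop_lin A)) nrm0 expr0n mul0r.
Qed.

Lemma slice_bessel N z : \sum_(0 <= j < N) nrm (V j z) ^+ 2 <= nrm z ^+ 2.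
Proof.
set p := \sum_(0 <= j < N) t (V j z) (e j).
set s := \sum_(0 <= j < N) _.
have ps : nrm p ^+ 2 = s.
  have := nrm2_tensor_sum (fun j => V j z) 0 N; rewrite add0n -/p => ->.
  by apply: eq_bigr => j _; exact: (slice_nrm_mul (bop1 H)).
have zp : complex.Re (inner z p) = s.
  rewrite inner_sumr cRe_sum; apply: eq_bigr => j _.
  by rewrite -slice_inner nrm2E.
have := sqr_ge0 (nrm (z - p)); rewrite nrm2D innerNr cReN zp nrmN ps; lra.
Qed.

Lemma slice_cvg z : cvgn (fun N => \sum_(0 <= j < N) nrm (V j z) ^+ 2).
Proof.
apply: nondecreasing_is_cvgn.
  by apply/nondecreasing_seqP => n; rewrite big_nat_recr //= lerDl sqr_ge0.
by exists (nrm z ^+ 2) => _ [N _ <-]; exact: slice_bessel.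
Qed.

Lemma tensor_left (A : bop H) : exists C : bop K,
  (forall u v, C (t u v) = t (A u) v) /\
  (forall z z', (\sum_(0 <= j < N) inner (A (V j z)) (V j z') : R[i]^o) @[N --> \oo]
     --> (inner (C z) z' : R[i]^o)).
Proof.
have [tl tr ti td] := tt.
pose C N z := \sum_(0 <= j < N) t (A (V j z)) (e j).
have nC m k z : nrm (\sum_(m <= j < m + k) t (A (V j z)) (e j)) ^+ 2 <=
    opn A ^+ 2 * \sum_(m <= j < m + k) nrm (V j z) ^+ 2.
  rewrite nrm2_tensor_sum mulr_sumr; apply: ler_sum => j _.
  by rewrite slice_nrm_mul -exprMn ler_pXn2r ?nnegrE ?mulr_ge0 ?opn_ge0 // nrm_bop.
have cC z : cvgn (C ^~ z).
  apply: (cvg_increments (p := 1) (S := fun N => opn A ^+ 2 * \sum_(0 <= j < N) nrm (V j z) ^+ 2)).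
    by apply: is_cvgMr; exact: slice_cvg.
  move=> n m nm; rewrite -mulrBr.
  have -> : C m z - C n z = \sum_(n <= j < m) t (A (V j z)) (e j).
    by rewrite /C (@big_cat_nat _ _ _ n 0 m) //= addrAC subrr add0r.
  rewrite [X in _ * (X - _)](@big_cat_nat _ _ _ n 0 m) //= addrAC subrr add0r.
  by rewrite -(subnKC nm); exact: nC.
pose L z := limn (C ^~ z).
have bC N z : nrm (C N z) <= opn A * nrm z.
  rewrite -(ler_pXn2r (n := 2)) ?nnegrE ?mulr_ge0 ?opn_ge0 //.
  have := nC 0 N z; rewrite add0n => /le_trans; apply.
  by rewrite exprMn ler_wpM2l ?sqr_ge0 // slice_bessel.
have lC N : linear (C N).
  move=> a x y; rewrite /C scaler_sumr -big_split; apply: eq_bigr => j _ /=.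
  by have [[lV _ _] _] := hV j; rewrite lV bop_lin tl.
have bL : blin L (opn A).
  split => [a x y||z]; last 2 first.
  - exact: opn_ge0.
  - exact: (cvg_nrm_le (cC z)).
  apply/cvg_lim => //.
  have h : a *: C N x + C N y @[N --> \oo] --> a *: L x + L y.
    by apply: cvgD; [apply: cvgZl_tmp|]; exact: cC.
  by apply: cvg_trans h; apply: near_eq_cvg; apply: nearW => N; rewrite lC.
have [C' hC'] := bop_exists bL; exists C'; split => [u v|z z'].
  rewrite hC'; apply/cvg_lim => //.
  have h : t (A u) (onproj e N v) @[N --> \oo] --> t (A u) v.
    by apply: (cvg_blin (blin_tensorr _)); exact: cvg_onproj.
  apply: cvg_trans h; apply: near_eq_cvg; apply: nearW => N.
  rewrite /C /onproj (lin_sum (tr _)); apply: eq_bigr => j _.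
  by rewrite slice_tensor (linZ (bop_lin A)) (linZ (tl _)) (linZ (tr _)).
rewrite hC'; have h := cvg_inner (FF := eventually_filter) (w := z') (cC z).
apply: cvg_trans h; apply: near_eq_cvg; apply: nearW => N.
by rewrite inner_suml; apply: eq_bigr => j _; rewrite slice_innerr.
Qed.

End TensorProduct.

Section OperatorTensor.
Variables (R : realType) (H K : hilbertType R) (t : H -> H -> K).
Hypothesis tt : is_tensor t.
Variable e : nat -> H.
Hypothesis one : onseq e.
Implicit Types A B : bop H.

Lemma elementary_bop_ext (C D : bop K) :
  (forall u v, C (t u v) = D (t u v)) -> C = D.
Proof.
move=> h; apply: bop_ext.
apply: (dense_eq (elementary_dense tt) (bop_blin_opn C) (bop_blin_opn D)).
by move=> _ [u [v ->]].
Qed.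

Lemma op_tensorE A B u v : op_tensor t A B (t u v) = t (A u) (B v).
Proof.
have [V hV] := slices_exist tt one.
have [V' hV'] := slices_exist (is_tensor_flip tt) one.
have [C [hC _]] := tensor_left tt one hV A.
have [D [hD _]] := tensor_left (is_tensor_flip tt) one hV' B.
have : exists C : bop K, forall u v, C (t u v) = t (A u) (B v).
  by exists (C \oc D) => x y; rewrite bop_compE hD hC.
by move=> /(xgetPex 0) /(_ u v).
Qed.

Lemma op_tensor_eq A B (C : bop K) :
  (forall u v, C (t u v) = t (A u) (B v)) -> op_tensor t A B = C.
Proof. by move=> h; apply: elementary_bop_ext => u v; rewrite op_tensorE h. Qed.

Lemma op_tensor_comp A B A' B' :
  op_tensor t A B \oc op_tensor t A' B' = op_tensor t (A \oc A') (B \oc B').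
Proof. by apply/esym/op_tensor_eq => u v; rewrite bop_compE !op_tensorE. Qed.

Lemma op_tensorDl A A' B : op_tensor t (A + A') B = op_tensor t A B + op_tensor t A' B.
Proof.
have [tl tr _ _] := tt; apply: op_tensor_eq => u v.
by rewrite bopDE !op_tensorE bopDE (linD (tl _)).
Qed.
Lemma op_tensorDr A B B' : op_tensor t A (B + B') = op_tensor t A B + op_tensor t A B'.
Proof.
have [tl tr _ _] := tt; apply: op_tensor_eq => u v.
by rewrite bopDE !op_tensorE bopDE (linD (tr _)).
Qed.
Lemma op_tensorZl a A B : op_tensor t (a *: A) B = a *: op_tensor t A B.
Proof.
have [tl tr _ _] := tt; apply: op_tensor_eq => u v.
by rewrite bopZE !op_tensorE bopZE (linZ (tl _)).
Qed.
Lemma op_tensorZr a A B : op_tensor t A (a *: B) = a *: op_tensor t A B.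
Proof.
have [tl tr _ _] := tt; apply: op_tensor_eq => u v.
by rewrite bopZE !op_tensorE bopZE (linZ (tr _)).
Qed.
Lemma op_tensorNl A B : op_tensor t (- A) B = - op_tensor t A B.
Proof. by rewrite -scaleN1r op_tensorZl scaleN1r. Qed.
Lemma op_tensorNr A B : op_tensor t A (- B) = - op_tensor t A B.
Proof. by rewrite -scaleN1r op_tensorZr scaleN1r. Qed.
Lemma op_tensor1 : op_tensor t (bop1 H) (bop1 H) = bop1 K.
Proof. exact: op_tensor_eq. Qed.

Lemma op_tensor_flip A B : op_tensor t A B = op_tensor (fun u v => t v u) B A.
Proof.
apply: op_tensor_eq => u v; rewrite /op_tensor.
have [V hV] := slices_exist tt one.
have : exists C : bop K, forall u v, C (t v u) = t (A v) (B u).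
  by exists (op_tensor t A B) => x y; rewrite op_tensorE.
by move=> /(xgetPex 0) /(_ v u).
Qed.

Section Slices.
Variable V : nat -> K -> H.
Hypothesis hV : slices t e V.

Lemma op_tensor1_slices A z z' :
  (\sum_(0 <= j < N) inner (A (V j z)) (V j z') : R[i]^o) @[N --> \oo]
     --> (inner (op_tensor t A (bop1 H) z) z' : R[i]^o).
Proof.
have [C [hC h]] := tensor_left tt one hV A.
by rewrite (op_tensor_eq (C := C)).
Qed.

Lemma slice_parseval z z' :
  (\sum_(0 <= j < N) inner (V j z) (V j z') : R[i]^o) @[N --> \oo] --> (inner z z' : R[i]^o).
Proof. by have := @op_tensor1_slices (bop1 H) z z'; rewrite op_tensor1. Qed.

Lemma slice_parseval_nrm z :
  \sum_(0 <= j < N) nrm (V j z) ^+ 2 @[N --> \oo] --> nrm z ^+ 2.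
Proof.
have /cvg_complex[+ _] := @slice_parseval z z; rewrite -nrm2E.
apply: cvg_trans; apply: near_eq_cvg; apply: nearW => N.
by rewrite cRe_sum; apply: eq_bigr => j _; rewrite nrm2E.
Qed.
End Slices.

Variable b : nat -> K.
Hypothesis onk : onseq b.

Lemma op_tensor_adj A B A' B' :
  (forall u v, inner (A u) v = inner u (A' v)) ->
  (forall u v, inner (B u) v = inner u (B' v)) ->
  forall z z', inner (op_tensor t A B z) z' = inner z (op_tensor t A' B' z').
Proof.
move=> hA hB z z'; have [_ _ ti _] := tt.
rewrite (adjointP onk); congr inner; congr (bop_fun _ z'); apply/esym.
apply: op_tensor_eq => u v; apply: (elementary_inner_inj tt) => u' v'.
rewrite -(adjointPr onk) op_tensorE !ti (innerC u) hA -innerC.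
by rewrite (innerC v) hB -innerC.
Qed.

Lemma op_tensor_sa A B : sa A -> sa B -> sa (op_tensor t A B).
Proof. exact: op_tensor_adj. Qed.

Lemma op_tensor_sqr A B : positive A -> positive B ->
  op_tensor t (opsqrt A) (opsqrt B) \oc op_tensor t (opsqrt A) (opsqrt B) = op_tensor t A B.
Proof.
by move=> pA pB; have [_ hA] := opsqrtP pA; have [_ hB] := opsqrtP pB;
  rewrite op_tensor_comp hA hB.
Qed.

Lemma op_tensor_positive A B : positive A -> positive B -> positive (op_tensor t A B).
Proof.
move=> pA pB; rewrite -op_tensor_sqr //; apply: positive_sqr.
by apply: op_tensor_sa; apply: positive_sa; exact: opsqrt_positive.
Qed.

End OperatorTensor.

(** * Measurability *)

Section WeakMeasurability.
Context (d : measure_display) (T : measurableType d) (R : realType).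

Definition cmeas (F : T -> R[i]) : Prop :=
  measurable_fun setT (fun x => complex.Re (F x)) /\
  measurable_fun setT (fun x => complex.Im (F x)).

Lemma eq_cmeas F G : F =1 G -> cmeas F -> cmeas G.
Proof. by move=> /funext ->. Qed.

Lemma cmeas_cst (c : R[i]) : cmeas (fun=> c).
Proof. by split; exact: measurable_cst. Qed.

Lemma cmeasD F G : cmeas F -> cmeas G -> cmeas (fun x => F x + G x).
Proof.
move=> [f1 f2] [g1 g2]; split.
  by under eq_fun do rewrite cReD; exact: measurable_funD.
by under eq_fun do rewrite cImD; exact: measurable_funD.
Qed.

Lemma cmeasM F G : cmeas F -> cmeas G -> cmeas (fun x => F x * G x).
Proof.
move=> [f1 f2] [g1 g2]; split.
  by under eq_fun do rewrite cReM; apply: measurable_funB; exact: measurable_funM.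
by under eq_fun do rewrite cImM; apply: measurable_funD; exact: measurable_funM.
Qed.

Lemma cmeasZ (c : R[i]) F : cmeas F -> cmeas (fun x => c * F x).
Proof. by apply: cmeasM; exact: cmeas_cst. Qed.

Lemma cmeasN F : cmeas F -> cmeas (fun x => - F x).
Proof.
by move=> /(cmeasZ (-1)); apply: eq_cmeas => x; rewrite mulN1r.
Qed.

Lemma cmeasB F G : cmeas F -> cmeas G -> cmeas (fun x => F x - G x).
Proof. by move=> hF hG; apply: cmeasD => //; exact: cmeasN. Qed.

Lemma cmeasJ F : cmeas F -> cmeas (fun x => conjc (F x)).
Proof.
move=> [f1 f2]; split; first by under eq_fun do rewrite cReJ.
by under eq_fun do rewrite cImJ; exact: measurable_funN.
Qed.

Lemma cmeas_sum (J : Type) (r : seq J) (F : J -> T -> R[i]) :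
  (forall j, cmeas (F j)) -> cmeas (fun x => \sum_(j <- r) F j x).
Proof.
move=> h; elim: r => [|j r IH].
  by apply: eq_cmeas (cmeas_cst 0) => x; rewrite big_nil.
by apply: eq_cmeas (cmeasD (h j) IH) => x; rewrite big_cons.
Qed.

Lemma cmeas_cvg (F : nat -> T -> R[i]) (G : T -> R[i]) :
  (forall n, cmeas (F n)) ->
  (forall x, (F n x : R[i]^o) @[n --> \oo] --> (G x : R[i]^o)) -> cmeas G.
Proof.
move=> mF FG; split.
  apply: (@measurable_fun_cvg _ _ _ _ (fun n x => complex.Re (F n x))).
    by move=> n; have [] := mF n.
  by move=> x _; have /cvg_complex[] := FG x.
apply: (@measurable_fun_cvg _ _ _ _ (fun n x => complex.Im (F n x))).
  by move=> n; have [] := mF n.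
by move=> x _; have /cvg_complex[] := FG x.
Qed.

Definition wmeas (H : hilbertType R) (f : T -> bop H) : Prop :=
  forall u v, cmeas (fun x => inner (f x u) v).

Section OneSpace.
Variable H : hilbertType R.
Implicit Types f g : T -> bop H.

Lemma eq_wmeas f g : f =1 g -> wmeas f -> wmeas g.
Proof. by move=> /funext ->. Qed.

Lemma wmeas_cst (A : bop H) : wmeas (fun=> A).
Proof. by move=> u v; exact: cmeas_cst. Qed.

Lemma wmeasD f g : wmeas f -> wmeas g -> wmeas (fun x => f x + g x).
Proof.
move=> mf mg u v; apply: eq_cmeas (cmeasD (mf u v) (mg u v)) => x.
by rewrite bopDE innerDl.
Qed.

Lemma wmeasZ (c : T -> R[i]) f : cmeas c -> wmeas f -> wmeas (fun x => c x *: f x).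
Proof.
move=> mc mf u v; apply: eq_cmeas (cmeasM mc (mf u v)) => x.
by rewrite bopZE innerZl.
Qed.

Lemma wmeasZc (c : R[i]) f : wmeas f -> wmeas (fun x => c *: f x).
Proof. by apply: wmeasZ; exact: cmeas_cst. Qed.

Lemma wmeasB f g : wmeas f -> wmeas g -> wmeas (fun x => f x - g x).
Proof.
move=> mf mg; apply: eq_wmeas (wmeasD mf (wmeasZc (-1) mg)) => x.
by rewrite scaleN1r.
Qed.

Lemma wmeas_cvg (f : nat -> T -> bop H) g : (forall n, wmeas (f n)) ->
  (forall x u, f n x u @[n --> \oo] --> g x u) -> wmeas g.
Proof.
move=> mf fg u v; apply: (cmeas_cvg (fun n => mf n u v)) => x.
by apply: cvg_inner; exact: fg.
Qed.

Lemma wmeas_polar f : (forall v, nrm v = 1 -> cmeas (fun x => inner (f x v) v)) -> wmeas f.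
Proof.
move=> h.
have {}h v : cmeas (fun x => inner (f x v) v).
  have [->|v0] := eqVneq v 0.
    by apply: eq_cmeas (cmeas_cst 0) => x; rewrite inner0r.
  have nv : nrm v != 0 by apply: contraNneq v0 => /nrm_eq0 ->.
  have n1 : nrm ((nrm v)^-1%:C *: v) = 1.
    by rewrite nrmZ normc_real ger0_norm ?invr_ge0 // mulVf.
  apply: eq_cmeas (cmeasZ ((nrm v) ^+ 2)%:C (h _ n1)) => x.
  rewrite (linZ (bop_lin _)) innerZl innerZr conjc_real !mulrA -!rmorphM.
  by rewrite (_ : _ * _ * _ = 1) ?mul1r //; field.
move=> u v.
have m := cmeasB (cmeasD (cmeasB (h (u + v)) (h (u - v)))
  (cmeasZ 'i%C (h (u + 'i%C *: v)))) (cmeasZ 'i%C (h (u - 'i%C *: v))).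
apply: eq_cmeas (cmeasZ 4^-1 m) => x.
by rewrite -bop_polarization mulrA mulVf ?mul1r // pnatr_eq0.
Qed.

Variable e : nat -> H.
Hypothesis one : onseq e.

Lemma wmeas_adjoint f : wmeas f -> wmeas (fun x => adjoint (f x)).
Proof.
move=> mf u v; apply: eq_cmeas (cmeasJ (mf v u)) => x.
by rewrite (adjointP one) -innerC.
Qed.

Lemma wmeas_comp f g : wmeas f -> wmeas g -> wmeas (fun x => f x \oc g x).
Proof.
move=> mf mg u v.
apply: (@cmeas_cvg (fun N x => \sum_(0 <= n < N) inner (g x u) (e n) * inner (f x (e n)) v)).
  by move=> N; apply: cmeas_sum => n; apply: cmeasM.
move=> x; rewrite bop_compE (adjointP one (f x)).
by under eq_fun do under eq_bigr do rewrite (adjointP one (f x)); exact: parseval.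
Qed.

Lemma wmeas_sqrt_iter f n : wmeas f -> wmeas (fun x => sqrt_iter (f x) n).
Proof.
move=> mf; elim: n => [|n IH]; first exact: wmeas_cst.
by apply: wmeasZc; apply: wmeasD => //; exact: wmeas_comp.
Qed.

Lemma wmeas_opsqrt f (M : R) : 0 < M -> (forall x, positive (f x)) ->
  (forall x u, nrm (f x u) <= M * nrm u) -> wmeas f -> wmeas (fun x => opsqrt (f x)).
Proof.
move=> M0 pf bf mf.
apply: (@wmeas_cvg (fun n x => (Num.sqrt M)%:C *: (bop1 H - sqrt_iter (sqrt_scale M (f x)) n))).
  move=> n; apply: wmeasZc; apply: wmeasB; first exact: wmeas_cst.
  by apply: wmeas_sqrt_iter; apply: wmeasB; [exact: wmeas_cst|exact: wmeasZc].
by move=> x u; apply: opsqrt_cvg.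
Qed.

Lemma separable_seq : separable H -> exists D : nat -> H,
  forall z (r : R), 0 < r -> exists n, nrm (z - D n) < r.
Proof.
move=> [A [cA dA]].
have [z0 Az0 _] := dense_nrm dA 0 ltr01.
have /pfcard_geP[A0|[D]] := cA.
  by rewrite A0 in Az0.
exists D => z r r0; have [y Ay zy] := dense_nrm dA z r0.
by have [n _ Dn] := 'surj_D Ay; exists n; rewrite Dn.
Qed.

Section Separable.
Variable D : nat -> H.
Hypothesis hD : forall z (r : R), 0 < r -> exists n, nrm (z - D n) < r.

Lemma separable_opnorm (A : bop H) (r : R) : 0 <= r ->
  (forall n, nrm (A (D n)) <= r * nrm (D n)) -> forall u, nrm (A u) <= r * nrm u.
Proof.
move=> r0 h u; apply/ler_addgt0Pr => p p0.
have k0 : 0 < opn A + r + 1 by have := opn_ge0 A; lra.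
have [n hn] := hD u (divr_gt0 p0 k0).
rewrite ltr_pdivlMr // in hn.
have h1 : nrm (A u) <= nrm (A (u - D n)) + nrm (A (D n)).
  by have := nrmD (A (u - D n)) (A (D n)); rewrite -(linD (bop_lin A)) subrK.
have h2 : nrm (D n) <= nrm (u - D n) + nrm u.
  by have := nrmD (- (u - D n)) u; rewrite nrmN opprB subrK.
have := h n; have := nrm_bop A (u - D n); have := nrm_ge0 (u - D n).
nra.
Qed.

Lemma separable_positive (A : bop H) : (forall n, 0 <= inner (A (D n)) (D n)) -> positive A.
Proof.
move=> h u.
have [w hw] : exists w : nat -> nat, forall k, nrm (u - D (w k)) < k.+1%:R^-1.
  have /choice[w hw] : forall k : nat, exists n, nrm (u - D n) < k.+1%:R^-1.
    by move=> k; apply: hD; rewrite invr_gt0.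
  by exists w.
have cw : D (w k) @[k --> \oo] --> u.
  apply/cvg_nrm; apply: (squeeze_cvgr _ (cvg_cst (0:R)) (@cvg_harmonic R)).
  by apply: nearW => k; rewrite nrm_ge0 -nrmN opprB ltW //; exact: hw.
have cA : (inner (A (D (w k))) (D (w k)) : R[i]^o) @[k --> \oo] --> (inner (A u) u : R[i]^o).
  apply/cvg_normc.
  have h0 : opn A * (2 * nrm u + 1) * nrm (D (w k) - u) @[k --> \oo] --> (0 : R).
    by rewrite -(mulr0 (opn A * (2 * nrm u + 1))); apply: cvgMr; apply/cvg_nrm.
  apply: (squeeze_cvgr _ (cvg_cst (0:R)) h0); apply: nearW => k; rewrite normc_ge0 /=.
  set y := D (w k).
  have y1 : nrm (y - u) <= 1.
    rewrite -nrmN opprB ltW // (lt_le_trans (hw k)) //.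
    by rewrite invf_le1 ?ler1n // ltr0n.
  have yu : nrm y <= nrm u + 1.
    by rewrite -(subrK u y) addrC (le_trans (nrmD _ _)) // lerD2l.
  have -> : inner (A y) y - inner (A u) u = inner (A (y - u)) y + inner (A u) (y - u).
    by rewrite (linB (bop_lin A)) innerBl innerBr addrA subrK.
  apply: (le_trans (le_normcD _ _)).
  apply: (le_trans (lerD (cauchy_schwarz _ _) (cauchy_schwarz _ _))).
  have := nrm_bop A (y - u); have := nrm_bop A u.
  have := nrm_ge0 u; have := nrm_ge0 y; have := nrm_ge0 (y - u); have := opn_ge0 A.
  set a := opn A; set p := nrm (y - u); set q := nrm (A _); set r := nrm (A _).
  set nu := nrm u; set ny := nrm y => a0 p0 y0 u0 hq hr.
  have : r * ny <= a * p * (nu + 1) by rewrite ler_pM // nrm_ge0.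
  have : q * p <= a * nu * p by rewrite ler_wpM2r.
  lra.
have /cvg_complex[cr ci] := cA.
rewrite le0cE; apply/andP; split.
  have c0 : (fun k => complex.Im (inner (A (D (w k))) (D (w k)))) = fun=> 0.
    by apply/funext => k; exact: ger0_Im.
  by rewrite c0 in ci; rewrite (cvg_unique _ ci (cvg_cst _)).
apply: (cvgr_to_ge cr); apply: nearW => k.
by have := h (w k); rewrite le0cE => /andP[].
Qed.
End Separable.
End OneSpace.
End WeakMeasurability.

Section WeakMeasurabilityOperations.
Context (d : measure_display) (T : measurableType d) (R : realType).

Lemma measurable_opn (H : hilbertType R) (e : nat -> H) (f : T -> bop H) :
  onseq e -> separable H -> wmeas f -> measurable_fun setT (fun x => opn (f x)).
Proof.
move=> one /separable_seq[D hD] mf mT.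
apply: (measurability _ (RGenOInfty.measurableE R)) => //.
move=> /= _ [_ [a ->] <-]; rewrite setTI.
have [a0|a0] := ltrP a 0.
  rewrite (_ : _ @^-1` _ = setT) //; apply/seteqP; split => // x _ /=.
  by rewrite in_itv /= andbT (lt_le_trans a0) // opn_ge0.
rewrite (_ : _ @^-1` _ = ~` \bigcap_n [set x |
    complex.Re (inner ((adjoint (f x) \oc f x) (D n)) (D n)) <= (a * nrm (D n)) ^+ 2]).
  apply: measurableC; apply: bigcapT_measurable => n.
  have [m _] := wmeas_comp one (wmeas_adjoint one mf) mf (D n) (D n).
  have := m measurableT _ (measurable_itv `]-oo, ((a * nrm (D n)) ^+ 2)]).
  by rewrite setTI; congr measurable; apply/seteqP; split => x /=; rewrite in_itv.
have hE x n : complex.Re (inner ((adjoint (f x) \oc f x) (D n)) (D n)) = nrm (f x (D n)) ^+ 2.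
  by rewrite bop_compE -(adjointPr one) nrm2E.
apply/seteqP; split => x /=; rewrite in_itv /= andbT.
  move=> ax h; have : opn (f x) <= a.
    rewrite -lee_fin -opnE; apply: opnorm_le => //.
    apply: (separable_opnorm hD a0) => n; have := h n I; rewrite /= hE.
    by rewrite ler_pXn2r // ?nnegrE ?mulr_ge0.
  by rewrite leNgt ax.
move=> h; rewrite ltNge; apply/negP => xa; apply: h => n _ /=; rewrite hE.
rewrite ler_pXn2r // ?nnegrE ?mulr_ge0 //.
by apply: (le_trans (nrm_bop _ _)); rewrite ler_wpM2r.
Qed.

Section TensorMeas.
Variables (H K : hilbertType R) (t : H -> H -> K).
Hypothesis tt : is_tensor t.
Variables (e : nat -> H) (b : nat -> K).
Hypotheses (one : onseq e) (onk : onseq b).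

Lemma wmeas_op_tensorl (t' : H -> H -> K) (f : T -> bop H) : is_tensor t' -> wmeas f ->
  wmeas (fun x => op_tensor t' (f x) (bop1 H)).
Proof.
move=> tt' mf z z'; have [V hV] := slices_exist tt' one.
apply: (cmeas_cvg (F := fun N x => \sum_(0 <= j < N) inner (f x (V j z)) (V j z'))).
  by move=> N; apply: cmeas_sum => j; exact: mf.
by move=> x; apply: (op_tensor1_slices tt' one hV).
Qed.

Lemma wmeas_op_tensor (f g : T -> bop H) : wmeas f -> wmeas g ->
  wmeas (fun x => op_tensor t (f x) (g x)).
Proof.
move=> mf mg.
have m := wmeas_comp onk (wmeas_op_tensorl tt mf) (wmeas_op_tensorl (is_tensor_flip tt) mg).
apply: eq_wmeas m => x.
by rewrite -(op_tensor_flip tt one) (op_tensor_comp tt one) bop_comp1 bop_1comp.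
Qed.
End TensorMeas.
End WeakMeasurabilityOperations.

Section QuantumRandomVariable.
Variables (R : realType) (H : hilbertType R) (I : countType) (e : I -> H).
Hypothesis onbe : onb e.
Variable X : ptopologicalType.

Lemma qrvP (f : borel X -> bop H) : qrv e f <-> wmeas f.
Proof.
split=> [qf|mf].
  apply: wmeas_polar => v v1; have [s hs sE] := rank1_state onbe v1.
  have [m1 m2] := qf s hs; split.
    by under eq_fun do rewrite -sE.
  by under eq_fun do rewrite -sE.
move=> s hs; have [w [_ hw _]] := state_vectors onbe hs.
apply: (cmeas_cvg (F := fun N x => \sum_(0 <= n < N) inner (f x (w n)) (w n))).
  by move=> N; apply: cmeas_sum => n; exact: mf.
by move=> x; exact: hw.
Qed.

Lemma LHP (f : borel X -> bop H) : LH e f -> wmeas f.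
Proof.
move=> [n [c [w [hw ->]]]].
apply: (big_ind (fun f : borel X -> bop H => wmeas f)).
- exact: wmeas_cst.
- by move=> F G; exact: wmeasD.
- by move=> k _; apply: wmeasZc; apply/qrvP; have [] := hw k.
Qed.

Lemma LH_pos (f : borel X -> bop H) : wmeas f -> pos_fun f -> LH e f.
Proof.
move=> mf pf; exists 1, (fun=> 1), (fun=> f); split => [_|].
  by split => //; apply/qrvP.
by rewrite big_ord1 scale1r.
Qed.

End QuantumRandomVariable.

(** * Densities *)

Section NonmeasurableIntegrands.
Import HBNNSimple.
Context (d : measure_display) (T : measurableType d) (R : realType).

(* No measurability is assumed: [rn], a chosen version of the density, is not
   known to make the functions [twist] measurable. *)
Lemma ae_le_integral_nonmeasurable (mu : {measure set T -> \bar R}) (f g : T -> \bar R) :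
  (forall x, 0 <= f x)%E -> (forall x, 0 <= g x)%E ->
  {ae mu, forall x, (f x <= g x)%E} ->
  (\int[mu]_x f x <= \int[mu]_x g x)%E.
Proof.
move=> f0 g0 [N [mN muN0 hN]].
rewrite !ge0_integralTE //; apply: ge_ereal_sup => _ [h /= hf <-].
have mNC := measurableC mN.
pose h' := proj_nnsfun h mNC.
have h'E x : h' x = h x * \1_(~` N) x by [].
have -> : sintegral mu h = sintegral mu h'.
  rewrite -!integralT_nnsfun; apply: ge0_ae_eq_integral => //.
  - by apply/measurable_EFinP.
  - by apply/measurable_EFinP.
  - by move=> x _; rewrite lee_fin.
  - by move=> x _; rewrite lee_fin.
  - exists N; split => // x /= hx; apply: contrapT => Nx; apply: hx => _.
    transitivity ((h x * \1_(~` N) x)%:E); last by [].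
    by rewrite indicE mem_set // mulr1.
apply: ereal_sup_ubound; exists h' => // x.
change ((h x * \1_(~` N) x)%:E <= g x)%E; rewrite indicE.
have [Nx|Nx] := pselect (N x); first by rewrite memNset ?mulr0 //=; apply: contrapT.
rewrite mem_set // mulr1 (le_trans (hf x)) //.
by apply: contrapT => hx; apply: Nx; apply: hN.
Qed.

End NonmeasurableIntegrands.

Section SetFunctions.
Context (d : measure_display) (T : measurableType d) (R : realType).

Definition sigadd (m : set T -> R) : Prop :=
  forall F : nat -> set T, (forall n, measurable (F n)) -> trivIset setT F ->
  \sum_(0 <= k < n) m (F k) @[n --> \oo] --> m (\bigcup_n F n).

Lemma sigadd0 (m : set T -> R) : sigadd m -> m set0 = 0.
Proof.
move=> hm.
have tF : trivIset [set: nat] (fun=> set0 : set T) by move=> i j _ _ [x []].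
have := hm (fun=> set0) (fun=> measurable0) tF; rewrite bigcup0 // => h.
have h1 : \sum_(0 <= k < n.+1) m set0 @[n --> \oo] --> m set0.
  by rewrite (cvg_shiftS (fun n => \sum_(0 <= k < n) m set0)).
have h2 : \sum_(0 <= k < n.+1) m set0 @[n --> \oo] --> m set0 + m set0.
  under eq_fun do rewrite big_nat_recr //=.
  by apply: cvgD => //; exact: cvg_cst.
have E : m set0 = m set0 + m set0 by exact: (cvg_unique _ h1 h2).
lra.
Qed.

(* The absolute value only matters on nonmeasurable sets. *)
Definition mk_measure (m : set T -> R) (hm : sigadd m)
  (m0 : forall E, measurable E -> 0 <= m E) (E : set T) : \bar R := `|m E|%:E.

Section MkMeasure.
Variables (m : set T -> R) (hm : sigadd m) (m0 : forall E, measurable E -> 0 <= m E).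

Let mk0 : mk_measure hm m0 set0 = 0%E.
Proof. by rewrite /mk_measure sigadd0 // normr0. Qed.
Let mk_ge0 E : (0 <= mk_measure hm m0 E)%E.
Proof. by rewrite lee_fin. Qed.
Let mk_sigma : semi_sigma_additive (mk_measure hm m0).
Proof.
move=> F mF tF mUF; rewrite /mk_measure ger0_norm ?m0 //.
rewrite (_ : (fun _ => _) = EFin \o (fun n => \sum_(0 <= k < n) m (F k))); last first.
  by apply/funext => n /=; rewrite -sumEFin; apply: eq_bigr => k _; rewrite ger0_norm ?m0.
by apply: cvg_EFin; [exact: nearW|exact: hm].
Qed.
HB.instance Definition _ := isMeasure.Build _ _ _ (mk_measure hm m0) mk0 mk_ge0 mk_sigma.
Let mk_fin : fin_num_fun (mk_measure hm m0). Proof. by []. Qed.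
HB.instance Definition _ := Measure_isFinite.Build _ _ _ (mk_measure hm m0) mk_fin.

Lemma measure_ofE E : measurable E -> measure_of (fun E => (m E)%:E) E = (m E)%:E.
Proof.
move=> mE; rewrite /measure_of; case: pselect => [h|[]].
  by case: cid => /= mu ->.
by exists (mk_measure hm m0) => A mA; rewrite /= /mk_measure ger0_norm ?m0.
Qed.
End MkMeasure.

Definition mk_charge (m : set T -> R) (hm : sigadd m) (E : set T) : \bar R := (m E)%:E.

Section MkCharge.
Variables (m : set T -> R) (hm : sigadd m).
Let mk0 : mk_charge hm set0 = 0%E.
Proof. by rewrite /mk_charge sigadd0. Qed.
Let mk_fin E : measurable E -> mk_charge hm E \is a fin_num.
Proof. by []. Qed.
Let mk_sigma : semi_sigma_additive (mk_charge hm).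
Proof.
move=> F mF tF mUF; rewrite /mk_charge.
rewrite (_ : (fun _ => _) = EFin \o (fun n => \sum_(0 <= k < n) m (F k))); last first.
  by apply/funext => n /=; rewrite -sumEFin.
by apply: cvg_EFin; [exact: nearW|exact: hm].
Qed.
HB.instance Definition _ := isCharge.Build _ _ _ (mk_charge hm) mk0 mk_fin mk_sigma.

Lemma charge_ofE E : measurable E -> charge_of (fun E => (m E)%:E) E = (m E)%:E.
Proof.
move=> mE; rewrite /charge_of; case: pselect => [h|[]].
  by case: cid => /= mu ->.
by exists (mk_charge hm).
Qed.
End MkCharge.

Lemma sigadd_Rintegral (mu : {measure set T -> \bar R}) (phi : T -> R) :
  mu.-integrable setT (EFin \o phi) -> sigadd (fun E => \int[mu]_(x in E) phi x).
Proof.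
move=> iphi F mF tF.
have mU : measurable (\bigcup_n F n) by exact: bigcupT_measurable.
have fin E : measurable E -> induced_charge iphi E = (\int[mu]_(x in E) phi x)%:E.
  move=> mE; rewrite fineK // integrable_fin_num //.
  exact: (integrableS measurableT mE _ iphi).
have : (fun n => (\sum_(0 <= k < n) induced_charge iphi (F k))%E) @ \oo -->
    induced_charge iphi (\bigcup_n F n) by exact: (charge_semi_sigma_additive _ mF tF mU).
rewrite fin //.
rewrite (_ : (fun _ => _) = EFin \o (fun n => \sum_(0 <= k < n) \int[mu]_(x in F k) phi x)).
  by move=> /fine_cvg.
by apply/funext => n /=; rewrite -sumEFin; apply: eq_bigr => k _; rewrite fin.
Qed.

End SetFunctions.

Section Densities.
Context (d : measure_display) (T : measurableType d) (R : realType).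
Implicit Types (mu lam : {finite_measure set T -> \bar R}).

Lemma integrable_bounded mu (E : set T) (h : T -> R) (C : R) : measurable E ->
  measurable_fun setT h -> (forall x, `|h x| <= C) -> mu.-integrable E (EFin \o h).
Proof.
move=> mE mh hC; apply: measurable_bounded_integrable => //.
- by rewrite -ge0_fin_numE //; exact: fin_num_measure.
- exact: measurable_funTS.
- exists C; split; first exact: num_real.
  by move=> M CM x _ /=; apply: (le_trans (hC x)); exact: ltW.
Qed.

Lemma normr_Rintegral_le mu (E : set T) (h : T -> R) (C : R) : measurable E ->
  measurable_fun setT h -> (forall x, `|h x| <= C) ->
  `|\int[mu]_(x in E) h x| <= C * fine (mu E).
Proof.
move=> mE mh hC.
have ih := integrable_bounded mu mE mh hC.
apply: (le_trans (le_normr_Rintegral mE ih)).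
rewrite -Rintegral_cst //; apply: le_Rintegral => //.
- exact: integrable_norm.
- by apply: (@integrable_bounded _ _ _ `|C|).
Qed.

Section Density.
Variables (mu lam : {finite_measure set T -> \bar R}) (phi : T -> R).
Hypothesis phi0 : forall x, 0 <= phi x.
Hypothesis iphi : mu.-integrable setT (EFin \o phi).
Hypothesis lamE : forall E, measurable E -> (lam E = \int[mu]_(x in E) (phi x)%:E)%E.

Lemma measurable_density : measurable_fun setT phi.
Proof. by apply/measurable_EFinP; exact: measurable_int iphi. Qed.

Lemma dominated_density : lam `<< mu.
Proof.
apply/null_content_dominatesP => E mE E0; rewrite lamE //.
apply: null_set_integral => //; apply/measurable_EFinP.
exact: measurable_funTS measurable_density.
Qed.

Let rn := Radon_Nikodym_SigmaFinite.f lam mu.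

Let rnE : ae_eq mu setT rn (EFin \o phi).
Proof.
apply/ae_eq_sym; apply: integral_ae_eq => //.
- exact: measurable_int (Radon_Nikodym_SigmaFinite.f_integrable dominated_density).
- move=> E _ mE; rewrite -lamE //.
  exact: (Radon_Nikodym_SigmaFinite.f_integral dominated_density).
Qed.

Lemma integral_density (q : T -> \bar R) : (forall x, 0 <= q x)%E -> measurable_fun setT q ->
  (\int[lam]_x q x = \int[mu]_x (q x * (phi x)%:E))%E.
Proof.
move=> q0 mq.
rewrite -(Radon_Nikodym_SigmaFinite.change_of_variables dominated_density) //.
apply: ge0_ae_eq_integral => //.
- apply: emeasurable_funM => //.
  exact: measurable_int (Radon_Nikodym_SigmaFinite.f_integrable dominated_density).
- by apply: emeasurable_funM => //; apply/measurable_EFinP; exact: measurable_density.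
- by move=> x _; rewrite mule_ge0 // Radon_Nikodym_SigmaFinite.f_ge0 //; exact: dominated_density.
- by move=> x _; rewrite mule_ge0 ?lee_fin.
- case: rnE => N [mN N0 hN]; exists N; split => // x /= hx; apply: hN => /= h.
  by apply: hx => _; rewrite -/rn h.
Qed.

Lemma Radon_Nikodym_density (m : set T -> R) (p : T -> R) : sigadd m ->
  mu.-integrable setT (EFin \o p) ->
  (forall E, measurable E -> m E = \int[mu]_(x in E) p x) ->
  (forall E, measurable E -> lam E = 0%E -> m E = 0) ->
  {ae mu, forall x, p x = phi x * fine (Radon_Nikodym (charge_of (fun E => (m E)%:E)) lam x)}.
Proof.
move=> sm ip mE mlam.
have ml : charge_of (fun E => (m E)%:E) `<< lam.
  by apply/null_content_dominatesP => E mE' E0; rewrite charge_ofE // mlam.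
set r := (Radon_Nikodym _ lam).
have ir := Radon_Nikodym_integrable ml.
have h1 : ae_eq mu setT (EFin \o p)
    (fun x => r x * Radon_Nikodym (charge_of_finite_measure lam) mu x)%E.
  apply: integral_ae_eq => //.
  - apply: emeasurable_funM; first exact: measurable_int ir.
    exact: (measurable_int mu (Radon_Nikodym_integrable (nu := charge_of_finite_measure lam) dominated_density)).
  - move=> E _ mE'; rewrite Radon_Nikodym_change_of_variables //; first last.
    + exact: (integrableS measurableT mE' _ ir).
    + exact: dominated_density.
    rewrite -Radon_Nikodym_integral // charge_ofE // mE // fineK //.
    by apply: integrable_fin_num => //; exact: (integrableS measurableT mE' _ ip).
have h2 := ae_eq_Radon_Nikodym_SigmaFinite dominated_density measurableT.
apply: filterS3 h1 h2 rnE => x /(_ I) e1 /(_ I) e2 /(_ I) e3.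
have rf : r x \is a fin_num by exact: Radon_Nikodym_fin_num.
have e4 : Radon_Nikodym (charge_of_finite_measure lam) mu x = (phi x)%:E.
  by rewrite -[LHS]e2; exact: e3.
have e5 : (p x)%:E = (fine (r x) * phi x)%:E.
  by rewrite EFinM fineK // -e4; exact: e1.
by case: e5 => ->; rewrite mulrC.
Qed.

End Density.

Lemma Radon_Nikodym_Rintegral (mu : {finite_measure set T -> \bar R}) (m : set T -> R) :
  sigadd m -> (forall E, measurable E -> mu E = 0%E -> m E = 0) ->
  mu.-integrable setT (EFin \o (fun x => fine (Radon_Nikodym (charge_of (fun E => (m E)%:E)) mu x))) /\
  forall E, measurable E ->
  \int[mu]_(x in E) fine (Radon_Nikodym (charge_of (fun E => (m E)%:E)) mu x) = m E.
Proof.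
move=> sm hm.
have ml : charge_of (fun E => (m E)%:E) `<< mu.
  by apply/null_content_dominatesP => E mE' E0; rewrite charge_ofE // hm.
have fE : EFin \o (fun x => fine (Radon_Nikodym (charge_of (fun E => (m E)%:E)) mu x)) =
    Radon_Nikodym (charge_of (fun E => (m E)%:E)) mu.
  by apply/funext => x /=; rewrite fineK //; exact: Radon_Nikodym_fin_num.
split; first by rewrite fE; exact: Radon_Nikodym_integrable.
move=> E mE; have h := Radon_Nikodym_integral ml mE.
by rewrite charge_ofE // in h; rewrite /Rintegral -[m E]/(fine (m E)%:E) h -fE.
Qed.

End Densities.

Section OperatorIntegral.
Context (d : measure_display) (T : measurableType d) (R : realType).
Variable mu : {finite_measure set T -> \bar R}.

Definition cbounded (h : T -> R[i]) : Prop :=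
  cmeas h /\ exists C : R, forall x, normc (h x) <= C.

Lemma cbounded_integrable (E : set T) h : measurable E -> cbounded h ->
  mu.-integrable E (EFin \o (fun x => complex.Re (h x))) /\
  mu.-integrable E (EFin \o (fun x => complex.Im (h x))).
Proof.
move=> mE [[m1 m2] [C hC]]; split; apply: (@integrable_bounded _ _ _ mu E _ C) => // x.
  exact: le_trans (ler_Re_normc _) (hC x).
exact: le_trans (ler_Im_normc _) (hC x).
Qed.

Lemma cintegralD (E : set T) h k : measurable E -> cbounded h -> cbounded k ->
  cintegral mu E (fun x => h x + k x) = cintegral mu E h + cintegral mu E k.
Proof.
move=> mE /(cbounded_integrable mE)[h1 h2] /(cbounded_integrable mE)[k1 k2].
apply: complex_ext; rewrite /= -RintegralD //; congr Rintegral; apply/funext => x.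
  by rewrite cReD.
by rewrite cImD.
Qed.

Lemma cintegralM (E : set T) (c : R[i]) h : measurable E -> cbounded h ->
  cintegral mu E (fun x => c * h x) = c * cintegral mu E h.
Proof.
move=> mE /(cbounded_integrable mE)[h1 h2].
have i1 (r : R) : mu.-integrable E (EFin \o (fun x => r * complex.Re (h x))).
  by have := integrableZl mE r h1; congr integrable; apply/funext => x /=; rewrite EFinM.
have i2 (r : R) : mu.-integrable E (EFin \o (fun x => r * complex.Im (h x))).
  by have := integrableZl mE r h2; congr integrable; apply/funext => x /=; rewrite EFinM.
apply: complex_ext; rewrite ?cReM ?cImM /= -!RintegralZl // -?RintegralB -?RintegralD //;
  congr Rintegral; apply/funext => x; by rewrite ?cReM ?cImM.
Qed.

Lemma eq_cintegral (E : set T) h k : h =1 k -> cintegral mu E h = cintegral mu E k.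
Proof. by move=> /funext ->. Qed.

Lemma normc_cintegral (E : set T) h (C : R) : measurable E -> cmeas h ->
  (forall x, normc (h x) <= C) ->
  normc (cintegral mu E h) <= 2 * (C * fine (mu E)).
Proof.
move=> mE [m1 m2] hC; apply: (le_trans (normc_le_ReIm _)); rewrite mulr_natl mulr2n.
apply: lerD; apply: normr_Rintegral_le => // x.
  exact: le_trans (ler_Re_normc _) (hC x).
exact: le_trans (ler_Im_normc _) (hC x).
Qed.

Lemma cintegral_ae (E : set T) h k : measurable E -> cmeas h -> cmeas k ->
  {ae mu, forall x, h x = k x} -> cintegral mu E h = cintegral mu E k.
Proof.
move=> mE [h1 h2] [k1 k2] hk; apply: complex_ext => /=; congr fine;
  apply: ae_eq_integral => //;
  try (by apply/measurable_EFinP; exact: measurable_funTS);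
  by apply: filterS hk => x /= hx _; rewrite hx.
Qed.

Section Operator.
Variables (K : hilbertType R) (b : nat -> K) (Q : T -> bop K) (M : R).
Hypotheses (onk : onseq b) (M0 : 0 <= M) (mQ : wmeas Q).
Hypothesis bQ : forall x u, nrm (Q x u) <= M * nrm u.

Lemma form_bounded u v x : normc (inner (Q x u) v) <= M * nrm u * nrm v.
Proof. by apply: (le_trans (cauchy_schwarz _ _)); rewrite ler_wpM2r. Qed.

Lemma cbounded_form u v : cbounded (fun x => inner (Q x u) v).
Proof. by split; [exact: mQ|exists (M * nrm u * nrm v) => x; exact: form_bounded]. Qed.

Lemma cintegral_bop (E : set T) : measurable E -> exists A : bop K,
  forall u v, inner (A u) v = cintegral mu E (fun x => inner (Q x u) v).
Proof.
move=> mE.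
have [|a u v w|a u v w|u v|A hA] := form_bop onk
  (B := fun u v => cintegral mu E (fun x => inner (Q x u) v))
  (M := 2 * (M * fine (mu E))).
- by rewrite mulr_ge0 // mulr_ge0 // fine_ge0.
- rewrite -cintegralM //; last exact: cbounded_form.
  rewrite -cintegralD //; first by apply: eq_cintegral => x; rewrite bop_lin inner_linearl.
    split; first by apply: cmeasZ; exact: mQ.
    exists (normc a * (M * nrm u * nrm w)) => x.
    by rewrite normcM ler_wpM2l // form_bounded.
  exact: cbounded_form.
- rewrite -cintegralM //; last exact: cbounded_form.
  rewrite -cintegralD //; first by apply: eq_cintegral => x; rewrite innerDr innerZr.
    split; first by apply: cmeasZ; exact: mQ.
    exists (normc (conjc a) * (M * nrm w * nrm u)) => x.
    by rewrite normcM ler_wpM2l // form_bounded.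
  exact: cbounded_form.
- have := normc_cintegral mE (mQ u v) (form_bounded u v).
  by move=> /le_trans; apply; rewrite (_ : _ * _ = 2 * (M * fine (mu E)) * nrm u * nrm v) //; ring.
by exists A.
Qed.
End Operator.

Lemma ae_ge0_of_integral (h : T -> R) : mu.-integrable setT (EFin \o h) ->
  (forall E, measurable E -> 0 <= \int[mu]_(x in E) h x) ->
  {ae mu, forall x, 0 <= h x}.
Proof.
move=> ih hE.
have mh : measurable_fun setT h by apply/measurable_EFinP; exact: measurable_int ih.
pose E : set T := h @^-1` `]-oo, 0[.
have mE : measurable E by rewrite -[E]setTI; apply: mh => //; exact: measurable_itv.
have Eneg x : E x -> h x < 0 by rewrite /E /= in_itv.
have ae0 : ae_eq mu E (EFin \o h) (cst 0%E).
  apply: integral_ae_eq => //.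
    exact: (integrableS measurableT mE _ ih).
  move=> F FE mF; rewrite integral0.
  have iF : mu.-integrable F (EFin \o h) by exact: (integrableS measurableT mF _ ih).
  rewrite -[LHS]fineK; last exact: integrable_fin_num.
  congr (_%:E); apply/eqP; rewrite eq_le [X in _ && X]hE // andbT.
  have z0 : \int[mu]_(x in F) (fun=> 0 : R) x = 0 by rewrite Rintegral_cst // mul0r.
  rewrite -[leRHS]z0; apply: le_Rintegral => // [|x /FE/Eneg/ltW//].
  by apply: (@integrable_bounded _ _ _ mu F _ 0) => // x; rewrite normr0.
case: ae0 => N [mN N0 hN]; exists N; split => // x /= /negP hx; apply: hN => /= h'.
move: hx; rewrite -ltNge => hx; have := h' _; rewrite /E /= in_itv /= => /(_ hx) [] h0.
by rewrite h0 ltxx in hx.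
Qed.

Lemma ae_eq0_of_integral (h : T -> R) : mu.-integrable setT (EFin \o h) ->
  (forall E, measurable E -> \int[mu]_(x in E) h x = 0) ->
  {ae mu, forall x, h x = 0}.
Proof.
move=> ih hE.
have ae0 : ae_eq mu setT (EFin \o h) (cst 0%E).
  apply: integral_ae_eq => // F _ mF; rewrite integral0.
  have iF : mu.-integrable F (EFin \o h) by exact: (integrableS measurableT mF _ ih).
  by rewrite -[LHS]fineK; [rewrite -[fine _]/(Rintegral mu F h) hE|exact: integrable_fin_num].
by apply: filterS ae0 => x /(_ I) /= [].
Qed.

Lemma wmeas_if (K : hilbertType R) (N : set T) (Q : T -> bop K) : measurable N ->
  wmeas Q -> wmeas (fun x => if x \in N then 0 else Q x).
Proof.
move=> mN mQ u v; have [m1 m2] := mQ u v.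
have mb : measurable_fun setT (fun x => x \in N).
  apply: (measurable_fun_bool true); rewrite setTI.
  by rewrite (_ : _ @^-1` _ = N) //; apply/seteqP; split => x /=; [move=> /set_mem|move=> /mem_set].
split.
  have := measurable_fun_ifT mb (@measurable_cst _ _ _ _ _ (0 : R)) m1.
  by congr measurable_fun; apply/funext => x; case: ifP => //; rewrite bop0E inner0l.
have := measurable_fun_ifT mb (@measurable_cst _ _ _ _ _ (0 : R)) m2.
by congr measurable_fun; apply/funext => x; case: ifP => //; rewrite bop0E inner0l.
Qed.
End OperatorIntegral.

Section PovmDensity.
Variables (R : realType) (H : hilbertType R) (I : countType) (e : I -> H).
Hypothesis onbe : onb e.
Local Notation E' := (onenum e).
Let oneE : onseq E' := onseq_onenum onbe.

Lemma optraceD (s A B : bop H) : state e s ->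
  optrace e (s \oc (A + B)) = optrace e (s \oc A) + optrace e (s \oc B).
Proof.
move=> hs; have [w [_ hw _]] := state_vectors onbe hs.
apply: (ccvg_unique (hw (A + B)) (ccvgD (hw A) (hw B))) => N.
by rewrite -big_split; apply: eq_bigr => n _; rewrite bopDE innerDl.
Qed.

Lemma optrace0 (s : bop H) : state e s -> optrace e (s \oc 0) = 0.
Proof.
move=> hs; have := optraceD 0 0 hs; rewrite addr0 => /eqP.
by rewrite -subr_eq0 opprD addrA subrr add0r oppr_eq0 => /eqP.
Qed.

Lemma optrace_sum (s : bop H) (A : nat -> bop H) n : state e s ->
  optrace e (s \oc \sum_(k < n) A k) = \sum_(0 <= k < n) optrace e (s \oc A k).
Proof.
move=> hs; rewrite big_mkord.
apply: (big_morph (fun A => optrace e (s \oc A)) (fun A B => optraceD A B hs)).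
exact: optrace0.
Qed.

Lemma state_trace_ge0 (s A : bop H) : state e s -> positive A ->
  0 <= complex.Re (optrace e (s \oc A)).
Proof.
move=> hs pA; have [w [_ hw _]] := state_vectors onbe hs.
have /cvg_complex[h _] := hw A; apply: (cvgr_to_ge h); apply: nearW => N.
by rewrite cRe_sum sumr_ge0 // => n _; exact: positive_ge0.
Qed.

Definition csigadd d (T : measurableType d) (m : set T -> R[i]) : Prop :=
  forall F : nat -> set T, (forall n, measurable (F n)) -> trivIset setT F ->
  (\sum_(0 <= k < n) m (F k) : R[i]^o) @[n --> \oo] --> (m (\bigcup_n F n) : R[i]^o).

Lemma csigadd_ReIm d (T : measurableType d) (m : set T -> R[i]) : csigadd m ->
  sigadd (fun E => complex.Re (m E)) /\ sigadd (fun E => complex.Im (m E)).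
Proof.
move=> hm; split => F mF tF; have /cvg_complex[h1 h2] := hm F mF tF.
  by under eq_fun do rewrite -cRe_sum.
by under eq_fun do rewrite -cIm_sum.
Qed.

Lemma csigaddM d (T : measurableType d) (c : R[i]) (m : set T -> R[i]) : csigadd m ->
  csigadd (fun E => c * m E).
Proof.
move=> hm F mF tF; under eq_fun do rewrite -mulr_sumr.
by apply: ccvgM; exact: hm.
Qed.

Lemma csigaddD d (T : measurableType d) (m m' : set T -> R[i]) : csigadd m -> csigadd m' ->
  csigadd (fun E => m E + m' E).
Proof.
move=> hm hm' F mF tF; under eq_fun do rewrite big_split.
by apply: ccvgD; [exact: hm|exact: hm'].
Qed.

Variables (X : ptopologicalType) (nu : set (borel X) -> bop H) (rho : bop H).
Hypotheses (pv : povm e nu) (st : state e rho) (fr : full_rank rho).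

Lemma povm_trace_csigadd s : state e s -> csigadd (fun E => optrace e (s \oc nu E)).
Proof.
move=> hs F mF tF; have [_ h] := pv.
have := h F mF tF s hs; apply: cvg_trans; apply: near_eq_cvg; apply: nearW => n.
exact: (@optrace_sum s (fun k => nu (F k)) n hs).
Qed.

Lemma povm_csigadd u v : csigadd (fun E => inner (nu E u) v).
Proof.
have q x : csigadd (fun E => inner (nu E x) x).
  have [->|x0] := eqVneq x 0.
    move=> F mF tF; rewrite inner0r (_ : (fun n => _) = fun=> 0); first exact: cvg_cst.
    by apply/funext => n; rewrite big1 // => k _; rewrite inner0r.
  have nx : nrm x != 0 by apply: contraNneq x0 => /nrm_eq0 ->.
  have n1 : nrm ((nrm x)^-1%:C *: x) = 1.
    by rewrite nrmZ normc_real ger0_norm ?invr_ge0 // mulVf.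
  have [s hs sE] := rank1_state onbe n1.
  have := @csigaddM _ _ ((nrm x) ^+ 2)%:C _ (povm_trace_csigadd hs).
  congr csigadd; apply/funext => E; rewrite sE.
  rewrite (linZ (bop_lin _)) innerZl innerZr conjc_real !mulrA -!rmorphM.
  by rewrite (_ : _ * _ * _ = 1) ?mul1r //; field.
have := @csigaddM _ _ 4^-1 _ (csigaddD (csigaddD (csigaddD (q (u + v)) (@csigaddM _ _ (-1) _ (q (u - v))))
  (@csigaddM _ _ 'i%C _ (q (u + 'i%C *: v)))) (@csigaddM _ _ (- 'i%C) _ (q (u - 'i%C *: v)))).
congr csigadd; apply/funext => E; rewrite mulN1r mulNr -bop_polarization.
by rewrite mulrA mulVf ?mul1r // pnatr_eq0.
Qed.

Lemma nu_rhoE E : measurable E ->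
  nu_rho e nu rho E = (complex.Re (optrace e (rho \oc nu E)))%:E.
Proof.
have [h _] := csigadd_ReIm (povm_trace_csigadd st).
move=> mE; rewrite /nu_rho measure_ofE // => A mA.
by apply: state_trace_ge0 => //; have [pn _] := pv; exact: pn.
Qed.

Lemma trace_eq0 (A : bop H) : positive A -> complex.Re (optrace e (rho \oc A)) = 0 -> A = 0.
Proof.
move=> pA h; have [w [_ hw hf]] := state_vectors onbe st.
apply: hf => // n; rewrite positive_real //; congr (_%:C).
have /cvg_complex[hr _] := hw A; rewrite h in hr.
have {}hr : \sum_(0 <= n < N) complex.Re (inner (A (w n)) (w n)) @[N --> \oo] --> (0 : R).
  by under eq_fun do rewrite -cRe_sum.
have t0 k : 0 <= complex.Re (inner (A (w k)) (w k)) by exact: positive_ge0.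
apply/eqP; rewrite eq_le t0 andbT.
have nd : nondecreasing_seq (fun N => \sum_(0 <= n < N) complex.Re (inner (A (w n)) (w n))).
  by apply/nondecreasing_seqP => k; rewrite big_nat_recr //= lerDl.
have := nondecreasing_cvgn_le nd (cvgP _ hr) n.+1; rewrite (cvg_lim _ hr) //.
by apply: le_trans; rewrite big_nat_recr //= lerDr sumr_ge0.
Qed.

Lemma nu_rho_null E : measurable E -> nu_rho e nu rho E = 0%E -> nu E = 0.
Proof.
move=> mE; rewrite nu_rhoE // => -[h]; apply: trace_eq0 => //.
by have [pn _] := pv; exact: pn.
Qed.

Local Notation mu := (nu_rho e nu rho).

Lemma rn_matrix_integral E i j : measurable E ->
  cintegral mu E (fun x => rn_matrix e nu rho x i j) = inner (nu E (e j)) (e i).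
Proof.
move=> mE; have [h1 h2] := csigadd_ReIm (@povm_csigadd (e j) (e i)).
have n1 A : measurable A -> mu A = 0%E -> complex.Re (inner (nu A (e j)) (e i)) = 0.
  by move=> mA A0; rewrite (nu_rho_null mA A0) bop0E inner0l.
have n2 A : measurable A -> mu A = 0%E -> complex.Im (inner (nu A (e j)) (e i)) = 0.
  by move=> mA A0; rewrite (nu_rho_null mA A0) bop0E inner0l.
have [_ e1] := Radon_Nikodym_Rintegral h1 n1.
have [_ e2] := Radon_Nikodym_Rintegral h2 n2.
by apply: complex_ext => /=; [exact: e1|exact: e2].
Qed.

Hypothesis sepH : separable H.
Hypothesis rn_ex : {ae mu, forall x, exists A, has_matrix e (rn_matrix e nu rho x) A}.
Hypothesis mrn : wmeas (rn e nu rho).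
Variable M : R.
Hypothesis M0 : 0 <= M.
Hypothesis rnM : {ae mu, forall x, (opnorm (rn e nu rho x) <= M%:E)%E}.

Lemma cmeas_rn_matrix i j : cmeas (fun x => rn_matrix e nu rho x i j).
Proof.
have [h1 h2] := csigadd_ReIm (@povm_csigadd (e j) (e i)).
have n1 A : measurable A -> mu A = 0%E -> complex.Re (inner (nu A (e j)) (e i)) = 0.
  by move=> mA A0; rewrite (nu_rho_null mA A0) bop0E inner0l.
have n2 A : measurable A -> mu A = 0%E -> complex.Im (inner (nu A (e j)) (e i)) = 0.
  by move=> mA A0; rewrite (nu_rho_null mA A0) bop0E inner0l.
have [e1 _] := Radon_Nikodym_Rintegral h1 n1.
have [e2 _] := Radon_Nikodym_Rintegral h2 n2.
by split; apply/measurable_EFinP; [exact: measurable_int e1|exact: measurable_int e2].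
Qed.

Lemma rn_bounded_version : exists D : borel X -> bop H,
  [/\ wmeas D, forall x u, nrm (D x u) <= M * nrm u,
      {ae mu, forall x, rn e nu rho x = D x} &
      forall E u v, measurable E ->
        inner (nu E u) v = cintegral mu E (fun x => inner (D x u) v)].
Proof.
have [N [mN N0 hN]] := rnM.
pose D x := if x \in N then 0 else rn e nu rho x.
have mD : wmeas D by exact: wmeas_if.
have bD x u : nrm (D x u) <= M * nrm u.
  rewrite /D; case: ifPn => [_|xN]; first by rewrite bop0E nrm0 mulr_ge0.
  apply: le_opnorm; apply: contrapT => h; move/negP: xN; apply.
  by apply: mem_set; apply: hN.
have aeD : {ae mu, forall x, rn e nu rho x = D x}.
  exists N; split => // x /= hx; apply: contrapT => xN; apply: hx.
  by rewrite /D memNset.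
exists D; split => // E u v mE.
have [A hA] := cintegral_bop mu oneE M0 mD bD mE.
rewrite -hA; suff -> : nu E = A by [].
apply: (bop_inner_ext oneE) => m n; rewrite /onenum.
case: pickle_inv => [j|]; last by rewrite !(lin0 (bop_lin _)) !inner0l.
case: pickle_inv => [i|]; last by rewrite !inner0r.
rewrite hA -rn_matrix_integral //.
apply: cintegral_ae => //; first exact: cmeas_rn_matrix.
apply: filterS2 rn_ex aeD => x ex <-.
by have := xgetPex 0 ex; move=> /(_ i j).
Qed.

Lemma rn_version : exists D : borel X -> bop H,
  [/\ wmeas D, forall x, positive (D x), forall x u, nrm (D x u) <= M * nrm u &
      {ae mu, forall x, rn e nu rho x = D x}].
Proof.
have [D [mD bD aeD hD]] := rn_bounded_version.
have [d hd] := separable_seq sepH.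
have aep n : {ae mu, forall x, 0 <= inner (D x (d n)) (d n)}.
  have cb := cbounded_form mD bD (d n) (d n).
  have [i1 i2] := cbounded_integrable mu measurableT cb.
  have h E : measurable E -> 0 <= cintegral mu E (fun x => inner (D x (d n)) (d n)).
    by move=> mE; rewrite -hD //; have [pn _] := pv; exact: pn.
  have h1 := ae_ge0_of_integral i1 _.
  have h2 := ae_eq0_of_integral i2 _.
  apply: filterS2 (h1 _) (h2 _) => [x r0 i0|E mE|E mE].
  - by rewrite le0cE r0 i0 eqxx.
  - by have := h E mE; rewrite le0cE => /andP[].
  - by have := h E mE; rewrite le0cE => /andP[/eqP].
have [U [mU U0 hU]] := ae_foralln aep.
have hU' x n : ~ U x -> 0 <= inner (D x (d n)) (d n).
  by move=> xU; apply: contrapT => h; apply: xU; apply: hU => /= h'; apply: h.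
exists (fun x => if x \in U then 0 else D x); split.
- exact: wmeas_if.
- move=> x; case: ifPn => xU; first exact: positive0.
  by apply: (separable_positive hd) => n; apply: hU' => /mem_set; apply/negP.
- by move=> x u; case: ifPn => _; rewrite ?bop0E ?nrm0 ?mulr_ge0.
- have aeU : {ae mu, forall x, ~ U x} by exists U; split => // x /= /contrapT.
  by apply: filterS2 aeD aeU => x -> xU; rewrite memNset.
Qed.

End PovmDensity.

Section TensorBound.
Variables (R : realType) (H K : hilbertType R) (t : H -> H -> K).
Hypothesis tt : is_tensor t.
Variables (e : nat -> H) (b : nat -> K).
Hypotheses (one : onseq e) (onk : onseq b).

Lemma nrm_op_tensor1 (t' : H -> H -> K) (A : bop H) (M : R) : is_tensor t' -> 0 <= M ->
  (forall u, nrm (A u) <= M * nrm u) ->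
  forall z, nrm (op_tensor t' A (bop1 H) z) <= M * nrm z.
Proof.
move=> tt' M0 bA z; have [V hV] := slices_exist tt' one.
rewrite -(ler_pXn2r (n := 2)) ?nnegrE ?mulr_ge0 // exprMn.
have h : \sum_(0 <= j < N) nrm (A (V j z)) ^+ 2 @[N --> \oo] -->
    nrm (op_tensor t' A (bop1 H) z) ^+ 2.
  have /cvg_complex[+ _] := @op_tensor1_slices _ _ _ _ tt' _ one _ hV (adjoint A \oc A) z z.
  rewrite -[X in op_tensor _ _ X](bop_comp1 (bop1 H)) -(op_tensor_comp tt' one) bop_compE.
  rewrite (op_tensor_adj tt' one onk (A' := A) (B' := bop1 H)) //; last first.
    by move=> u v; rewrite -(adjointPr one).
  rewrite -nrm2E; apply: cvg_trans; apply: near_eq_cvg; apply: nearW => N.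
  by rewrite cRe_sum; apply: eq_bigr => j _; rewrite bop_compE -(adjointPr one) nrm2E.
have h' : M ^+ 2 * \sum_(0 <= j < N) nrm (V j z) ^+ 2 @[N --> \oo] --> M ^+ 2 * nrm z ^+ 2.
  by apply: cvgMr; exact: (slice_parseval_nrm tt' one hV).
apply: (ler_cvg_to h h'); apply: nearW => N.
rewrite mulr_sumr; apply: ler_sum => j _.
by rewrite -exprMn ler_pXn2r ?nnegrE ?mulr_ge0.
Qed.

Lemma nrm_op_tensor (A B : bop H) (M M' : R) : 0 <= M -> 0 <= M' ->
  (forall u, nrm (A u) <= M * nrm u) -> (forall u, nrm (B u) <= M' * nrm u) ->
  forall z, nrm (op_tensor t A B z) <= M * M' * nrm z.
Proof.
move=> M0 M0' bA bB z.
rewrite -(bop_comp1 A) -(bop_1comp B) -(op_tensor_comp tt one) bop_compE.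
apply: (le_trans (nrm_op_tensor1 tt M0 bA _)); rewrite -mulrA ler_wpM2l //.
rewrite (op_tensor_flip tt one).
exact: (nrm_op_tensor1 (is_tensor_flip tt) M0' bB).
Qed.

End TensorBound.

Section TensorPovmDensity.
Variables (R : realType) (H K : hilbertType R) (t : H -> H -> K).
Hypothesis tt : is_tensor t.
Variables (I J : countType) (e : I -> H) (b : J -> K).
Hypotheses (onbe : onb e) (onbb : onb b).
Let one := onseq_onenum onbe.
Let onk := onseq_onenum onbb.
Variables (X : ptopologicalType) (mu : {finite_measure set (borel X) -> \bar R}).
Variables (D : borel X -> bop H) (M : R).
Hypotheses (mD : wmeas D) (pD : forall x, positive (D x)) (M0 : 0 <= M).
Hypothesis bD : forall x u, nrm (D x u) <= M * nrm u.
Variables (omega : set (borel X) -> bop K) (sigma : bop K).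

Definition tensor_density (x : borel X) : bop K := op_tensor t (D x) (D x).
Local Notation P := tensor_density.

Hypothesis omegaE : forall E u v, measurable E ->
  inner (omega E u) v = cintegral mu E (fun x => inner (P x u) v).
Hypotheses (st : state b sigma) (fr : full_rank sigma).

Lemma wmeas_tensor_density : wmeas P.
Proof. exact: (wmeas_op_tensor tt one onk). Qed.

Lemma tensor_density_positive x : positive (P x).
Proof. exact: (op_tensor_positive tt one onk). Qed.

Lemma nrm_tensor_density x u : nrm (P x u) <= M * M * nrm u.
Proof. exact: (nrm_op_tensor tt one onk). Qed.

Definition trace_density (x : borel X) : R := complex.Re (optrace b (sigma \oc P x)).
Local Notation phi := trace_density.

Lemma trace_density_ge0 x : 0 <= phi x.
Proof. by apply: (state_trace_ge0 onbb st); exact: tensor_density_positive. Qed.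

Lemma wmeas_trace (s : bop K) (Q : borel X -> bop K) : state b s -> wmeas Q ->
  measurable_fun setT (fun x => complex.Re (optrace b (s \oc Q x))).
Proof. by move=> hs /(qrvP onbb)/(_ s hs)[]. Qed.

Lemma state_trace_le (s A : bop K) (C : R) : state b s -> 0 <= C ->
  (forall u, nrm (A u) <= C * nrm u) -> `|complex.Re (optrace b (s \oc A))| <= C.
Proof.
move=> hs C0 hC; have [w [w1 hw _]] := state_vectors onbb hs.
have /cvg_complex[h _] := hw A.
have h2 : C * \sum_(0 <= n < N) nrm (w n) ^+ 2 @[N --> \oo] --> C.
  rewrite -[X in _ --> X]mulr1; apply: cvgMr; apply/cvg_nneseries => //.
  by move=> n; exact: sqr_ge0.
apply: (ler_cvg_to (cvg_norm h) h2); apply: nearW => N.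
rewrite cRe_sum mulr_sumr; apply: (le_trans (ler_norm_sum _ _ _)); apply: ler_sum => n _.
apply: (le_trans (ler_Re_normc _)); apply: (le_trans (cauchy_schwarz _ _)).
by rewrite expr2 mulrA ler_wpM2r.
Qed.

Lemma trace_density_bounded x : `|phi x| <= M * M.
Proof. by apply: (state_trace_le st); rewrite ?mulr_ge0 // => u; exact: nrm_tensor_density. Qed.

Lemma trace_density_integrable (E : set (borel X)) : measurable E ->
  mu.-integrable E (EFin \o phi).
Proof.
move=> mE; apply: (@integrable_bounded _ _ _ mu E _ (M * M)) => //.
  by apply: wmeas_trace => //; exact: wmeas_tensor_density.
exact: trace_density_bounded.
Qed.

Lemma integral_trace (s : bop K) (Q : borel X -> bop K) (E : set (borel X)) (w : nat -> K) :
  measurable E -> wmeas Q -> (forall x, positive (Q x)) ->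
  (forall A : bop K, (\sum_(0 <= n < N) inner (A (w n)) (w n) : R[i]^o) @[N --> \oo]
        --> (optrace b (s \oc A) : R[i]^o)) ->
  (\int[mu]_(x in E) (complex.Re (optrace b (s \oc Q x)))%:E =
   \sum_(0 <= n <oo) \int[mu]_(x in E) (complex.Re (inner (Q x (w n)) (w n)))%:E)%E.
Proof.
move=> mE mQ pQ hw; rewrite -integral_nneseries //.
- apply: eq_integral => x _; apply/esym/cvg_nneseries.
    by move=> n; exact: positive_ge0.
  have /cvg_complex[+ _] := hw (Q x).
  by under eq_fun do rewrite cRe_sum.
- move=> n; apply/measurable_EFinP; apply: measurable_funTS.
  by have [] := mQ (w n) (w n).
- by move=> n x _; rewrite lee_fin; exact: positive_ge0.
Qed.

Lemma trace_omega (E : set (borel X)) : measurable E ->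
  (complex.Re (optrace b (sigma \oc omega E)))%:E = (\int[mu]_(x in E) (phi x)%:E)%E.
Proof.
move=> mE; have [w [w1 hw _]] := state_vectors onbb st.
rewrite (integral_trace mE wmeas_tensor_density tensor_density_positive hw).
have q n : (complex.Re (inner (omega E (w n)) (w n)))%:E =
   (\int[mu]_(x in E) (complex.Re (inner (P x (w n)) (w n)))%:E)%E.
  rewrite omegaE //= fineK //; apply: integrable_fin_num => //.
  have cb := cbounded_form wmeas_tensor_density nrm_tensor_density (w n) (w n).
  by have [] := cbounded_integrable mu mE cb.
apply/esym; under eq_eseriesr do rewrite -q.
apply/cvg_nneseries.
  move=> n; rewrite -lee_fin q; apply: integral_ge0 => x _; rewrite lee_fin.
  by apply: positive_ge0; exact: tensor_density_positive.
by have /cvg_complex[+ _] := hw (omega E); under eq_fun do rewrite cRe_sum.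
Qed.

Local Notation lam := (nu_rho b omega sigma).

Lemma trace_omegaR (E : set (borel X)) : measurable E ->
  complex.Re (optrace b (sigma \oc omega E)) = \int[mu]_(x in E) phi x.
Proof. by move=> mE; rewrite /Rintegral -trace_omega. Qed.

Lemma nu_sigmaE (E : set (borel X)) : measurable E ->
  lam E = (\int[mu]_(x in E) (phi x)%:E)%E.
Proof.
move=> mE; rewrite -trace_omega // /nu_rho measure_ofE //.
  move=> F mF tF; rewrite trace_omegaR; last exact: bigcupT_measurable.
  have h := sigadd_Rintegral (trace_density_integrable measurableT) mF tF.
  apply: cvg_trans h; apply: near_eq_cvg; apply: nearW => n.
  by apply: eq_bigr => k _; rewrite trace_omegaR.
move=> F mF; rewrite trace_omegaR //; apply: Rintegral_ge0 => x _.
exact: trace_density_ge0.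
Qed.

Lemma nu_sigma_dominated : lam `<< mu.
Proof.
exact: (dominated_density (trace_density_integrable measurableT) nu_sigmaE).
Qed.

Lemma trace_density_gt0_ae : {ae lam, forall x, 0 < phi x}.
Proof.
have mphi : measurable_fun setT phi.
  by apply: wmeas_trace => //; exact: wmeas_tensor_density.
pose E : set (borel X) := phi @^-1` [set 0].
have mE : measurable E by rewrite -[E]setTI; exact: mphi.
exists E; split => //.
  rewrite nu_sigmaE // integral0_eq // => x; rewrite /E /= => ->.
  by [].
move=> x /= /negP; rewrite -leNgt => h; rewrite /E /=; apply/eqP.
by rewrite eq_le h trace_density_ge0.
Qed.

Lemma omega_csigadd u v : sigadd (fun E => complex.Re (inner (omega E u) v)) /\
  sigadd (fun E => complex.Im (inner (omega E u) v)).
Proof.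
have cb := cbounded_form wmeas_tensor_density nrm_tensor_density u v.
have [i1 i2] := cbounded_integrable mu measurableT cb.
split => F mF tF; rewrite omegaE; try exact: bigcupT_measurable.
  have h := sigadd_Rintegral i1 mF tF.
  apply: cvg_trans h; apply: near_eq_cvg; apply: nearW => n.
  by apply: eq_bigr => k _; rewrite omegaE.
have h := sigadd_Rintegral i2 mF tF.
apply: cvg_trans h; apply: near_eq_cvg; apply: nearW => n.
by apply: eq_bigr => k _; rewrite omegaE.
Qed.

Lemma omega_null (E : set (borel X)) : measurable E -> lam E = 0%E -> omega E = 0.
Proof.
move=> mE E0; apply: (trace_eq0 onbb st fr).
  move=> u; rewrite omegaE // le0cE /=; apply/andP; split.
    have -> : (fun x => complex.Im (inner (P x u) u)) = fun=> 0.
      by apply/funext => x; apply: ger0_Im; exact: tensor_density_positive.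
    by rewrite Rintegral_cst // mul0r.
  apply: Rintegral_ge0 => x _; apply: positive_ge0; exact: tensor_density_positive.
by apply: EFin_inj; rewrite trace_omega // -nu_sigmaE.
Qed.

Lemma rn_matrix_density i j :
  {ae mu, forall x, inner (P x (b j)) (b i) = (phi x)%:C * rn_matrix b omega sigma x i j}.
Proof.
have cb := cbounded_form wmeas_tensor_density nrm_tensor_density (b j) (b i).
have [i1 i2] := cbounded_integrable mu measurableT cb.
have [s1 s2] := @omega_csigadd (b j) (b i).
have h1 := Radon_Nikodym_density (trace_density_integrable measurableT)
  nu_sigmaE s1 i1 _ _.
have h2 := Radon_Nikodym_density (trace_density_integrable measurableT)
  nu_sigmaE s2 i2 _ _.
apply: filterS2 (h1 _ _) (h2 _ _) => [x e1 e2|E mE|E mE E0|E mE|E mE E0].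
- by apply: complex_ext; rewrite ?cReZ ?cImZ ?e1 ?e2.
- by rewrite omegaE.
- by rewrite omega_null // bop0E inner0l.
- by rewrite omegaE.
- by rewrite omega_null // bop0E inner0l.
Qed.

Lemma rn_omega : {ae lam, forall x, 0 < phi x /\
  rn b omega sigma x = ((phi x)^-1)%:C *: P x}.
Proof.
have h : {ae mu, forall x, forall n, match unpickle n with
    | Some (i, j) => inner (P x (b j)) (b i) = (phi x)%:C * rn_matrix b omega sigma x i j
    | None => True end}.
  apply: ae_foralln => n; case: unpickle => [[i j]|]; first exact: rn_matrix_density.
  exact: aeW.
have h' : {ae lam, forall x, forall n, match unpickle n with
    | Some (i, j) => inner (P x (b j)) (b i) = (phi x)%:C * rn_matrix b omega sigma x i j
    | None => True end}.
  have [N [mN N0 hN]] := h; exists N; split => //.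
  by have /null_content_dominatesP := nu_sigma_dominated; apply.
apply: filterS2 h' trace_density_gt0_ae => x hx p0; split => //.
have ex : has_matrix b (rn_matrix b omega sigma x) (((phi x)^-1)%:C *: P x).
  move=> i j; have := hx (pickle (i, j)); rewrite pickleK => hij.
  by rewrite bopZE innerZl hij mulrA -rmorphM mulVf ?gt_eqF // mul1r.
have ex' := xgetPex 0 (ex_intro _ _ ex); rewrite -/(op_of_matrix b _) in ex'.
apply: (bop_inner_ext onk) => m n; rewrite /onenum.
case: pickle_inv => [j|]; last by rewrite !(lin0 (bop_lin _)) !inner0l.
case: pickle_inv => [i|]; last by rewrite !inner0r.
by rewrite /rn ex' ex.
Qed.

End TensorPovmDensity.

Lemma twistE (R : realType) (H : hilbertType R) (I : countType) (e : I -> H)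
    (X : ptopologicalType) (nu : set (borel X) -> bop H) (rho : bop H) f s x :
  twist e nu rho f s x =
  optrace e (s \oc (opsqrt (rn e nu rho x) \oc f x \oc opsqrt (rn e nu rho x))).
Proof. by rewrite /twist -!bop_compA. Qed.

(** * Tensoring with a scalar function *)

Section KeyInequality.
Variables (R : realType) (H K : hilbertType R) (t : H -> H -> K).
Hypothesis tt : is_tensor t.
Variables (I J : countType) (e : I -> H) (b : J -> K).
Hypotheses (onbe : onb e) (onbb : onb b).
Let one := onseq_onenum onbe.
Let onk := onseq_onenum onbb.
Variables (X : ptopologicalType) (nu : set (borel X) -> bop H) (rho : bop H).
Local Notation mu := (nu_rho e nu rho).
Variables (D : borel X -> bop H) (M : R).
Hypotheses (mD : wmeas D) (pD : forall x, positive (D x)) (M0 : 0 <= M).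
Hypothesis bD : forall x u, nrm (D x u) <= M * nrm u.
Hypothesis aeD : {ae mu, forall x, rn e nu rho x = D x}.
Variables (omega : set (borel X) -> bop K) (sigma : bop K).
Local Notation P := (tensor_density t D).
Local Notation phi := (trace_density t b D sigma).
Hypothesis omegaE : forall E u v, measurable E ->
  inner (omega E u) v = cintegral mu E (fun x => inner (P x u) v).
Hypotheses (st : state b sigma) (fr : full_rank sigma).
Local Notation lam := (nu_rho b omega sigma).

Variables (F : borel X -> bop H) (L : R) (c : borel X -> R) (G : R).
Hypotheses (mF : wmeas F) (pF : pos_fun F) (L0 : 0 <= L).
Hypothesis FL : (sup_integral e nu rho F <= L%:E)%E.
Hypotheses (mc : measurable_fun setT c) (c0 : forall x, 0 <= c x) (G0 : 0 <= G).
Hypothesis cG : {ae mu, forall x, c x <= G}.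

Definition sandwich (A : borel X -> bop H) (x : borel X) : bop H :=
  opsqrt (A x) \oc F x \oc opsqrt (A x).

Lemma sandwich_positive A x : positive (sandwich A x).
Proof.
by apply: positive_conj => //; apply: positive_sa; exact: opsqrt_positive.
Qed.

Local Notation Phi := (sandwich D).

Lemma wmeas_opsqrt_version : wmeas (fun x => opsqrt (D x)).
Proof.
have M1 : 0 < M + 1 by rewrite ltr_wpDl.
apply: (wmeas_opsqrt one M1) => // x u.
by have := bD x u; have := nrm_ge0 u; nra.
Qed.

Lemma wmeas_sandwich : wmeas Phi.
Proof.
by apply: (wmeas_comp one); [apply: (wmeas_comp one)|]; rewrite //; exact: wmeas_opsqrt_version.
Qed.

Lemma measurable_form (V : hilbertType R) (Q : borel X -> bop V) u : wmeas Q ->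
  measurable_fun setT (fun x => (complex.Re (inner (Q x u) u))%:E).
Proof. by move=> mQ; apply/measurable_EFinP; have [] := mQ u u. Qed.

Lemma integral_sandwich_unit v : nrm v = 1 ->
  (\int[mu]_x (complex.Re (inner (Phi x v) v))%:E <= L%:E)%E.
Proof.
move=> v1; have [s hs sE] := rank1_state onbe v1.
apply: le_trans FL; apply: (@le_trans _ _ (\int[mu]_x (complex.Re (twist e nu rho F s x))%:E)%E).
  have tE x : twist e nu rho F s x = inner (sandwich (rn e nu rho) x v) v.
    by rewrite twistE sE.
  apply: ae_le_integral_nonmeasurable.
  - by move=> x; rewrite lee_fin; apply: positive_ge0; exact: sandwich_positive.
  - by move=> x; rewrite lee_fin tE; apply: positive_ge0; exact: sandwich_positive.
  - by apply: filterS aeD => x h; rewrite tE /sandwich h.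
by apply: ereal_sup_ubound; exists s.
Qed.

Lemma integral_sandwich v :
  (\int[mu]_x (complex.Re (inner (Phi x v) v))%:E <= (L * nrm v ^+ 2)%:E)%E.
Proof.
have [->|v0] := eqVneq v 0.
  rewrite integral0_eq ?lee_fin ?mulr_ge0 ?sqr_ge0 // => x _.
  by rewrite inner0r.
have nv : nrm v != 0 by apply: contraNneq v0 => /nrm_eq0 ->.
have n1 : nrm ((nrm v)^-1%:C *: v) = 1.
  by rewrite nrmZ normc_real ger0_norm ?invr_ge0 // mulVf.
set v' := _ *: v in n1.
have -> : (\int[mu]_x (complex.Re (inner (Phi x v) v))%:E =
    \int[mu]_x ((nrm v ^+ 2)%:E * (complex.Re (inner (Phi x v') v'))%:E))%E.
  apply: eq_integral => x _; rewrite -EFinM; congr (_%:E).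
  rewrite -cReZ; congr complex.Re.
  rewrite /v' (linZ (bop_lin _)) innerZl innerZr conjc_real !mulrA -!rmorphM.
  by rewrite (_ : _ * _ * _ = 1) ?mul1r //; field.
rewrite ge0_integralZl_EFin ?sqr_ge0 //; first last.
- by apply: measurable_form; exact: wmeas_sandwich.
- by move=> x _; rewrite lee_fin; apply: positive_ge0; exact: sandwich_positive.
rewrite mulrC (EFinM _ L); apply: lee_wpmul2l; last exact: integral_sandwich_unit.
by rewrite lee_fin sqr_ge0.
Qed.

Definition tensor_sandwich (x : borel X) : bop K :=
  op_tensor t (Phi x) ((c x)%:C *: D x).
Local Notation Psi := tensor_sandwich.

Lemma cmeas_c : cmeas (fun x => (c x)%:C : R[i]).
Proof. by split => //; exact: measurable_cst. Qed.

Lemma wmeas_tensor_sandwich : wmeas Psi.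
Proof.
apply: (wmeas_op_tensor tt one onk); first exact: wmeas_sandwich.
by apply: wmeasZ => //; exact: cmeas_c.
Qed.

Lemma tensor_sandwich_positive x : positive (Psi x).
Proof.
apply: (op_tensor_positive tt one onk); first exact: sandwich_positive.
exact: positiveZ.
Qed.

Lemma tensor_sandwich_le x z : c x <= G ->
  complex.Re (inner (Psi x z) z) <=
  M * G * complex.Re (inner (op_tensor t (Phi x) (bop1 H) z) z).
Proof.
move=> cxG.
have pB : positive ((M * G)%:C *: bop1 H - (c x)%:C *: D x).
  apply: positiveP.
    by apply: saD; [apply: saZ; exact: sa1|apply: saN; apply: saZ; exact: positive_sa].
  move=> u; rewrite bopBE innerBl !bopZE !innerZl bop1E cReD cReN !cReZ -nrm2E subr_ge0.
  have h1 : complex.Re (inner (D x u) u) <= M * nrm u ^+ 2.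
    apply: (le_trans (ler_norm _)); apply: (le_trans (ler_Re_normc _)).
    by apply: (le_trans (cauchy_schwarz _ _)); rewrite expr2 mulrA ler_wpM2r.
  have h2 := positive_ge0 u (pD x).
  apply: (@le_trans _ _ (G * (M * nrm u ^+ 2))); first by rewrite ler_pM.
  by rewrite mulrA (mulrC G).
have := positive_ge0 z (op_tensor_positive tt one onk (sandwich_positive D x) pB).
rewrite (op_tensorDr tt one) (op_tensorNr tt one) (op_tensorZr tt one _ _ (bop1 H)).
by rewrite bopBE innerBl bopZE innerZl cReD cReN cReZ subr_ge0.
Qed.

Lemma integral_tensor_sandwich z :
  (\int[mu]_x (complex.Re (inner (Psi x z) z))%:E <= (M * G * L * nrm z ^+ 2)%:E)%E.
Proof.
have [V hV] := slices_exist tt one.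
have MG0 : 0 <= M * G by rewrite mulr_ge0.
have m1 : wmeas (fun x => op_tensor t (Phi x) (bop1 H)).
  by apply: (wmeas_op_tensorl one) => //; exact: wmeas_sandwich.
have p1 x : positive (op_tensor t (Phi x) (bop1 H)).
  apply: (op_tensor_positive tt one onk); first exact: sandwich_positive.
  exact: positive1.
apply: (@le_trans _ _ (\int[mu]_x ((M * G)%:E *
    (complex.Re (inner (op_tensor t (Phi x) (bop1 H) z) z))%:E))%E).
  apply: ae_le_integral_nonmeasurable.
  - by move=> x; rewrite lee_fin; apply: positive_ge0; exact: tensor_sandwich_positive.
  - by move=> x; rewrite -EFinM lee_fin mulr_ge0 //; exact: positive_ge0.
  - by apply: filterS cG => x /tensor_sandwich_le h; rewrite -EFinM lee_fin.
rewrite ge0_integralZl_EFin //; first last.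
- exact: measurable_form.
- by move=> x _; rewrite lee_fin; exact: positive_ge0.
rewrite -mulrA (EFinM (M * G)); apply: lee_wpmul2l; first by rewrite lee_fin.
have -> : (\int[mu]_x (complex.Re (inner (op_tensor t (Phi x) (bop1 H) z) z))%:E =
   \int[mu]_x \sum_(0 <= j <oo) (complex.Re (inner (Phi x (V j z)) (V j z)))%:E)%E.
  apply: eq_integral => x _; apply/esym/cvg_nneseries.
    by move=> j; apply: positive_ge0; exact: sandwich_positive.
  have /cvg_complex[+ _] := @op_tensor1_slices _ _ _ _ tt _ one _ hV (Phi x) z z.
  by under eq_fun do rewrite cRe_sum.
rewrite integral_nneseries //; first last.
- by move=> j x _; rewrite lee_fin; apply: positive_ge0; exact: sandwich_positive.
- by move=> j; apply: measurable_form; exact: wmeas_sandwich.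
apply: (@le_trans _ _ (\sum_(0 <= j <oo) (L * nrm (V j z) ^+ 2)%:E)%E).
  apply: lee_nneseries => j _; last exact: integral_sandwich.
  by move=> _; apply: integral_ge0 => x _; rewrite lee_fin; apply: positive_ge0; exact: sandwich_positive.
suff -> : (\sum_(0 <= j <oo) (L * nrm (V j z) ^+ 2)%:E = (L * nrm z ^+ 2)%:E)%E by [].
apply/cvg_nneseries; first by move=> j; rewrite mulr_ge0 ?sqr_ge0.
under eq_fun do rewrite -mulr_sumr.
by apply: cvgMr; exact: (slice_parseval_nrm tt one hV).
Qed.

Lemma twist_tensor s x : 0 < phi x -> rn b omega sigma x = ((phi x)^-1)%:C *: P x ->
  twist b omega sigma (fun x => op_tensor t (F x) ((c x)%:C *: bop1 H)) s x =
  optrace b (s \oc (((phi x)^-1)%:C *: Psi x)).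
Proof.
move=> p0 rnE; have pV : 0 <= (phi x)^-1 by rewrite invr_ge0 ltW.
set S := opsqrt (D x); have [pS SS] := opsqrtP (pD x).
set r := Num.sqrt (phi x)^-1.
have rr : r * r = (phi x)^-1 by rewrite -expr2 sqr_sqrtr.
have pSS : positive (op_tensor t S S).
  by apply: (op_tensor_positive tt one onk).
rewrite twistE.
rewrite rnE (opsqrt_eq (B := r%:C *: op_tensor t S S)); first last.
- rewrite bop_compZl bop_compZr scalerA -rmorphM rr (op_tensor_comp tt one).
  by rewrite /S SS.
- by apply: positiveZ => //; exact: sqrtr_ge0.
congr (optrace b (s \oc _)).
rewrite !bop_compZl bop_compZr scalerA -rmorphM rr !(op_tensor_comp tt one).
congr (_ *: _); congr op_tensor.
by rewrite bop_compZr bop_compZl bop_comp1 /S SS.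
Qed.

Lemma optraceZ (s A : bop K) (k : R[i]) : state b s ->
  optrace b (s \oc (k *: A)) = k * optrace b (s \oc A).
Proof.
move=> hs; have [w [_ hw _]] := state_vectors onbb hs.
apply: (ccvg_unique (hw (k *: A)) (ccvgM (c := k) (hw A))) => N.
by rewrite mulr_sumr; apply: eq_bigr => n _; rewrite bopZE innerZl.
Qed.

Lemma key_inequality :
  (sup_integral b omega sigma (fun x => op_tensor t (F x) ((c x)%:C *: bop1 H))
    <= (M * G * L)%:E)%E.
Proof.
apply: ge_ereal_sup => _ [s hs <-].
have [w [w1 hw _]] := state_vectors onbb hs.
pose psi x : R := complex.Re (optrace b (s \oc Psi x)).
have psi0 x : 0 <= psi x by apply: (state_trace_ge0 onbb hs); exact: tensor_sandwich_positive.
have mpsi : measurable_fun setT psi.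
  by apply: (wmeas_trace onbb hs); exact: wmeas_tensor_sandwich.
have phi0 x : 0 <= phi x by apply: (trace_density_ge0 tt onbe onbb pD st).
have mphi : measurable_fun setT phi.
  by apply: (wmeas_trace onbb st); exact: (wmeas_tensor_density tt onbe onbb).
pose q x : R := (phi x `^ (-1)) * psi x.
have q0 x : 0 <= q x by rewrite mulr_ge0 ?powR_ge0.
have mq : measurable_fun setT q.
  apply: measurable_funM => //.
  apply: (@measurableT_comp _ _ _ _ _ _ (fun a : R => a `^ (-1)) _ phi) => //.
apply: (@le_trans _ _ (\int[lam]_x (q x)%:E)%E).
  apply: ae_le_integral_nonmeasurable.
  - move=> x; rewrite lee_fin twistE.
    apply: (state_trace_ge0 onbb hs); apply: positive_conj; last first.
      apply: (op_tensor_positive tt one onk) => //.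
      by apply: positiveZ => //; exact: positive1.
    by apply: positive_sa; exact: opsqrt_positive.
  - by move=> x; rewrite lee_fin.
  - apply: filterS (rn_omega tt onbe onbb mD pD M0 bD omegaE st fr) => x [p0 rnE].
    rewrite lee_fin twist_tensor // optraceZ // cReZ /q powR_inv1 //.
rewrite (integral_density phi0 (trace_density_integrable tt onbe onbb mu mD M0 bD st measurableT)
   (nu_sigmaE tt onbe onbb mD pD M0 bD omegaE st)) //; last exact/measurable_EFinP.
apply: (@le_trans _ _ (\int[mu]_x (psi x)%:E)%E).
  apply: ae_le_integral_nonmeasurable.
  - by move=> x; rewrite -EFinM lee_fin mulr_ge0.
  - by move=> x; rewrite lee_fin.
  - apply: aeW => x; rewrite -EFinM lee_fin /q powR_inv1 //.
    have [->|p0] := eqVneq (phi x) 0; first by rewrite mulr0.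
    by rewrite mulrAC mulVf // mul1r.
rewrite (integral_trace mu measurableT wmeas_tensor_sandwich tensor_sandwich_positive hw).
apply: (@le_trans _ _ (\sum_(0 <= n <oo) (M * G * L * nrm (w n) ^+ 2)%:E)%E).
  apply: lee_nneseries => n _; last exact: integral_tensor_sandwich.
  by move=> _; apply: integral_ge0 => x _; rewrite lee_fin; apply: positive_ge0; exact: tensor_sandwich_positive.
suff -> : (\sum_(0 <= n <oo) (M * G * L * nrm (w n) ^+ 2)%:E = (M * G * L)%:E)%E by [].
apply/cvg_nneseries; first by move=> n; rewrite mulr_ge0 ?sqr_ge0 // !mulr_ge0.
have h : M * G * L * \sum_(0 <= n < N) nrm (w n) ^+ 2 @[N --> \oo] --> M * G * L * 1.
  by apply: cvgMr; apply/cvg_nneseries => // n; exact: sqr_ge0.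
by rewrite mulr1 in h; under eq_fun do rewrite -mulr_sumr.
Qed.

End KeyInequality.

(** * Positive block matrices and decompositions *)

Section Blocks.
Variables (R : realType) (H : hilbertType R) (e : nat -> H).
Hypothesis one : onseq e.
Implicit Types S A f g : bop H.

Lemma block_positiveP S1 A S2 : positive S1 -> positive S2 ->
  block_positive S1 A S2 <->
  forall u v, 0 <= complex.Re (inner (S1 u) u) + 2 * complex.Re (inner (A v) u)
    + complex.Re (inner (S2 v) v).
Proof.
move=> p1 p2.
have E u v : inner (S1 u + A v) u + inner (adjoint A u + S2 v) v =
    (complex.Re (inner (S1 u) u) + 2 * complex.Re (inner (A v) u)
    + complex.Re (inner (S2 v) v))%:C.
  rewrite !innerDl -(adjointPr one) (innerC u) (positive_real u p1) (positive_real v p2).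
  by apply: complex_ext; rewrite !(cReD, cImD, cReJ, cImJ) /=; ring.
by split=> h u v; have := h u v; rewrite E ler0c.
Qed.

Lemma block_positive_decomposition (f1 f2 f3 f4 : bop H) :
  positive f1 -> positive f2 -> positive f3 -> positive f4 ->
  block_positive (f1 + f2 + f3 + f4) (f1 - f2 + 'i%C *: f3 - 'i%C *: f4) (f1 + f2 + f3 + f4).
Proof.
move=> p1 p2 p3 p4.
have pS : positive (f1 + f2 + f3 + f4) by do 3 (apply: positiveD => //).
apply/block_positiveP => // u v.
have key (f : bop H) (w : R[i]) : positive f -> normc w = 1 ->
    0 <= complex.Re (inner (f u) u) + 2 * complex.Re (w * inner (f v) u)
      + complex.Re (inner (f v) v).
  move=> pf w1; have := positive_ge0 (u + w *: v) pf.
  rewrite (linD (bop_lin f)) (linZ (bop_lin f)) innerDl !innerDr !innerZl !innerZr.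
  rewrite (positive_sa pf u v) (innerC u) mulrA mul_conj w1 expr1n mul1r.
  rewrite -rmorphM !cReD cReJ; lra.
have k1 := key f1 1 p1 (Normc.normc1 _).
have k2 := key f2 (-1) p2 (etrans (normcN _) (Normc.normc1 _)).
have i1 : normc ('i%C : R[i]) = 1 by rewrite /= expr0n expr1n add0r sqrtr1.
have k3 := key f3 'i%C p3 i1.
have k4 := key f4 (- 'i%C) p4 (etrans (normcN _) i1).
rewrite !bopDE !bopNE !bopZE !innerDl !innerNl !innerZl !cReD !cReN.
rewrite mul1r mulN1r mulNr !cReN in k1 k2 k4.
lra.
Qed.

End Blocks.

Section TensorBlocks.
Variables (R : realType) (H K : hilbertType R) (t : H -> H -> K).
Hypothesis tt : is_tensor t.
Variables (e : nat -> H) (b : nat -> K).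
Hypotheses (one : onseq e) (onk : onseq b).
Local Notation id1 := (bop1 H).

Lemma block_positive_tensor1 (S1 A S2 : bop H) : positive S1 -> positive S2 ->
  block_positive S1 A S2 ->
  block_positive (op_tensor t S1 id1) (op_tensor t A id1) (op_tensor t S2 id1).
Proof.
move=> p1 p2 /(block_positiveP one A p1 p2) h.
apply/(block_positiveP onk); try by apply: (op_tensor_positive tt one onk) => //; exact: positive1.
move=> u v; have [V hV] := slices_exist tt one.
have /cvg_complex[c1 _] := @op_tensor1_slices _ _ _ _ tt _ one _ hV S1 u u.
have /cvg_complex[c2 _] := @op_tensor1_slices _ _ _ _ tt _ one _ hV A v u.
have /cvg_complex[c3 _] := @op_tensor1_slices _ _ _ _ tt _ one _ hV S2 v v.
have c4 : (complex.Re (\sum_(0 <= j < N) inner (S1 (V j u)) (V j u)) +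
    2 * complex.Re (\sum_(0 <= j < N) inner (A (V j v)) (V j u)) +
    complex.Re (\sum_(0 <= j < N) inner (S2 (V j v)) (V j v))) @[N --> \oo] -->
    complex.Re (inner (op_tensor t S1 id1 u) u) +
    2 * complex.Re (inner (op_tensor t A id1 v) u) +
    complex.Re (inner (op_tensor t S2 id1 v) v).
  by apply: cvgD; [apply: cvgD; [exact: c1|apply: cvgMr; exact: c2]|exact: c3].
apply: (cvgr_to_ge c4); apply: nearW => N.
rewrite /= !cRe_sum mulr_sumr -!big_split sumr_ge0 // => j _; exact: h.
Qed.

(* Apply the form of [block_positive_tensor1] to (c u, (1 (x) g) v), where
   c = |g|, and bound g^* g by c^2. *)
Lemma block_positive_tensor (S1 f S2 g : bop H) : positive S1 -> positive S2 ->
  block_positive S1 f S2 ->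
  block_positive (op_tensor t S1 ((opn g)%:C *: id1)) (op_tensor t f g)
    (op_tensor t S2 ((opn g)%:C *: id1)).
Proof.
move=> p1 p2 blk; set c := opn g; have c0 : 0 <= c by exact: opn_ge0.
have pc S : positive S -> positive (op_tensor t S (c%:C *: id1)).
  move=> pS; apply: (op_tensor_positive tt one onk) => //.
  by apply: positiveZ => //; exact: positive1.
apply/(block_positiveP onk); [exact: pc|exact: pc|move=> u v].
rewrite !(op_tensorZr tt one) !bopZE !innerZl !cReZ.
have [cE|cN] := eqVneq c 0.
  have g0 : g = 0.
    apply: bop_ext => x; apply: nrm_eq0; apply/eqP; rewrite eq_le nrm_ge0 andbT.
    by apply: (le_trans (nrm_bop g x)); rewrite -/c cE mul0r.
  rewrite cE g0 -(scale0r id1) (op_tensorZr tt one) scale0r bop0E inner0l /=.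
  by rewrite !mul0r mulr0 !addr0.
have cp : 0 < c by rewrite lt_neqAle eq_sym cN.
have p1' : positive (op_tensor t S1 id1).
  by apply: (op_tensor_positive tt one onk) => //; exact: positive1.
have p2' : positive (op_tensor t S2 id1).
  by apply: (op_tensor_positive tt one onk) => //; exact: positive1.
have := block_positive_tensor1 p1 p2 blk.
move=> /(block_positiveP onk _ p1' p2')/(_ (c%:C *: u) (op_tensor t id1 g v)).
rewrite (linZ (bop_lin _)) !innerZl !innerZr conjc_real !cReZ -bop_compE.
rewrite (op_tensor_comp tt one) bop_comp1 bop_1comp.
set a := complex.Re (inner _ u); set m := complex.Re (inner _ u); set d := complex.Re _.
have dle : d <= c ^+ 2 * complex.Re (inner (op_tensor t S2 id1 v) v).
  have gg u' : inner ((adjoint g \oc g) u') u' = (nrm (g u') ^+ 2)%:C.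
    by rewrite bop_compE -(adjointPr one) inner_nrm2.
  have pB : positive ((c ^+ 2)%:C *: id1 - adjoint g \oc g).
    move=> u'; rewrite bopBE innerBl gg bopZE innerZl bop1E inner_nrm2 -rmorphM -rmorphB ler0c.
    by rewrite subr_ge0 -exprMn ler_pXn2r ?nnegrE ?mulr_ge0 // nrm_bop.
  have := positive_ge0 v (op_tensor_positive tt one onk p2 pB).
  rewrite (op_tensorDr tt one) (op_tensorNr tt one) (op_tensorZr tt one _ _ id1).
  rewrite bopBE innerBl bopZE innerZl cReD cReN cReZ subr_ge0; congr (_ <= _).
  rewrite /d; congr complex.Re.
  have -> : op_tensor t S2 (adjoint g \oc g) =
      op_tensor t id1 (adjoint g) \oc (op_tensor t S2 id1 \oc op_tensor t id1 g).
    by rewrite !(op_tensor_comp tt one) bop_1comp bop_comp1 bop_1comp.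
  rewrite bop_compE -[in RHS]bop_compE.
  rewrite (op_tensor_adj tt one onk (A' := id1) (B' := g)) //.
  by move=> x y; rewrite -(adjointPr one).
set q := complex.Re (inner (op_tensor t S2 id1 v) v) in dle *.
have -> : c * (c * a) = c ^+ 2 * a by ring.
move=> h.
have h2 : 0 <= c * (c * a + 2 * m + c * q) by lra.
by rewrite -(pmulr_rge0 _ cp).
Qed.

End TensorBlocks.

Section RotatedParts.
Variables (R : realType) (H : hilbertType R) (e : nat -> H).
Hypothesis one : onseq e.
Implicit Types (A : bop H) (w : R[i]).

(* (|A| 1 + Re (w A)) / 2, which is positive when w has modulus 1; the four
   rotations w = 1, -1, -i, i recombine to A. *)
Definition rotated_part w A : bop H :=
  (2^-1)%:C *: ((opn A)%:C *: bop1 H + (2^-1)%:C *: (w *: A + conjc w *: adjoint A)).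

Lemma rotated_part_positive w A : normc w = 1 -> positive (rotated_part w A).
Proof.
move=> w1 u.
have -> : inner (rotated_part w A u) u =
    (2^-1 * (opn A * nrm u ^+ 2 + complex.Re (w * inner (A u) u)))%:C.
  rewrite /rotated_part bopZE bopDE !bopZE bopDE !bopZE bop1E.
  rewrite innerZl innerDl !innerZl innerDl !innerZl -(adjointPr one) inner_nrm2.
  rewrite (innerC u).
  by apply: complex_ext; rewrite !(cReZ, cReD, cImZ, cImD, cReM, cImM, cReJ, cImJ) /=; field.
rewrite ler0c mulr_ge0 ?invr_ge0 //.
have h1 : - complex.Re (w * inner (A u) u) <= opn A * nrm u ^+ 2.
  apply: (le_trans (ler_norm _)); rewrite normrN.
  apply: (le_trans (ler_Re_normc _)); rewrite normcM w1 mul1r.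
  apply: (le_trans (cauchy_schwarz _ _)).
  by rewrite expr2 mulrA ler_wpM2r // nrm_bop.
lra.
Qed.

Lemma rotated_part_decomposition A :
  A = rotated_part 1 A - rotated_part (-1) A + 'i%C *: rotated_part (- 'i%C) A
      - 'i%C *: rotated_part 'i%C A.
Proof.
apply: bop_ext => u; apply: inner_inj => v.
rewrite /rotated_part !(bopDE, bopNE, bopZE) !(innerDl, innerNl, innerZl).
by apply: complex_ext;
  rewrite !(cReZ, cReD, cImZ, cImD, cReM, cImM, cReN, cImN, cReJ, cImJ) /=; field.
Qed.

Lemma rotated_part_sum A :
  rotated_part 1 A + rotated_part (-1) A + rotated_part (- 'i%C) A + rotated_part 'i%C A
  = (2 * opn A)%:C *: bop1 H.
Proof.
apply: bop_ext => u; apply: inner_inj => v.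
rewrite /rotated_part !(bopDE, bopNE, bopZE) !(innerDl, innerNl, innerZl).
by apply: complex_ext;
  rewrite !(cReZ, cReD, cImZ, cImD, cReM, cImM, cReN, cImN, cReJ, cImJ) /=; field.
Qed.

End RotatedParts.

Section TensorDecomposition.
Variables (R : realType) (H K : hilbertType R) (t : H -> H -> K).
Hypothesis tt : is_tensor t.
Variable e : nat -> H.
Hypothesis one : onseq e.
Local Notation T := (op_tensor t).

Lemma op_tensor_decomposition (f1 f2 f3 f4 g1 g2 g3 g4 : bop H) :
  T (f1 - f2 + 'i%C *: f3 - 'i%C *: f4) (g1 - g2 + 'i%C *: g3 - 'i%C *: g4) =
  (T f1 g1 + T f2 g2 + T f3 g4 + T f4 g3) - (T f1 g2 + T f2 g1 + T f3 g3 + T f4 g4)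
  + 'i%C *: (T f1 g3 + T f2 g4 + T f3 g1 + T f4 g2)
  - 'i%C *: (T f1 g4 + T f2 g3 + T f3 g2 + T f4 g1).
Proof.
rewrite !(op_tensorDl tt one, op_tensorDr tt one, op_tensorNl tt one, op_tensorNr tt one,
  op_tensorZl tt one, op_tensorZr tt one).
apply: bop_ext => u; apply: inner_inj => v.
rewrite !(bopDE, bopNE, bopZE) !(innerDl, innerNl, innerZl).
by apply: complex_ext;
  rewrite !(cReD, cImD, cReN, cImN, cReM, cImM) /=; ring.
Qed.

Lemma op_tensor_sum4 (f1 f2 f3 f4 g1 g2 g3 g4 : bop H) :
  T (f1 + f2 + f3 + f4) (g1 + g2 + g3 + g4) =
  (T f1 g1 + T f2 g2 + T f3 g4 + T f4 g3) + (T f1 g2 + T f2 g1 + T f3 g3 + T f4 g4)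
  + (T f1 g3 + T f2 g4 + T f3 g1 + T f4 g2) + (T f1 g4 + T f2 g3 + T f3 g2 + T f4 g1).
Proof.
rewrite !(op_tensorDl tt one, op_tensorDr tt one).
apply: bop_ext => u; apply: inner_inj => v; rewrite !bopDE !innerDl.
by ring.
Qed.

End TensorDecomposition.

Lemma le_ereal_inf_scale (R : realType) (A B : set (\bar R)) (k : R) : 0 <= k ->
  (exists2 z, B z & (z < +oo)%E) -> (forall z, B z -> (0 <= z)%E) ->
  (forall z, B z -> (z < +oo)%E -> exists2 y, A y & (y <= k%:E * z)%E) ->
  (ereal_inf A <= k%:E * ereal_inf B)%E.
Proof.
move=> k0 [z0 Bz0 z0oo] B0 h.
have [kE|kN] := eqVneq k 0.
  have [y Ay] := h _ Bz0 z0oo; rewrite kE !mul0e => y0.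
  exact: le_trans (ereal_inf_lbound Ay) y0.
have kp : 0 < k by rewrite lt_neqAle eq_sym kN.
rewrite -lee_pdivrMl //; apply: le_ereal_inf_tmp => z Bz; rewrite lee_pdivrMl //.
have [zoo|] := ltP z +oo%E.
  by have [y Ay yz] := h _ Bz zoo; exact: le_trans (ereal_inf_lbound Ay) yz.
by rewrite leye_eq => /eqP ->; rewrite gt0_muley ?lte_fin // leey.
Qed.

Section Norms.
Variables (R : realType) (H : hilbertType R) (I : countType) (e : I -> H).
Hypothesis onbe : onb e.
Variables (X : ptopologicalType) (nu : set (borel X) -> bop H) (rho : bop H).
Local Notation mu := (nu_rho e nu rho).

Lemma essnorm_bound f : (essnorm e nu rho f < +oo)%E ->
  exists G : R, [/\ 0 <= G, essnorm e nu rho f = G%:E &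
    {ae mu, forall x, (opnorm (f x) <= G%:E)%E}].
Proof.
move=> foo; have f0 : (0 <= essnorm e nu rho f)%E by exact: Lnorm_ge0.
have fin : essnorm e nu rho f \is a fin_num by rewrite ge0_fin_numE.
exists (fine (essnorm e nu rho f)); rewrite fineK //; split => //; first exact: fine_ge0.
rewrite /essnorm unlock; case: ifPn => [_|].
  apply: filterS (ess_sup_ge mu (abse \o (fun x => opnorm (f x)))) => x /=.
  by rewrite gee0_abs // opnorm_ge0.
rewrite -leNgt => mu0; exists setT; split => //.
by apply/eqP; rewrite eq_le mu0 measure_ge0.
Qed.

Hypothesis st : state e rho.

Lemma sup_integral_ge0 F : pos_fun F -> (0 <= sup_integral e nu rho F)%E.
Proof.
move=> pF; apply: (le_trans _ (ereal_sup_ubound _)); last by exists rho.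
apply: integral_ge0 => x _; rewrite lee_fin twistE; apply: (state_trace_ge0 onbe st).
by apply: positive_conj => //; apply: positive_sa; exact: opsqrt_positive.
Qed.

Lemma pos_fun_sum4 (V : hilbertType R) (f1 f2 f3 f4 : borel X -> bop V) :
  pos_fun f1 -> pos_fun f2 -> pos_fun f3 -> pos_fun f4 -> pos_fun (f1 + f2 + f3 + f4).
Proof. by move=> p1 p2 p3 p4 x; do 3 (apply: positiveD => //). Qed.

Lemma norm1_ge0 f : (0 <= norm1 e nu rho f)%E.
Proof.
apply: le_ereal_inf_tmp => _ [f1 [f2 [f3 [f4 [[_ p1] [_ p2] [_ p3] [_ p4] [_ ->]]]]]].
by apply: sup_integral_ge0; exact: pos_fun_sum4.
Qed.

End Norms.

Section TensorNorms.
Variables (R : realType) (H K : hilbertType R) (t : H -> H -> K).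
Hypothesis tt : is_tensor t.
Variables (I J : countType) (e : I -> H) (b : J -> K).
Hypotheses (onbe : onb e) (onbb : onb b).
Let one := onseq_onenum onbe.
Let onk := onseq_onenum onbb.
Variables (X : ptopologicalType) (nu : set (borel X) -> bop H) (rho : bop H).
Local Notation mu := (nu_rho e nu rho).
Variables (D : borel X -> bop H) (M : R).
Hypotheses (mD : wmeas D) (pD : forall x, positive (D x)) (M0 : 0 <= M).
Hypothesis bD : forall x u, nrm (D x u) <= M * nrm u.
Hypothesis aeD : {ae mu, forall x, rn e nu rho x = D x}.
Variables (omega : set (borel X) -> bop K) (sigma : bop K).
Hypothesis omegaE : forall E u v, measurable E ->
  inner (omega E u) v = cintegral mu E (fun x => inner (tensor_density t D x u) v).
Hypotheses (str : state e rho) (st : state b sigma) (fr : full_rank sigma).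
Local Notation lam := (nu_rho b omega sigma).

Lemma norm1_tensor (f g g1 g2 g3 g4 : borel X -> bop H) (c : borel X -> R) (G : R) :
  (norm1 e nu rho f < +oo)%E ->
  (wmeas g1 /\ pos_fun g1) -> (wmeas g2 /\ pos_fun g2) ->
  (wmeas g3 /\ pos_fun g3) -> (wmeas g4 /\ pos_fun g4) ->
  (forall x, g x = g1 x - g2 x + 'i%C *: g3 x - 'i%C *: g4 x) ->
  (forall x, g1 x + g2 x + g3 x + g4 x = (c x)%:C *: bop1 H) ->
  measurable_fun setT c -> (forall x, 0 <= c x) -> 0 <= G ->
  {ae mu, forall x, c x <= G} ->
  L1 b omega sigma (fun_tensor t f g) /\
  (norm1 b omega sigma (fun_tensor t f g) <= (M * G)%:E * norm1 e nu rho f)%E.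
Proof.
move=> foo [mg1 pg1] [mg2 pg2] [mg3 pg3] [mg4 pg4] gE gS mc c0 G0 cG.
have MG0 : 0 <= M * G by rewrite mulr_ge0.
pose T (a a' : borel X -> bop H) : borel X -> bop K := fun x => op_tensor t (a x) (a' x).
have mT a a' : wmeas a -> wmeas a' -> wmeas (T a a') by exact: (wmeas_op_tensor tt one onk).
have pT a a' : pos_fun a -> pos_fun a' -> pos_fun (T a a').
  by move=> pa pa' x; exact: (op_tensor_positive tt one onk).
have LH4 a1 a2 a3 a4 : wmeas a1 /\ pos_fun a1 -> wmeas a2 /\ pos_fun a2 ->
    wmeas a3 /\ pos_fun a3 -> wmeas a4 /\ pos_fun a4 ->
    LH b (a1 + a2 + a3 + a4 : borel X -> bop K) /\ pos_fun (a1 + a2 + a3 + a4).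
  move=> [m1 p1] [m2 p2] [m3 p3] [m4 p4].
  have p : pos_fun (a1 + a2 + a3 + a4) by exact: pos_fun_sum4.
  by split => //; apply: (LH_pos onbb) => //; do 3 (apply: wmeasD => //).
pose B := [set z | exists f1 f2 f3 f4 : borel X -> bop H,
    [/\ LH e f1 /\ pos_fun f1, LH e f2 /\ pos_fun f2,
        LH e f3 /\ pos_fun f3, LH e f4 /\ pos_fun f4 &
        f = f1 - f2 + 'i *: f3 - 'i *: f4 /\
        z = sup_integral e nu rho (f1 + f2 + f3 + f4)]].
have step z : B z -> (z < +oo)%E -> exists h1 h2 h3 h4 : borel X -> bop K,
    [/\ LH b h1 /\ pos_fun h1, LH b h2 /\ pos_fun h2,
        LH b h3 /\ pos_fun h3, LH b h4 /\ pos_fun h4 &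
        fun_tensor t f g = h1 - h2 + 'i *: h3 - 'i *: h4 /\
        (sup_integral b omega sigma (h1 + h2 + h3 + h4)%R <= (M * G)%:E * z)%E].
  move=> [f1 [f2 [f3 [f4 [[l1 p1] [l2 p2] [l3 p3] [l4 p4] [fE ->]]]]]] zoo.
  have pF : pos_fun (f1 + f2 + f3 + f4) by exact: pos_fun_sum4.
  have m1 := LHP onbe l1; have m2 := LHP onbe l2.
  have m3 := LHP onbe l3; have m4 := LHP onbe l4.
  have mF : wmeas (f1 + f2 + f3 + f4) by do 3 (apply: wmeasD => //).
  have z0 := sup_integral_ge0 onbe nu str pF.
  have zE : sup_integral e nu rho (f1 + f2 + f3 + f4) =
      (fine (sup_integral e nu rho (f1 + f2 + f3 + f4)))%:E.
    by rewrite fineK // ge0_fin_numE.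
  exists (T f1 g1 + T f2 g2 + T f3 g4 + T f4 g3), (T f1 g2 + T f2 g1 + T f3 g3 + T f4 g4),
    (T f1 g3 + T f2 g4 + T f3 g1 + T f4 g2), (T f1 g4 + T f2 g3 + T f3 g2 + T f4 g1).
  split; try by apply: LH4; split; auto.
  split.
    apply/funext => x; rewrite /fun_tensor gE fE -!complexiE.
    exact: (op_tensor_decomposition tt one).
  have -> : (T f1 g1 + T f2 g2 + T f3 g4 + T f4 g3) + (T f1 g2 + T f2 g1 + T f3 g3 + T f4 g4)
      + (T f1 g3 + T f2 g4 + T f3 g1 + T f4 g2) + (T f1 g4 + T f2 g3 + T f3 g2 + T f4 g1)
      = fun x => op_tensor t ((f1 + f2 + f3 + f4) x) ((c x)%:C *: bop1 H).
    by apply/funext => x; rewrite -gS; exact/esym/(op_tensor_sum4 tt one).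
  rewrite zE -EFinM.
  apply: (key_inequality tt onbe onbb mD pD M0 bD aeD omegaE st fr mF pF) => //.
    exact: fine_ge0.
  by rewrite -zE.
have [z0 Bz0 z0oo] : exists2 z, B z & (z < +oo)%E.
  by have /ereal_inf_lt[z Bz zoo] := foo; exists z.
have le : (norm1 b omega sigma (fun_tensor t f g) <= (M * G)%:E * norm1 e nu rho f)%E.
  apply: (@le_ereal_inf_scale _ _ B) => //.
  - by exists z0.
  - move=> _ [f1 [f2 [f3 [f4 [[_ p1] [_ p2] [_ p3] [_ p4] [_ ->]]]]]].
    by apply: (sup_integral_ge0 onbe) => //; exact: pos_fun_sum4.
  - move=> z Bz zoo; have [h1 [h2 [h3 [h4 [k1 k2 k3 k4 [hE hle]]]]]] := step z Bz zoo.
    by exists (sup_integral b omega sigma (h1 + h2 + h3 + h4)) => //; exists h1, h2, h3, h4.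
split => //; split; last first.
  apply: (le_lt_trans le); have f0 := norm1_ge0 onbe nu str f.
  by rewrite lte_mul_pinfty ?lee_fin // ge0_fin_numE.
have [h1 [h2 [h3 [h4 [[l1 p1] [l2 p2] [l3 p3] [l4 p4] [hE _]]]]]] := step z0 Bz0 z0oo.
exists 4, (fun k : 'I_4 => [:: 1; -1; 'i; - 'i]`_k), (fun k : 'I_4 => nth h1 [:: h1; h2; h3; h4] k).
split.
  by case=> -[|[|[|[|//]]]] i /=; split => //; apply/(qrvP onbb); exact: (LHP onbb).
by rewrite !big_ord_recl big_ord0 /= hE scale1r scaleN1r scaleNr addr0 !addrA.
Qed.

Variables (g : borel X -> bop H) (G : R).
Hypotheses (sepH : separable H) (mg : wmeas g) (G0 : 0 <= G).
Hypothesis gG : {ae mu, forall x, (opnorm (g x) <= G%:E)%E}.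

Let mopn : measurable_fun setT (fun x => opn (g x)).
Proof. exact: (measurable_opn one sepH mg). Qed.

Let opnG : {ae mu, forall x, opn (g x) <= G}.
Proof. by apply: filterS gG => x; rewrite opnE lee_fin. Qed.

Lemma norm1_fun_tensor f : (norm1 e nu rho f < +oo)%E ->
  L1 b omega sigma (fun_tensor t f g) /\
  (norm1 b omega sigma (fun_tensor t f g) <= (M * (2 * G))%:E * norm1 e nu rho f)%E.
Proof.
move=> foo.
have mr w : wmeas (fun x => rotated_part w (g x)).
  apply: wmeasZc; apply: wmeasD.
    by apply: wmeasZ; [split => //; exact: measurable_cst|exact: wmeas_cst].
  apply: wmeasZc; apply: wmeasD; first exact: wmeasZc.
  by apply: wmeasZc; exact: (wmeas_adjoint one).
have i1 : normc ('i%C : R[i]) = 1 by rewrite /= expr0n expr1n add0r sqrtr1.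
have pr w : normc w = 1 -> pos_fun (fun x => rotated_part w (g x)).
  by move=> w1 x; exact: (rotated_part_positive one).
apply: (norm1_tensor (g1 := fun x => rotated_part 1 (g x))
  (g2 := fun x => rotated_part (-1) (g x)) (g3 := fun x => rotated_part (- 'i%C) (g x))
  (g4 := fun x => rotated_part 'i%C (g x)) (c := fun x => 2 * opn (g x))) => //.
- by split => //; apply: pr; exact: Normc.normc1.
- by split => //; apply: pr; exact: (etrans (normcN _) (Normc.normc1 _)).
- by split => //; apply: pr; exact: (etrans (normcN _) i1).
- by split => //; exact: pr.
- by move=> x; exact: rotated_part_decomposition.
- by move=> x; exact: rotated_part_sum.
- by apply: measurable_funM => //; exact: measurable_cst.
- by move=> x; rewrite mulr_ge0 // opn_ge0.
- by rewrite mulr_ge0.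
- by apply: filterS opnG => x h; rewrite ler_pM2l.
Qed.

Lemma norm1_tensor_opn S : (norm1 e nu rho S < +oo)%E ->
  (norm1 b omega sigma (fun_tensor t S (fun x => (opn (g x))%:C *: bop1 H)) <=
    (M * G)%:E * norm1 e nu rho S)%E.
Proof.
move=> Soo.
have [] := @norm1_tensor S (fun x => (opn (g x))%:C *: bop1 H)
  (fun x => (opn (g x))%:C *: bop1 H) 0 0 0 (fun x => opn (g x)) G => //.
- split; first by apply: wmeasZ; [split => //; exact: measurable_cst|exact: wmeas_cst].
  by move=> x; apply: positiveZ; [exact: opn_ge0|exact: positive1].
- by split; [exact: wmeas_cst|move=> x; exact: positive0].
- by split; [exact: wmeas_cst|move=> x; exact: positive0].
- by split; [exact: wmeas_cst|move=> x; exact: positive0].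
- by move=> x; rewrite !scaler0 !subr0 addr0.
- by move=> x; rewrite !addr0.
- by move=> x; exact: opn_ge0.
Qed.

Lemma norm1dec_fun_tensor f : (norm1 e nu rho f < +oo)%E ->
  (norm1dec b omega sigma (fun_tensor t f g) <= (M * G)%:E * norm1dec e nu rho f)%E.
Proof.
move=> foo; apply: le_ereal_inf_scale; first by rewrite mulr_ge0.
- have /ereal_inf_lt[_ [f1 [f2 [f3 [f4 [[l1 p1] [l2 p2] [l3 p3] [l4 p4] [fE ->]]]]]] zoo] := foo.
  have pF : pos_fun (f1 + f2 + f3 + f4) by exact: pos_fun_sum4.
  have lF : LH e (f1 + f2 + f3 + f4).
    by apply: (LH_pos onbe) => //; do 3 (apply: wmeasD; last exact: (LHP onbe));
      exact: (LHP onbe).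
  exists (maxe (norm1 e nu rho (f1 + f2 + f3 + f4)) (norm1 e nu rho (f1 + f2 + f3 + f4))).
    exists (f1 + f2 + f3 + f4), (f1 + f2 + f3 + f4); split => //.
    apply: aeW => x; rewrite fE -!complexiE.
    exact: (block_positive_decomposition one).
  rewrite maxxx; apply: le_lt_trans zoo; apply: ereal_inf_lbound.
  have l0 : LH e (0 : borel X -> bop H).
    by apply: (LH_pos onbe); [exact: wmeas_cst|move=> x; exact: positive0].
  have p0 : pos_fun (0 : borel X -> bop H) by move=> x; exact: positive0.
  exists (f1 + f2 + f3 + f4), 0, 0, 0; split; [by []|by []|by []|by []|].
  by split; rewrite ?scaler0 ?subr0 ?addr0.
- by move=> _ [S1 [S2 [_ _ _ ->]]]; rewrite le_max norm1_ge0.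
move=> _ [S1 [S2 [[l1 p1] [l2 p2] blk ->]]]; rewrite gt_max => /andP[oo1 oo2].
pose c x := (opn (g x))%:C *: bop1 H.
have mc : wmeas c by apply: wmeasZ; [split => //; exact: measurable_cst|exact: wmeas_cst].
have LHc S : LH e S -> pos_fun S ->
    LH b (fun_tensor t S c) /\ pos_fun (fun_tensor t S c).
  move=> lS pS; have p : pos_fun (fun_tensor t S c).
    move=> x; apply: (op_tensor_positive tt one onk); first exact: pS.
    by apply: positiveZ; [exact: opn_ge0|exact: positive1].
  split => //; apply: (LH_pos onbb) => //.
  by apply: (wmeas_op_tensor tt one onk) => //; exact: (LHP onbe).
exists (maxe (norm1 b omega sigma (fun_tensor t S1 c)) (norm1 b omega sigma (fun_tensor t S2 c))).
  exists (fun_tensor t S1 c), (fun_tensor t S2 c); split => //; try exact: LHc.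
  have [N [mN N0 hN]] := blk; exists N; split => //.
    have /null_content_dominatesP := nu_sigma_dominated tt onbe onbb mD pD M0 bD omegaE st.
    exact.
  move=> x /= hx; apply: hN => /= h; apply: hx.
  by apply: (block_positive_tensor tt one onk).
have MG0 : (0 <= (M * G)%:E)%E by rewrite lee_fin mulr_ge0.
rewrite maxe_pMr //.
by rewrite ge_max !le_max !norm1_tensor_opn // orbT.
Qed.

End TensorNorms.

Lemma povm_tensorE (R : realType) (H K : hilbertType R) (t : H -> H -> K)
    (I J : countType) (e : I -> H) (b : J -> K) (X : ptopologicalType)
    (nu : set (borel X) -> bop H) (rho : bop H) (D : borel X -> bop H) (M : R) :
  is_tensor t -> onb e -> onb b -> wmeas (rn e nu rho) -> wmeas D ->
  (forall x, positive (D x)) -> 0 <= M -> (forall x u, nrm (D x u) <= M * nrm u) ->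
  {ae nu_rho e nu rho, forall x, rn e nu rho x = D x} ->
  forall E u v, measurable E ->
  inner (povm_tensor e b t nu rho E u) v =
  cintegral (nu_rho e nu rho) E (fun x => inner (tensor_density t D x u) v).
Proof.
move=> tt onbe onbb mrn mD pD M0 bD aeD E u v mE.
have one := onseq_onenum onbe; have onk := onseq_onenum onbb.
have mP := wmeas_tensor_density tt onbe onbb mD.
have bP := nrm_tensor_density tt onbe onbb M0 bD.
have [A hA] := cintegral_bop (nu_rho e nu rho) onk (mulr_ge0 M0 M0) mP bP mE.
rewrite -hA; suff -> : povm_tensor e b t nu rho E = A by [].
have ex : has_matrix b (fun i j => cintegral (nu_rho e nu rho) E (fun x =>
      inner (op_tensor t (rn e nu rho x) (rn e nu rho x) (b j)) (b i))) A.
  move=> i j; rewrite hA; apply: cintegral_ae => //.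
    by apply: (wmeas_op_tensor tt one onk).
  by apply: filterS aeD => x ->.
have ex' := xgetPex 0 (ex_intro _ _ ex).
apply: (bop_inner_ext onk) => m n; rewrite /onenum.
case: pickle_inv => [j|]; last by rewrite !(lin0 (bop_lin _)) !inner0l.
case: pickle_inv => [i|]; last by rewrite !inner0r.
by rewrite ex' ex.
Qed.

Theorem theorem4p6 (R : realType) (H K : hilbertType R)
    (I J : countType) (e : I -> H) (b : J -> K) (t : H -> H -> K)
    (X : ptopologicalType) (nu : set (borel X) -> bop H)
    (rho : bop H) (sigma : bop K) (f g : borel X -> bop H) :
  separable H -> onb e ->
  is_tensor t -> onb b ->
  hausdorff_space X -> locally_compact [set: X] ->
  povm e nu ->
  state e rho -> full_rank rho ->
  {ae nu_rho e nu rho, forall x, exists A, has_matrix e (rn_matrix e nu rho x) A} ->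
  state b sigma -> full_rank sigma ->
  Linfty e nu rho (rn e nu rho) ->
  {ae nu_rho e nu rho, forall x, invertible (rn e nu rho x)} ->
  L1 e nu rho f ->
  Linfty e nu rho g ->
  let omega := povm_tensor e b t nu rho in
  [/\ L1 b omega sigma (fun_tensor t f g),
      (norm1 b omega sigma (fun_tensor t f g) <=
         2%:E * essnorm e nu rho (rn e nu rho) * norm1 e nu rho f *
         essnorm e nu rho g)%E &
      (norm1dec b omega sigma (fun_tensor t f g) <=
         essnorm e nu rho (rn e nu rho) * norm1dec e nu rho f *
         essnorm e nu rho g)%E].
Proof.
move=> sepH onbe tt onbb _ _ pv str frr rn_ex st fr [qrn rnoo] _ [_ foo] [qg goo] omega.
have mrn : wmeas (rn e nu rho) by apply/(qrvP onbe).
have mg : wmeas g by apply/(qrvP onbe).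
have [M [M0 -> rnM]] := essnorm_bound rnoo.
have [G [G0 -> gG]] := essnorm_bound goo.
have [D [mD pD bD aeD]] := rn_version onbe pv str frr sepH rn_ex mrn M0 rnM.
have omegaE := povm_tensorE tt onbe onbb mrn mD pD M0 bD aeD.
have [L1fg le1] := norm1_fun_tensor tt onbe onbb mD pD M0 bD aeD omegaE str st fr
  sepH mg G0 gG foo.
have le2 := norm1dec_fun_tensor tt onbe onbb mD pD M0 bD aeD omegaE str st fr
  sepH mg G0 gG foo.
split => //.
  apply: (le_trans le1); rewrite muleAC -!EFinM.
  by rewrite (_ : M * (2 * G) = 2 * M * G) //; ring.
by apply: (le_trans le2); rewrite muleAC -EFinM.
Qed.
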